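(* Let $W$ be a binary-input cq channel, fix $R<I(W)$ and $\beta<1/2$. For each $N=2^n$ let $\mathcal A_N\subset\{1,\dots,N\}$ be any set with $|\mathcal A_N|=\lfloor NR\rfloor$ satisfying the polar coding rule $F(W_N^{(i)})\le F(W_N^{(j)})$ for all $i\in\mathcal A_N$, $j\notin\mathcal A_N$, and let $P_e(N,R)=P_e(N,\lfloor NR\rfloor,\mathcal A_N)$. Then $P_e(N,R)=o\big(2^{-\frac12N^\beta}\big)$.
   Context: A binary-input cq channel $W$ assigns to $x\in\{0,1\}$ a density operator $\rho_x$ on a finite-dimensional Hilbert space. For $V:x\mapsto\sigma_x$: $I(V)=H(\tfrac12(\sigma_0+\sigma_1))-\tfrac12H(\sigma_0)-\tfrac12H(\sigma_1)$ with $H(\sigma)=-\mathrm{Tr}\{\sigma\log_2\sigma\}$, and $F(V)=\|\sqrt{\sigma_0}\sqrt{\sigma_1}\|_1^2$. Channel combining: for $N=2^n$ define $\rho_{u^N}$ on $B^N$ recursively by $\rho_{u_1}=\rho_{u_1}$ ($N=1$) and $\rho_{u^{2N}}=\rho^{B_1\cdots B_N}_{u_o\oplus u_e}\otimes\rho^{B_{N+1}\cdots B_{2N}}_{u_e}$ with $u_o=(u_1,u_3,\dots)$, $u_e=(u_2,u_4,\dots)$. Let $\overline\rho_{u_1^i}=\sum_{u_{i+1}^N}2^{-(N-i)}\rho_{u^N}$ and split channel $W_N^{(i)}:u_i\mapsto\sum_{u_1^{i-1}}2^{-(i-1)}|u_1^{i-1}\rangle\langle u_1^{i-1}|\otimes\overline\rho_{u_1^i}$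 (classical register with orthonormal basis $\{|u_1^{i-1}\rangle\}$). Decoder: for $i\in\mathcal A$, $\Pi_{(i),u_1^{i-1}0}=\{\sqrt{\overline\rho_{u_1^{i-1}0}}-\sqrt{\overline\rho_{u_1^{i-1}1}}\ge0\}$ (projector onto nonnegative eigenspace), $\Pi_{(i),u_1^{i-1}1}=I-\Pi_{(i),u_1^{i-1}0}$; for $i\notin\mathcal A$, $\Pi_{(i),u_1^{i-1}u_i}=I$. With $\Pi_i=\Pi_{(i),u_1^{i-1}u_i}$, $P_e(N,K,\mathcal A)=1-2^{-N}\sum_{u^N\in\{0,1\}^N}\mathrm{Tr}\{\Pi_N\cdots\Pi_1\rho_{u^N}\Pi_1\cdots\Pi_N\}$ (block error probability of quantum successive cancellation decoding averaged uniformly over information and frozen bits). *)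

(* Defs.v *)
From Stdlib Require Import Reals ClassicalEpsilon Arith.
Open Scope R_scope.

Definition C := (R * R)%type.
Definition C0 : C := (0, 0).
Definition C1 : C := (1, 0).
Definition RtoC (r : R) : C := (r, 0).
Definition Cadd (a b : C) : C := (fst a + fst b, snd a + snd b).
Definition Copp (a : C) : C := (- fst a, - snd a).
Definition Cmul (a b : C) : C :=
  (fst a * fst b - snd a * snd b, fst a * snd b + snd a * fst b).
Definition Cconj (a : C) : C := (fst a, - snd a).
Definition Re (a : C) : R := fst a.

Fixpoint csum (n : nat) (f : nat -> C) : C :=
  match n with O => C0 | S m => Cadd (csum m f) (f m) end.

(* ---------- matrices: only the entries with indices < d are meaningful ---------- *)
Definition Mat := nat -> nat -> C.
Definition madd (A B : Mat) : Mat := fun i j => Cadd (A i j) (B i j).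
Definition msub (A B : Mat) : Mat := fun i j => Cadd (A i j) (Copp (B i j)).
Definition mscale (r : R) (A : Mat) : Mat := fun i j => Cmul (RtoC r) (A i j).
Definition mzero : Mat := fun _ _ => C0.
Definition mid : Mat := fun i j => if Nat.eqb i j then C1 else C0.
Definition mmul (d : nat) (A B : Mat) : Mat :=
  fun i j => csum d (fun k => Cmul (A i k) (B k j)).
Definition adj (A : Mat) : Mat := fun i j => Cconj (A j i).
Definition trace (d : nat) (A : Mat) : C := csum d (fun i => A i i).
Definition meq (d : nat) (A B : Mat) : Prop :=
  forall i j, (i < d)%nat -> (j < d)%nat -> A i j = B i j.
Definition diagm (lam : nat -> R) : Mat :=
  fun i j => if Nat.eqb i j then RtoC (lam i) else C0.
Definition unitary (d : nat) (U : Mat) : Prop := meq d (mmul d (adj U) U) mid.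
Definition hermitian (d : nat) (A : Mat) : Prop := meq d (adj A) A.

Definition spectral_decomp (d : nat) (A U : Mat) (lam : nat -> R) : Prop :=
  unitary d U /\ meq d A (mmul d (mmul d U (diagm lam)) (adj U)).

(* functional calculus f(A) = U diag(f lam) U^* for a Hermitian A
   (via a chosen spectral decomposition; zero matrix if none exists) *)
Definition matfun (d : nat) (f : R -> R) (A : Mat) : Mat :=
  let P := fun Ul : Mat * (nat -> R) => spectral_decomp d A (fst Ul) (snd Ul) in
  match excluded_middle_informative (exists Ul, P Ul) with
  | left H =>
      let Ul := proj1_sig (constructive_indefinite_description P H) in
      mmul d (mmul d (fst Ul) (diagm (fun k => f (snd Ul k)))) (adj (fst Ul))
  | right _ => mzero
  end.

Definition sqrtm (d : nat) (A : Mat) : Mat := matfun d sqrt A.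
Definition nonneg_proj (d : nat) (A : Mat) : Mat :=
  matfun d (fun x => if Rle_dec 0 x then 1 else 0) A.

Definition psd (d : nat) (A : Mat) : Prop :=
  hermitian d A /\
  forall v : nat -> C,
    0 <= Re (csum d (fun i => csum d (fun j => Cmul (Cconj (v i)) (Cmul (A i j) (v j))))).
Definition density (d : nat) (A : Mat) : Prop := psd d A /\ trace d A = C1.

Definition xlog2x (x : R) : R := if Rlt_dec 0 x then x * (ln x / ln 2) else 0.
Definition entropy (d : nat) (A : Mat) : R := - Re (trace d (matfun d xlog2x A)).

Definition mutinf (d : nat) (s0 s1 : Mat) : R :=
  entropy d (mscale (1/2) (madd s0 s1)) - entropy d s0 / 2 - entropy d s1 / 2.
Definition tnorm (d : nat) (A : Mat) : R := Re (trace d (sqrtm d (mmul d (adj A) A))).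
Definition fid (d : nat) (s0 s1 : Mat) : R := (tnorm d (mmul d (sqrtm d s0) (sqrtm d s1))) ^ 2.

Definition kron (dB : nat) (A B : Mat) : Mat :=
  fun i j => Cmul (A (i / dB)%nat (j / dB)%nat) (B (i mod dB)%nat (j mod dB)%nat).

(* bit sequences u^N are functions nat -> bool; u_k (1-based) is u (k-1) *)
Definition upd (u : nat -> bool) (s : nat) (b : bool) : nat -> bool :=
  fun k => if Nat.eqb k s then b else u k.

Fixpoint rho_comb (rho : bool -> Mat) (d n : nat) (u : nat -> bool) : Mat :=
  match n with
  | O => rho (u 0%nat)
  | S m => kron (d ^ (2 ^ m))
             (rho_comb rho d m (fun k => xorb (u (2 * k)%nat) (u (2 * k + 1)%nat)))
             (rho_comb rho d m (fun k => u (2 * k + 1)%nat))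
  end.

Fixpoint ext_fold {T : Type} (add : T -> T -> T) (m s : nat) (u : nat -> bool)
  (F : (nat -> bool) -> T) : T :=
  match m with
  | O => F u
  | S m' => add (ext_fold add m' (S s) (upd u s false) F)
                (ext_fold add m' (S s) (upd u s true) F)
  end.

Definition dimN (d n : nat) : nat := (d ^ (2 ^ n))%nat.

Definition rhobar (rho : bool -> Mat) (d n i : nat) (u : nat -> bool) : Mat :=
  mscale (/ 2 ^ (2 ^ n - i)) (ext_fold madd (2 ^ n - i) i u (rho_comb rho d n)).

(* classical register: |a><a| and the binary code of u_1^m *)
Definition ketbra (a : nat) : Mat :=
  fun i j => if andb (Nat.eqb i a) (Nat.eqb j a) then C1 else C0.
Fixpoint code (u : nat -> bool) (m : nat) : nat :=
  match m with O => O | S k => (code u k + (if u k then 2 ^ k else 0))%nat end.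

(* output of split channel W_N^{(p+1)} on input b (dimension 2^p * d^N) *)
Definition split_state (rho : bool -> Mat) (d n p : nat) (b : bool) : Mat :=
  ext_fold madd p 0 (fun _ => false)
    (fun u => kron (dimN d n) (ketbra (code u p))
                (mscale (/ 2 ^ p) (rhobar rho d n (S p) (upd u p b)))).

Definition Fsplit (rho : bool -> Mat) (d n p : nat) : R :=
  fid (2 ^ p * dimN d n) (split_state rho d n p false) (split_state rho d n p true).

(* projector Pi_{(p+1), u_1^{p+1}}; A is the information set (0-indexed) *)
Definition Pi (rho : bool -> Mat) (d n : nat) (A : nat -> bool) (p : nat)
  (u : nat -> bool) : Mat :=
  if A p then
    let P0 := nonneg_proj (dimN d n)
                (msub (sqrtm (dimN d n) (rhobar rho d n (S p) (upd u p false)))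
                      (sqrtm (dimN d n) (rhobar rho d n (S p) (upd u p true)))) in
    if u p then msub mid P0 else P0
  else mid.

Fixpoint decode_state (rho : bool -> Mat) (d n : nat) (A : nat -> bool) (k : nat)
  (u : nat -> bool) : Mat :=
  match k with
  | O => rho_comb rho d n u
  | S k' => let P := Pi rho d n A k' u in
            mmul (dimN d n) (mmul (dimN d n) P (decode_state rho d n A k' u)) P
  end.

Definition Pe (rho : bool -> Mat) (d n : nat) (A : nat -> bool) : R :=
  1 - / 2 ^ (2 ^ n) *
      ext_fold Rplus (2 ^ n) 0 (fun _ => false)
        (fun u => Re (trace (dimN d n) (decode_state rho d n A (2 ^ n) u))).

Fixpoint card_below (A : nat -> bool) (N : nat) : nat :=
  match N with O => O | S k => (card_below A k + (if A k then 1 else 0))%nat end.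

(* Main.v *)
(* The split channel [W_N^(i)] is handled as the family, indexed by [u_1^(i-1)], of the pairs
   [(rhobar_{u 0}, rhobar_{u 1})], and its parameters as averages over this family. Three functionals of a pair
   [(a, b)] occur: [T = Tr sqrt a sqrt b], [Z = || sqrt a sqrt b ||_1], and the infimum [Y] over orthonormal
   bases of the Bhattacharyya coefficient of the measured pair; they satisfy [T <= Z <= Y].

   Decoding: Gao's form of the non-commutative union bound gives [P_e <= 4 sum_i Tr (I - Pi_i) rho], and the
   decision projector for [sqrt a - sqrt b] errs with total weight at most [T]; hence [P_e <= 2 sum_(i in A) T_i].

   Polarization: product bases reduce the recursion to the classical one, [Y^- <= 2 Y - Y^2] and [Y^+ <= Y^2],
   while [I^- + I^+ = 2 I] by additivity of the entropy. Measuring in the eigenbasis of [sqrt a - sqrt b] shows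
   [(1 - T)^2 <= 1 - Y^2], and [I ln 2 <= 2 sqrt (2 (1 - T))], so [I] is small where [Y] is close to 1. The
   potential [2 Y - Y^2] decreases by [Y^2 (1 - Y)^2] per step, so [Y] polarizes; since [I <= 1], a fraction
   close to [I(W)] of the indices has small [Y], and repeated use of the two recursions over long stretches of
   the tree makes [Y <= 2^-(2^(g n))] there, for any [g < 1/2]. *)

(* The chain [T <= Z <= Y] is what joins decoder, code and polarization: the decoder is controlled
   by [T], the selection rule compares values of [Z], and only [Y] has a tractable recursion,
   because in a product basis its minus bound becomes an inequality between four numbers. If a
   chosen index had [T] above the threshold, every index outside the set would have [Z], hence [Y],
   above it; then all indices with small [Y] would be chosen, and there are more than [N R] of them.
   Bases that are optimal up to [e] stand in for a minimizer of the infimum. Both bounds on [I], by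
   1 and by the square root of [1 - T], come from one estimate of the relative entropy to the
   average state, with a free parameter [theta]. Polarization is quantified by pigeonhole: the
   decrements of the potential add up to at most 1, so some level below [K] has unpolarized mass at
   most [1/K]. Where that level lies is unknown, so [K] and the stretches after it are chosen to
   keep everything before the last stretch a small fraction of [n]. *)
From Stdlib Require Import Reals Lra Lia Psatz Arith ZArith FunctionalExtensionality Setoid Morphisms Ring.
From Stdlib Require Import Classical ClassicalEpsilon.
From Stdlib Require IndefiniteDescription.
From mathcomp Require all_boot all_order all_algebra sesquilinear spectral complex Rstruct.
Require Import Defs.
Open Scope R_scope.

(** * The spectral theorem, transferred from MathComp matrices over [R[i]] *)

Module SpectralTransfer.
Import all_boot all_order all_algebra sesquilinear spectral complex Rstruct.
Import GRing.Theory Num.Theory.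
Local Open Scope ring_scope.
Local Open Scope sesquilinear_scope.

Definition toc (z : Defs.C) : R[i] := Complex (fst z) (snd z).
Definition ofc (z : R[i]) : Defs.C := (complex.Re z, complex.Im z).

Lemma tocK z : ofc (toc z) = z. Proof. by case: z. Qed.
Lemma ofcK z : toc (ofc z) = z. Proof. by case: z. Qed.

Lemma toc_add a b : toc (Cadd a b) = toc a + toc b. Proof. by []. Qed.
Lemma toc_sum n f : toc (csum n f) = \sum_(i < n) toc (f i).
Proof.
elim: n => [|n IH]; first by rewrite big_ord0.
by rewrite big_ord_recr /= toc_add IH.
Qed.

Definition toM d (A : Mat) : 'M[R[i]]_d := \matrix_(i, j) toc (A i j).
Definition ofM d (M : 'M[R[i]]_d) : Mat := fun i j =>
  if insub i is Some i' then if insub j is Some j' then ofc (M i' j') else C0 else C0.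

Lemma ofMK d (M : 'M[R[i]]_d) : toM d (ofM d M) = M.
Proof. by apply/matrixP => i j; rewrite mxE /ofM !valK ofcK. Qed.

Lemma meqP d A B : meq d A B <-> toM d A = toM d B.
Proof.
split=> [AB|/matrixP AB i j /ssrnat.ltP ltid /ssrnat.ltP ltjd].
  by apply/matrixP => i j; rewrite !mxE AB //; apply/ssrnat.ltP.
by have := AB (Ordinal ltid) (Ordinal ltjd); rewrite !mxE /= => /(congr1 ofc); rewrite !tocK.
Qed.

Lemma toM_mul d A B : toM d (mmul d A B) = toM d A *m toM d B.
Proof.
apply/matrixP => i j; rewrite !mxE /mmul toc_sum.
by apply: eq_bigr => k _; rewrite !mxE.
Qed.

Lemma toM_adj d A : toM d (adj A) = (toM d A)^t*.
Proof. by apply/matrixP => i j; rewrite !mxE. Qed.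

Lemma toM_id d : toM d mid = 1%:M.
Proof.
apply/matrixP => i j; rewrite !mxE /mid -val_eqE /=.
by case: eqP => [->|/Nat.eqb_neq ->]; rewrite ?Nat.eqb_refl.
Qed.

(** A left inverse of a square matrix is a right inverse; finite dimension enters here. *)
Lemma unitary_adj d U : unitary d U -> meq d (mmul d U (adj U)) mid.
Proof.
rewrite /unitary !meqP !toM_mul toM_adj toM_id; exact: mulmx1C.
Qed.

Lemma spectral_theorem d A : Defs.hermitian d A -> exists U lam, spectral_decomp d A U lam.
Proof.
rewrite /Defs.hermitian meqP toM_adj => hA.
have herm : toM d A \is hermsymmx by apply/is_hermitianmxP; rewrite expr0 scale1r.
have Hre := hermitian_spectral_diag_real herm.
have /orthomx_spectralP Aeq := hermitian_normalmx herm.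
set P := spectralmx _ in Aeq; set D := spectral_diag _ in Aeq Hre.
have uP : P \is unitarymx := spectral_unitarymx _.
(* MathComp factors the matrix as [P^-1 D P], so the basis sought is the adjoint of [P]. The
   eigenvalues are complex numbers cut to their real parts, which [Hre] justifies below. *)
exists (ofM d (P^t*)), (fun k => if insub k is Some k' then complex.Re (D 0 k') else 0).
split.
  rewrite /unitary meqP toM_mul toM_adj toM_id ofMK trmxCK; exact/unitarymxP.
rewrite meqP !toM_mul toM_adj ofMK trmxCK -invmx_unitary // {1}Aeq; congr (_ *m _ *m _).
apply/matrixP => i j; rewrite !mxE /diagm -val_eqE /=.
case: eqP => [eij|/Nat.eqb_neq -> //].
rewrite eij Nat.eqb_refl valK mulr1n.
have /mxOverP/(_ 0 j) := Hre => /CrealP.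
have -> : i = j by exact: val_inj.
case: (D 0 j) => a b /= [] /eqP; rewrite eqNr => /eqP ->.
by [].
Qed.
End SpectralTransfer.

(** * Finite sums *)

Fixpoint rsum (n : nat) (f : nat -> R) : R :=
  match n with O => 0 | S m => rsum m f + f m end.

Lemma rsum_ext n f g : (forall i, (i < n)%nat -> f i = g i) -> rsum n f = rsum n g.
Proof.
  induction n as [|n IH]; simpl; intros H; [reflexivity|].
  rewrite IH by (intros; apply H; lia). rewrite H by lia. reflexivity.
Qed.

Lemma rsum_add n f g : rsum n (fun i => f i + g i) = rsum n f + rsum n g.
Proof. induction n; simpl; lra. Qed.

Lemma rsum_sub n f g : rsum n (fun i => f i - g i) = rsum n f - rsum n g.
Proof. induction n; simpl; lra. Qed.

Lemma rsum_scal n c f : rsum n (fun i => c * f i) = c * rsum n f.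
Proof. induction n; simpl; lra. Qed.

Lemma rsum_scal_r n c f : rsum n (fun i => f i * c) = rsum n f * c.
Proof. induction n; simpl; lra. Qed.

Lemma rsum_const n c : rsum n (fun _ => c) = INR n * c.
Proof. induction n; simpl rsum; [simpl; lra | rewrite S_INR; lra]. Qed.

Lemma rsum_le n f g : (forall i, (i < n)%nat -> f i <= g i) -> rsum n f <= rsum n g.
Proof.
  induction n as [|n IH]; simpl; intros H; [lra|].
  assert (f n <= g n) by (apply H; lia).
  assert (rsum n f <= rsum n g) by (apply IH; intros; apply H; lia). lra.
Qed.

Lemma rsum_nonneg n f : (forall i, (i < n)%nat -> 0 <= f i) -> 0 <= rsum n f.
Proof.
  intros H. replace 0 with (rsum n (fun _ => 0)) by (rewrite rsum_const; lra).
  now apply rsum_le.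
Qed.

Lemma rsum_term_le n f i : (forall j, (j < n)%nat -> 0 <= f j) -> (i < n)%nat -> f i <= rsum n f.
Proof.
  induction n as [|n IH]; simpl; intros H Hi; [lia|].
  assert (0 <= rsum n f) by (apply rsum_nonneg; intros; apply H; lia).
  assert (0 <= f n) by (apply H; lia).
  destruct (Nat.eq_dec i n) as [->|]; [lra|].
  assert (f i <= rsum n f) by (apply IH; [intros; apply H|]; lia). lra.
Qed.

Lemma rsum_swap n m f :
  rsum n (fun i => rsum m (fun j => f i j)) = rsum m (fun j => rsum n (fun i => f i j)).
Proof.
  induction n as [|n IH]; simpl.
  - rewrite rsum_const; lra.
  - rewrite rsum_add, IH. reflexivity.
Qed.

Lemma rsum_app n m f : rsum (n + m) f = rsum n f + rsum m (fun i => f (n + i)%nat).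
Proof.
  induction m as [|m IH]; simpl.
  - rewrite Nat.add_0_r; lra.
  - rewrite Nat.add_succ_r; simpl; rewrite IH; lra.
Qed.

Lemma rsum_prod n m f :
  rsum (n * m) f = rsum n (fun i => rsum m (fun j => f (i * m + j)%nat)).
Proof.
  induction n as [|n IH]; simpl; [reflexivity|].
  rewrite Nat.add_comm, rsum_app, IH. reflexivity.
Qed.

Lemma rsum_delta n i f :
  (i < n)%nat -> rsum n (fun j => if Nat.eqb i j then f j else 0) = f i.
Proof.
  induction n as [|n IH]; intros Hi; [lia|]. simpl.
  destruct (Nat.eq_dec i n) as [->|Hne].
  - rewrite Nat.eqb_refl.
    rewrite (rsum_ext n _ (fun _ => 0)).
    + rewrite rsum_const; lra.
    + intros j Hj. destruct (Nat.eqb_spec n j); [lia|reflexivity].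
  - rewrite IH by lia. destruct (Nat.eqb_spec i n); [lia|lra].
Qed.

(** The discriminant argument behind all Cauchy-Schwarz inequalities below. *)
Lemma quad_disc a b c :
  0 <= a -> 0 <= c -> (forall t, 0 <= a + 2 * b * t + c * t * t) -> b * b <= a * c.
Proof.
  intros Ha Hc H. destruct (Req_dec c 0) as [->|Hc0].
  - destruct (Req_dec b 0) as [->|Hb0]; [lra|exfalso].
    (* For [c = 0] the polynomial is affine; this [t] gives it the value -1. *)
    set (t := - (a + 1) / (2 * b)) in H.
    assert (2 * b * t = - (a + 1)) by (unfold t; field; auto).
    specialize (H t). nra.
  (* Evaluation at the vertex of the parabola. *)
  - specialize (H (- b / c)).
    replace (a + 2 * b * (- b / c) + c * (- b / c) * (- b / c)) with ((a * c - b * b) / c) in H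
      by (field; auto).
    assert (0 < c) by lra.
    assert (0 <= (a * c - b * b) / c * c) by (apply Rmult_le_pos; lra).
    replace ((a * c - b * b) / c * c) with (a * c - b * b) in H1 by (field; auto). lra.
Qed.

Lemma rsum_CS2 n f g :
  rsum n (fun i => f i * g i) * rsum n (fun i => f i * g i)
  <= rsum n (fun i => f i * f i) * rsum n (fun i => g i * g i).
Proof.
  apply quad_disc.
  - apply rsum_nonneg; intros; nra.
  - apply rsum_nonneg; intros; nra.
  - intros t.
    replace (rsum n (fun i => f i * f i) + 2 * rsum n (fun i => f i * g i) * t +
             rsum n (fun i => g i * g i) * t * t)
      with (rsum n (fun i => (f i + t * g i) * (f i + t * g i))).
    + apply rsum_nonneg; intros; apply Rle_0_sqr.
    + induction n as [|n IH]; simpl; [ring|rewrite IH; ring].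
Qed.

Lemma sq_le_sqrt_mul x a b : 0 <= a -> 0 <= b -> x * x <= a * b -> x <= sqrt a * sqrt b.
Proof.
  intros Ha Hb H. rewrite <- sqrt_mult by assumption.
  destruct (Rle_dec x 0).
  - apply Rle_trans with 0; [lra|apply sqrt_pos].
  - rewrite <- (sqrt_square x) by lra. apply sqrt_le_1_alt. exact H.
Qed.

Lemma rsum_CS n f g : (forall i, (i < n)%nat -> 0 <= f i) -> (forall i, (i < n)%nat -> 0 <= g i) ->
  rsum n (fun i => sqrt (f i * g i)) <= sqrt (rsum n f) * sqrt (rsum n g).
Proof.
  intros Hf Hg. apply sq_le_sqrt_mul; try (now apply rsum_nonneg).
  rewrite (rsum_ext n _ (fun i => sqrt (f i) * sqrt (g i))) by (intros; apply sqrt_mult; auto).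
  eapply Rle_trans; [apply (rsum_CS2 n (fun i => sqrt (f i)) (fun i => sqrt (g i)))|].
  rewrite (rsum_ext n (fun i => sqrt (f i) * sqrt (f i)) f) by (intros; apply sqrt_sqrt; auto).
  rewrite (rsum_ext n (fun i => sqrt (g i) * sqrt (g i)) g) by (intros; apply sqrt_sqrt; auto).
  lra.
Qed.

(** * Complex scalars *)

Lemma C_ext (a b : Defs.C) : fst a = fst b -> snd a = snd b -> a = b.
Proof. destruct a, b; simpl; congruence. Qed.

Definition Csub (a b : Defs.C) : Defs.C := Cadd a (Copp b).

Lemma C_ring_theory : ring_theory C0 C1 Cadd Cmul Csub Copp (@eq Defs.C).
Proof.
  constructor; intros; apply C_ext; simpl; ring.
Qed.
Add Ring C_ring : C_ring_theory.

Lemma Cconj_mul a b : Cconj (Cmul a b) = Cmul (Cconj a) (Cconj b).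
Proof. apply C_ext; simpl; ring. Qed.
Lemma Cconj_add a b : Cconj (Cadd a b) = Cadd (Cconj a) (Cconj b).
Proof. apply C_ext; simpl; ring. Qed.
Lemma Cconj_conj a : Cconj (Cconj a) = a.
Proof. apply C_ext; simpl; ring. Qed.

Definition Cnorm2 (z : Defs.C) : R := fst z * fst z + snd z * snd z.

Lemma Cnorm2_pos z : 0 <= Cnorm2 z.
Proof. unfold Cnorm2; nra. Qed.

Lemma csum_fst n f : fst (csum n f) = rsum n (fun i => fst (f i)).
Proof. induction n; simpl; congruence. Qed.
Lemma csum_snd n f : snd (csum n f) = rsum n (fun i => snd (f i)).
Proof. induction n; simpl; congruence. Qed.

Lemma csum_ext n f g : (forall i, (i < n)%nat -> f i = g i) -> csum n f = csum n g.
Proof.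
  intros H. apply C_ext; rewrite ?csum_fst, ?csum_snd; apply rsum_ext; intros; now rewrite H.
Qed.

Lemma csum_add n f g : csum n (fun i => Cadd (f i) (g i)) = Cadd (csum n f) (csum n g).
Proof. induction n as [|n IH]; simpl; [ring|rewrite IH; ring]. Qed.
Lemma csum_opp n f : csum n (fun i => Copp (f i)) = Copp (csum n f).
Proof. induction n as [|n IH]; simpl; [ring|rewrite IH; ring]. Qed.
Lemma csum_scal_l n c f : csum n (fun i => Cmul c (f i)) = Cmul c (csum n f).
Proof. induction n as [|n IH]; simpl; [ring|rewrite IH; ring]. Qed.
Lemma csum_scal_r n c f : csum n (fun i => Cmul (f i) c) = Cmul (csum n f) c.
Proof. induction n as [|n IH]; simpl; [ring|rewrite IH; ring]. Qed.
Lemma csum_conj n f : Cconj (csum n f) = csum n (fun i => Cconj (f i)).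
Proof. induction n as [|n IH]; simpl; [apply C_ext; simpl; ring|rewrite Cconj_add, IH; reflexivity]. Qed.
Lemma csum_zero n : csum n (fun _ => C0) = C0.
Proof. induction n as [|n IH]; simpl; [|rewrite IH]; ring. Qed.

Lemma csum_swap n m f :
  csum n (fun i => csum m (fun j => f i j)) = csum m (fun j => csum n (fun i => f i j)).
Proof.
  induction n as [|n IH]; simpl.
  - now rewrite csum_zero.
  - rewrite csum_add, IH. reflexivity.
Qed.

Lemma csum_app n m f : csum (n + m) f = Cadd (csum n f) (csum m (fun i => f (n + i)%nat)).
Proof.
  induction m as [|m IH]; simpl.
  - rewrite Nat.add_0_r; ring.
  - rewrite Nat.add_succ_r; simpl; rewrite IH; ring.
Qed.

Lemma csum_prod n m f :
  csum (n * m) f = csum n (fun i => csum m (fun j => f (i * m + j)%nat)).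
Proof.
  induction n as [|n IH]; simpl; [reflexivity|].
  rewrite Nat.add_comm, csum_app, IH. reflexivity.
Qed.

Lemma csum_delta_l n i f :
  (i < n)%nat -> csum n (fun j => if Nat.eqb i j then f j else C0) = f i.
Proof.
  intros Hi. apply C_ext; rewrite ?csum_fst, ?csum_snd.
  - rewrite (rsum_ext n _ (fun j => if Nat.eqb i j then fst (f j) else 0)).
    + now rewrite rsum_delta.
    + intros j _. now destruct (Nat.eqb i j).
  - rewrite (rsum_ext n _ (fun j => if Nat.eqb i j then snd (f j) else 0)).
    + now rewrite rsum_delta.
    + intros j _. now destruct (Nat.eqb i j).
Qed.

(** * Matrix algebra *)

Ltac mext := apply functional_extensionality; intros i; apply functional_extensionality; intros j.

Lemma mmul_assoc d A B C : mmul d (mmul d A B) C = mmul d A (mmul d B C).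
Proof.
  mext. unfold mmul.
  rewrite (csum_ext d _ (fun k => csum d (fun l => Cmul (Cmul (A i l) (B l k)) (C k j))))
    by (intros; now rewrite csum_scal_r).
  rewrite csum_swap. apply csum_ext; intros l _.
  rewrite <- csum_scal_l. apply csum_ext; intros k _. ring.
Qed.

Lemma mmul_add_l d A B C : mmul d (madd A B) C = madd (mmul d A C) (mmul d B C).
Proof. mext. unfold mmul, madd. rewrite <- csum_add. apply csum_ext; intros; ring. Qed.
Lemma mmul_add_r d A B C : mmul d A (madd B C) = madd (mmul d A B) (mmul d A C).
Proof. mext. unfold mmul, madd. rewrite <- csum_add. apply csum_ext; intros; ring. Qed.
Lemma mmul_sub_l d A B C : mmul d (msub A B) C = msub (mmul d A C) (mmul d B C).
Proof. mext. unfold mmul, msub. rewrite <- csum_opp, <- csum_add. apply csum_ext; intros; ring. Qed.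
Lemma mmul_sub_r d A B C : mmul d A (msub B C) = msub (mmul d A B) (mmul d A C).
Proof. mext. unfold mmul, msub. rewrite <- csum_opp, <- csum_add. apply csum_ext; intros; ring. Qed.
Lemma mmul_scale_l d r A B : mmul d (mscale r A) B = mscale r (mmul d A B).
Proof. mext. unfold mmul, mscale. rewrite <- csum_scal_l. apply csum_ext; intros; ring. Qed.
Lemma mmul_scale_r d r A B : mmul d A (mscale r B) = mscale r (mmul d A B).
Proof. mext. unfold mmul, mscale. rewrite <- csum_scal_l. apply csum_ext; intros; ring. Qed.

Lemma adj_mul d A B : adj (mmul d A B) = mmul d (adj B) (adj A).
Proof.
  mext. unfold adj, mmul. rewrite csum_conj. apply csum_ext; intros.
  rewrite Cconj_mul; ring.
Qed.
Lemma adj_adj A : adj (adj A) = A.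
Proof. mext. unfold adj. apply Cconj_conj. Qed.
Lemma adj_add A B : adj (madd A B) = madd (adj A) (adj B).
Proof. mext. unfold adj, madd. apply Cconj_add. Qed.
Lemma adj_sub A B : adj (msub A B) = msub (adj A) (adj B).
Proof. mext. unfold adj, msub. apply C_ext; simpl; ring. Qed.
Lemma adj_scale r A : adj (mscale r A) = mscale r (adj A).
Proof. mext. unfold adj, mscale. apply C_ext; simpl; ring. Qed.
Lemma adj_diagm l : adj (diagm l) = diagm l.
Proof.
  mext. unfold adj, diagm. destruct (Nat.eqb_spec j i) as [->|H].
  - rewrite Nat.eqb_refl. apply C_ext; simpl; ring.
  - destruct (Nat.eqb_spec i j); [congruence|]. apply C_ext; simpl; ring.
Qed.
Lemma adj_mid : adj mid = mid.
Proof.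
  mext. unfold adj, mid. rewrite (Nat.eqb_sym j i).
  destruct (Nat.eqb i j); apply C_ext; simpl; ring.
Qed.

#[export] Instance meq_equiv d : Equivalence (meq d).
Proof.
  split.
  - intros A i j _ _; reflexivity.
  - intros A B H i j Hi Hj; symmetry; now apply H.
  - intros A B C H1 H2 i j Hi Hj. rewrite H1 by assumption. now apply H2.
Qed.
#[export] Instance mmul_meq d : Proper (meq d ==> meq d ==> meq d) (mmul d).
Proof.
  intros A A' HA B B' HB i j Hi Hj. unfold mmul. apply csum_ext; intros k Hk.
  now rewrite HA, HB.
Qed.
#[export] Instance madd_meq d : Proper (meq d ==> meq d ==> meq d) madd.
Proof. intros A A' HA B B' HB i j Hi Hj. unfold madd. now rewrite HA, HB. Qed.
#[export] Instance msub_meq d : Proper (meq d ==> meq d ==> meq d) msub.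
Proof. intros A A' HA B B' HB i j Hi Hj. unfold msub. now rewrite HA, HB. Qed.
#[export] Instance mscale_meq d r : Proper (meq d ==> meq d) (mscale r).
Proof. intros A A' HA i j Hi Hj. unfold mscale. now rewrite HA. Qed.
#[export] Instance adj_meq d : Proper (meq d ==> meq d) adj.
Proof. intros A A' HA i j Hi Hj. unfold adj. now rewrite HA. Qed.

Lemma mmul_1_r d A : meq d (mmul d A mid) A.
Proof.
  intros i j Hi Hj. unfold mmul, mid.
  rewrite (csum_ext d _ (fun k => if Nat.eqb j k then A i k else C0)).
  - now rewrite csum_delta_l.
  - intros k _. rewrite Nat.eqb_sym. destruct (Nat.eqb j k); ring.
Qed.
Lemma mmul_1_l d A : meq d (mmul d mid A) A.
Proof.
  intros i j Hi Hj. unfold mmul, mid.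
  rewrite (csum_ext d _ (fun k => if Nat.eqb i k then A k j else C0)).
  - now rewrite csum_delta_l.
  - intros k _. destruct (Nat.eqb i k); ring.
Qed.

Lemma mmul_diagm_r d A l i j :
  (j < d)%nat -> mmul d A (diagm l) i j = Cmul (A i j) (RtoC (l j)).
Proof.
  intros Hj. unfold mmul, diagm.
  rewrite (csum_ext d _ (fun k => if Nat.eqb j k then Cmul (A i k) (RtoC (l k)) else C0)).
  - now rewrite (csum_delta_l d j (fun k => Cmul (A i k) (RtoC (l k)))).
  - intros k _. rewrite Nat.eqb_sym. destruct (Nat.eqb j k); ring.
Qed.
Lemma mmul_diagm_l d A l i j :
  (i < d)%nat -> mmul d (diagm l) A i j = Cmul (RtoC (l i)) (A i j).
Proof.
  intros Hi. unfold mmul, diagm.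
  rewrite (csum_ext d _ (fun k => if Nat.eqb i k then Cmul (RtoC (l i)) (A k j) else C0)).
  - now rewrite (csum_delta_l d i (fun k => Cmul (RtoC (l i)) (A k j))).
  - intros k _. destruct (Nat.eqb i k); ring.
Qed.
Lemma mmul_diagm d l m : meq d (mmul d (diagm l) (diagm m)) (diagm (fun i => l i * m i)).
Proof.
  intros i j Hi Hj. rewrite mmul_diagm_l by assumption. unfold diagm.
  destruct (Nat.eqb_spec i j) as [->|]; [apply C_ext; simpl; ring|ring].
Qed.
Lemma diagm_ext d l m : (forall i, (i < d)%nat -> l i = m i) -> meq d (diagm l) (diagm m).
Proof.
  intros H i j Hi Hj. unfold diagm. now rewrite H.
Qed.

(** * Real trace and the Hilbert-Schmidt inner product *)

Definition rtr (d : nat) (A : Mat) : R := Re (trace d A).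

Lemma rtr_sum d A : rtr d A = rsum d (fun i => Re (A i i)).
Proof. unfold rtr, trace, Re. apply csum_fst. Qed.

#[export] Instance rtr_meq d : Proper (meq d ==> eq) (rtr d).
Proof.
  intros A B H. rewrite !rtr_sum. apply rsum_ext; intros. now rewrite H.
Qed.

Lemma rtr_add d A B : rtr d (madd A B) = rtr d A + rtr d B.
Proof. rewrite !rtr_sum, <- rsum_add. reflexivity. Qed.
Lemma rtr_sub d A B : rtr d (msub A B) = rtr d A - rtr d B.
Proof. rewrite !rtr_sum, <- rsum_sub. apply rsum_ext; intros; simpl; unfold Re; ring. Qed.
Lemma rtr_scale d r A : rtr d (mscale r A) = r * rtr d A.
Proof. rewrite !rtr_sum, <- rsum_scal. apply rsum_ext; intros; unfold Re, mscale; simpl; ring. Qed.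
Lemma rtr_adj d A : rtr d (adj A) = rtr d A.
Proof. rewrite !rtr_sum. reflexivity. Qed.
Lemma rtr_comm d A B : rtr d (mmul d A B) = rtr d (mmul d B A).
Proof.
  unfold rtr, trace, mmul. f_equal. rewrite csum_swap.
  apply csum_ext; intros; apply csum_ext; intros; ring.
Qed.
Lemma rtr_diagm d l : rtr d (diagm l) = rsum d l.
Proof.
  rewrite rtr_sum. apply rsum_ext; intros. unfold diagm. now rewrite Nat.eqb_refl.
Qed.

(** Real part of the Hilbert-Schmidt product. It is symmetric and real bilinear, so real multipliers
    suffice for Cauchy-Schwarz. *)
Definition hs (d : nat) (X Y : Mat) : R := rtr d (mmul d (adj X) Y).

#[export] Instance hs_meq d : Proper (meq d ==> meq d ==> eq) (hs d).
Proof. intros A A' HA B B' HB. unfold hs. now rewrite HA, HB. Qed.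

(** Squared length of a column, i.e. a diagonal entry of the Gram matrix. *)
Definition cn (d : nat) (X : Mat) (k : nat) : R := rsum d (fun i => Cnorm2 (X i k)).

Lemma cn_pos d X k : 0 <= cn d X k.
Proof. apply rsum_nonneg; intros; apply Cnorm2_pos. Qed.

Lemma gram_diag d X k : mmul d (adj X) X k k = (cn d X k, 0).
Proof.
  unfold mmul, cn. apply C_ext; rewrite ?csum_fst, ?csum_snd; simpl.
  - apply rsum_ext; intros; unfold adj, Cconj, Cnorm2; simpl; ring.
  - rewrite (rsum_ext d _ (fun _ => 0)) by (intros; unfold adj; simpl; ring).
    rewrite rsum_const; ring.
Qed.

Lemma cn_gram d X k : cn d X k = Re (mmul d (adj X) X k k).
Proof. now rewrite gram_diag. Qed.

Lemma hs_self d X : hs d X X = rsum d (cn d X).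
Proof. unfold hs. rewrite rtr_sum. apply rsum_ext; intros. now rewrite gram_diag. Qed.

Lemma hs_pos d X : 0 <= hs d X X.
Proof. rewrite hs_self. apply rsum_nonneg; intros; apply cn_pos. Qed.

Lemma hs_sym d X Y : hs d X Y = hs d Y X.
Proof. unfold hs. rewrite <- rtr_adj, adj_mul, adj_adj. reflexivity. Qed.

Lemma hs_add_r d X Y Z : hs d X (madd Y Z) = hs d X Y + hs d X Z.
Proof. unfold hs. now rewrite mmul_add_r, rtr_add. Qed.
Lemma hs_add_l d X Y Z : hs d (madd X Y) Z = hs d X Z + hs d Y Z.
Proof. unfold hs. now rewrite adj_add, mmul_add_l, rtr_add. Qed.
Lemma hs_sub_r d X Y Z : hs d X (msub Y Z) = hs d X Y - hs d X Z.
Proof. unfold hs. now rewrite mmul_sub_r, rtr_sub. Qed.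
Lemma hs_sub_l d X Y Z : hs d (msub X Y) Z = hs d X Z - hs d Y Z.
Proof. unfold hs. now rewrite adj_sub, mmul_sub_l, rtr_sub. Qed.
Lemma hs_scale_r d r X Y : hs d X (mscale r Y) = r * hs d X Y.
Proof. unfold hs. now rewrite mmul_scale_r, rtr_scale. Qed.
Lemma hs_scale_l d r X Y : hs d (mscale r X) Y = r * hs d X Y.
Proof. unfold hs. now rewrite adj_scale, mmul_scale_l, rtr_scale. Qed.
Lemma hs_mul_l d A X Y : hs d (mmul d A X) Y = hs d X (mmul d (adj A) Y).
Proof. unfold hs. now rewrite adj_mul, mmul_assoc. Qed.

Lemma hs_CS d X Y : hs d X Y * hs d X Y <= hs d X X * hs d Y Y.
Proof.
  apply quad_disc; [apply hs_pos..|].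
  intros t.
  replace (hs d X X + 2 * hs d X Y * t + hs d Y Y * t * t)
    with (hs d (madd X (mscale t Y)) (madd X (mscale t Y))); [apply hs_pos|].
  rewrite !hs_add_l, !hs_add_r, !hs_scale_l, !hs_scale_r, (hs_sym d Y X). ring.
Qed.

Lemma hs_CS_sqrt d X Y : hs d X Y <= sqrt (hs d X X) * sqrt (hs d Y Y).
Proof. apply sq_le_sqrt_mul; [apply hs_pos..|apply hs_CS]. Qed.

(** * Positive semidefinite matrices *)

Definition quad (d : nat) (A : Mat) (v : nat -> Defs.C) : R :=
  Re (csum d (fun i => csum d (fun j => Cmul (Cconj (v i)) (Cmul (A i j) (v j))))).

Lemma quad_col d A X k :
  quad d A (fun i => X i k) = Re (mmul d (adj X) (mmul d A X) k k).
Proof.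
  unfold quad, mmul, adj. f_equal. apply csum_ext; intros i _. now rewrite csum_scal_l.
Qed.

Lemma psd_herm d A : psd d A -> meq d (adj A) A.
Proof. now intros [H _]. Qed.

Lemma psd_conj_diag d A X k : psd d A -> 0 <= Re (mmul d (adj X) (mmul d A X) k k).
Proof. intros [_ H]. rewrite <- quad_col. apply H. Qed.

Lemma psd_conj_rtr d A X : psd d A -> 0 <= rtr d (mmul d (adj X) (mmul d A X)).
Proof.
  intros H. rewrite rtr_sum. apply rsum_nonneg; intros. now apply psd_conj_diag.
Qed.

(** Test vectors enter as columns of matrices, so positivity becomes matrix algebra. Conversely, [v]
    is a column of the matrix all of whose columns are [v]. *)
Lemma psd_intro d A :
  meq d (adj A) A -> (forall X k, (k < d)%nat -> 0 <= Re (mmul d (adj X) (mmul d A X) k k)) -> psd d A.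
Proof.
  intros Hh Hq. split; [exact Hh|]. intros v.
  destruct d as [|d]; [simpl; lra|].
  change (0 <= quad (S d) A v).
  refine (eq_ind_r (fun x => 0 <= x) _ (quad_col (S d) A (fun i _ => v i) 0%nat)).
  apply Hq. lia.
Qed.

Lemma psd_gram d X : psd d (mmul d (adj X) X).
Proof.
  apply psd_intro.
  - rewrite adj_mul, adj_adj. reflexivity.
  - intros Y k _. rewrite <- !mmul_assoc, <- adj_mul, mmul_assoc, gram_diag. apply cn_pos.
Qed.

#[export] Instance psd_meq d : Proper (meq d ==> iff) (psd d).
Proof.
  assert (forall A B, meq d A B -> psd d A -> psd d B) as H.
  { intros A B HAB HA. apply psd_intro.
    - rewrite <- HAB. now apply psd_herm.
    - intros X k Hk.
      assert (meq d (mmul d (adj X) (mmul d B X)) (mmul d (adj X) (mmul d A X))) as E by (now rewrite HAB).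
      rewrite E by assumption. now apply psd_conj_diag. }
  intros A B HAB. split; apply H; [|symmetry]; assumption.
Qed.

Lemma psd_add d A B : psd d A -> psd d B -> psd d (madd A B).
Proof.
  intros HA HB. apply psd_intro.
  - rewrite adj_add, (psd_herm _ _ HA), (psd_herm _ _ HB). reflexivity.
  - intros X k _. rewrite mmul_add_l, mmul_add_r.
    generalize (psd_conj_diag d A X k HA), (psd_conj_diag d B X k HB).
    unfold madd, Re; simpl. lra.
Qed.

Lemma psd_scale d r A : 0 <= r -> psd d A -> psd d (mscale r A).
Proof.
  intros Hr HA. apply psd_intro.
  - rewrite adj_scale, (psd_herm _ _ HA). reflexivity.
  - intros X k _. rewrite mmul_scale_l, mmul_scale_r.
    generalize (psd_conj_diag d A X k HA). unfold mscale, Re; simpl. intros. nra.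
Qed.

Lemma psd_conj d A X : psd d A -> psd d (mmul d (adj X) (mmul d A X)).
Proof.
  intros HA. apply psd_intro.
  - rewrite !adj_mul, adj_adj, (psd_herm _ _ HA), mmul_assoc. reflexivity.
  - intros Y k _.
    replace (mmul d (adj Y) (mmul d (mmul d (adj X) (mmul d A X)) Y))
      with (mmul d (adj (mmul d X Y)) (mmul d A (mmul d X Y)))
      by (rewrite adj_mul, !mmul_assoc; reflexivity).
    now apply psd_conj_diag.
Qed.

(** * Functional calculus *)

Definition spectral_theorem := SpectralTransfer.spectral_theorem.

Lemma unitary_l d U : unitary d U -> meq d (mmul d (adj U) U) mid.
Proof. exact (fun H => H). Qed.
Lemma unitary_r d U : unitary d U -> meq d (mmul d U (adj U)) mid.
Proof. apply SpectralTransfer.unitary_adj. Qed.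

Lemma mmul_unitary_l d U X : unitary d U -> meq d (mmul d (adj U) (mmul d U X)) X.
Proof. intros HU. rewrite <- mmul_assoc, (unitary_l _ _ HU). apply mmul_1_l. Qed.
Lemma mmul_unitary_r d U X : unitary d U -> meq d (mmul d U (mmul d (adj U) X)) X.
Proof. intros HU. rewrite <- mmul_assoc, (unitary_r _ _ HU). apply mmul_1_l. Qed.

Lemma rtr_conj_unitary d U X : unitary d U -> rtr d (mmul d (adj U) (mmul d X U)) = rtr d X.
Proof.
  intros HU. rewrite rtr_comm, mmul_assoc, (unitary_r _ _ HU), mmul_1_r. reflexivity.
Qed.

Lemma spectral_decomp_diag d A U l :
  spectral_decomp d A U l -> meq d (mmul d (adj U) (mmul d A U)) (diagm l).
Proof.
  intros [HU HA]. rewrite HA, !mmul_assoc, (unitary_l _ _ HU), mmul_1_r.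
  now apply mmul_unitary_l.
Qed.

Lemma spectral_decomp_herm d A U l : spectral_decomp d A U l -> meq d (adj A) A.
Proof.
  intros [HU HA]. rewrite HA, !adj_mul, adj_adj, adj_diagm, mmul_assoc. reflexivity.
Qed.

Definition fcalc (d : nat) (U : Mat) (l : nat -> R) : Mat :=
  mmul d (mmul d U (diagm l)) (adj U).

(** [W = adj V U] intertwines the two diagonals, so [W i j] can be nonzero only where [l j = m i];
    hence it intertwines their images under [f]. This frees [matfun] from its choice of
    decomposition. *)
Lemma fcalc_unique d U l V m f :
  unitary d U -> unitary d V -> meq d (fcalc d U l) (fcalc d V m) ->
  meq d (fcalc d U (fun k => f (l k))) (fcalc d V (fun k => f (m k))).
Proof.
  intros HU HV H.
  set (W := mmul d (adj V) U).
  assert (meq d (mmul d W (diagm l)) (mmul d (diagm m) W)) as HW.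
  { transitivity (mmul d (adj V) (mmul d (fcalc d U l) U)).
    - unfold fcalc, W. rewrite !mmul_assoc, (unitary_l _ _ HU), mmul_1_r. reflexivity.
    - rewrite H. unfold fcalc, W. rewrite !mmul_assoc. now apply mmul_unitary_l. }
  assert (meq d (mmul d W (diagm (fun k => f (l k)))) (mmul d (diagm (fun k => f (m k))) W)) as HWf.
  { intros i j Hi Hj. specialize (HW i j Hi Hj).
    rewrite mmul_diagm_r, mmul_diagm_l in * by assumption.
    assert (W i j = C0 \/ l j = m i) as [E|E].
    { destruct (Req_dec (l j) (m i)) as [|Hne]; [now right|left].
      assert (fst (W i j) * l j = m i * fst (W i j)) as E1
        by (apply (f_equal fst) in HW; simpl in HW; nra).
      assert (snd (W i j) * l j = m i * snd (W i j)) as E2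
        by (apply (f_equal snd) in HW; simpl in HW; nra).
      assert (l j - m i <> 0) by lra.
      apply C_ext; simpl; apply (Rmult_eq_reg_l (l j - m i)); try assumption; nra. }
    - rewrite E; ring.
    - rewrite E; ring. }
  unfold fcalc.
  transitivity (mmul d V (mmul d (mmul d W (diagm (fun k => f (l k)))) (adj U))).
  - unfold W. rewrite !mmul_assoc, mmul_unitary_r by assumption. reflexivity.
  - rewrite HWf. unfold W. rewrite !mmul_assoc, (unitary_r _ _ HU), mmul_1_r. reflexivity.
Qed.

Lemma matfun_eq d f A U l :
  spectral_decomp d A U l -> meq d (matfun d f A) (fcalc d U (fun k => f (l k))).
Proof.
  intros H. unfold matfun.
  destruct (excluded_middle_informative _) as [He|He].
  - destruct (ClassicalEpsilon.constructive_indefinite_description _ _) as [[V m] [HV HAV]]; simpl in *.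
    destruct H as [HU HAU].
    apply fcalc_unique; try assumption. unfold fcalc. now rewrite <- HAV, <- HAU.
  - exfalso. apply He. now exists (U, l).
Qed.

#[export] Instance spectral_decomp_meq d :
  Proper (meq d ==> eq ==> eq ==> iff) (spectral_decomp d).
Proof.
  intros A B H U ? <- l ? <-. unfold spectral_decomp. now rewrite H.
Qed.

Lemma fcalc_decomp d U l : unitary d U -> spectral_decomp d (fcalc d U l) U l.
Proof. intros HU; split; [assumption|reflexivity]. Qed.

(** The choice in [matfun] may depend on entries outside the range of [meq], so this goes through
    the uniqueness of the functional calculus. *)
Lemma matfun_meq d f A B : hermitian d A -> meq d A B -> meq d (matfun d f A) (matfun d f B).
Proof.
  intros HA HAB. destruct (spectral_theorem d A HA) as (U & l & H).
  rewrite (matfun_eq d f A U l H). rewrite HAB in H. now rewrite (matfun_eq d f B U l H).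
Qed.

Lemma fcalc_mul d U l m :
  unitary d U -> meq d (mmul d (fcalc d U l) (fcalc d U m)) (fcalc d U (fun k => l k * m k)).
Proof.
  intros HU. unfold fcalc. rewrite !mmul_assoc, mmul_unitary_l by assumption.
  rewrite <- (mmul_assoc d (diagm l)), mmul_diagm. reflexivity.
Qed.

Lemma fcalc_adj d U l : adj (fcalc d U l) = fcalc d U l.
Proof. unfold fcalc. now rewrite !adj_mul, adj_adj, adj_diagm, mmul_assoc. Qed.

Lemma fcalc_ext d U l m : (forall k, (k < d)%nat -> l k = m k) -> meq d (fcalc d U l) (fcalc d U m).
Proof. intros H. unfold fcalc. now rewrite (diagm_ext d l m H). Qed.

Lemma rtr_fcalc d U l : unitary d U -> rtr d (fcalc d U l) = rsum d l.
Proof.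
  intros HU. unfold fcalc. rewrite rtr_comm, <- mmul_assoc, (unitary_l _ _ HU), mmul_1_l.
  apply rtr_diagm.
Qed.

Lemma fcalc_psd d U l : (forall k, (k < d)%nat -> 0 <= l k) -> psd d (fcalc d U l).
Proof.
  intros H. rewrite (fcalc_ext d U l (fun k => sqrt (l k) * sqrt (l k)))
    by (intros; now rewrite sqrt_sqrt by auto).
  unfold fcalc. rewrite <- mmul_diagm.
  rewrite <- (mmul_assoc d U), mmul_assoc.
  replace (mmul d U (diagm (fun i => sqrt (l i)))) with (adj (mmul d (diagm (fun i => sqrt (l i))) (adj U)))
    by (now rewrite adj_mul, adj_adj, adj_diagm).
  apply psd_gram.
Qed.

Lemma psd_eigen_pos d A U l : psd d A -> spectral_decomp d A U l -> forall k, (k < d)%nat -> 0 <= l k.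
Proof.
  intros HA H k Hk. generalize (psd_conj_diag d A U k HA).
  rewrite (spectral_decomp_diag _ _ _ _ H) by assumption.
  unfold diagm. now rewrite Nat.eqb_refl.
Qed.

Lemma psd_spectral d A : psd d A -> exists U l, spectral_decomp d A U l /\ forall k, (k < d)%nat -> 0 <= l k.
Proof.
  intros HA. destruct (spectral_theorem d A (proj1 HA)) as (U & l & H).
  exists U, l. split; [assumption|]. eapply psd_eigen_pos; eassumption.
Qed.

Lemma sqrtm_decomp d A U l :
  spectral_decomp d A U l -> spectral_decomp d (sqrtm d A) U (fun k => sqrt (l k)).
Proof.
  intros H. unfold sqrtm. rewrite (matfun_eq _ _ _ _ _ H). apply fcalc_decomp, H.
Qed.

Lemma sqrtm_sq d A : psd d A -> meq d (mmul d (sqrtm d A) (sqrtm d A)) A.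
Proof.
  intros HA. destruct (psd_spectral d A HA) as (U & l & H & Hl).
  unfold sqrtm. rewrite (matfun_eq _ _ _ _ _ H), fcalc_mul by apply H.
  rewrite (fcalc_ext d U _ l) by (intros; apply sqrt_sqrt; auto).
  symmetry. apply H.
Qed.

Lemma sqrtm_psd d A : hermitian d A -> psd d (sqrtm d A).
Proof.
  intros HA. destruct (spectral_theorem d A HA) as (U & l & H).
  unfold sqrtm. rewrite (matfun_eq _ _ _ _ _ H). apply fcalc_psd. intros; apply sqrt_pos.
Qed.

Lemma sqrtm_adj d A : hermitian d A -> meq d (adj (sqrtm d A)) (sqrtm d A).
Proof. intros HA. apply psd_herm. now apply sqrtm_psd. Qed.

Lemma sqrtm_meq d A B : hermitian d A -> meq d A B -> meq d (sqrtm d A) (sqrtm d B).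
Proof. apply matfun_meq. Qed.

(** [Tr A B = Tr sqrt B A sqrt B]. *)
Lemma psd_mul_rtr d A B : psd d A -> psd d B -> 0 <= rtr d (mmul d A B).
Proof.
  intros HA HB.
  rewrite <- (sqrtm_sq d B HB), <- mmul_assoc, rtr_comm.
  rewrite <- (sqrtm_adj d B (proj1 HB)) at 1. now apply psd_conj_rtr.
Qed.

Lemma entropy_eq d A U l :
  spectral_decomp d A U l -> entropy d A = - rsum d (fun k => xlog2x (l k)).
Proof.
  intros H. unfold entropy. fold (rtr d (matfun d xlog2x A)).
  rewrite (matfun_eq _ _ _ _ _ H), rtr_fcalc by apply H. reflexivity.
Qed.

(** * The non-commutative union bound *)

(** Applied to [S = sqrt rho], the squared Hilbert-Schmidt norm of the result is the probability of
    passing all the projectors in turn. *)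
Fixpoint seq_proj (d : nat) (P : nat -> Mat) (k : nat) (S : Mat) : Mat :=
  match k with O => S | Datatypes.S k' => mmul d (P k') (seq_proj d P k' S) end.

Definition projector (d : nat) (P : Mat) : Prop := hermitian d P /\ meq d (mmul d P P) P.

Lemma projector_compl_hs d P X Y : projector d P ->
  hs d (msub X (mmul d P X)) (msub Y (mmul d P Y)) = hs d X (msub Y (mmul d P Y)).
Proof.
  intros [Hh Hi]; red in Hh.
  rewrite hs_sub_l, !hs_sub_r, !hs_mul_l, Hh, <- mmul_assoc, Hi. ring.
Qed.

Lemma projector_hs d P X : projector d P ->
  hs d X X - hs d (mmul d P X) (mmul d P X) = hs d (msub X (mmul d P X)) (msub X (mmul d P X)).
Proof.
  intros HP. rewrite projector_compl_hs by assumption. destruct HP as [Hh Hi]; red in Hh.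
  rewrite hs_sub_r, hs_mul_l, Hh, <- mmul_assoc, Hi. reflexivity.
Qed.

Lemma seq_proj_loss d P K S : (forall k, (k < K)%nat -> projector d (P k)) ->
  hs d S S - hs d (seq_proj d P K S) (seq_proj d P K S) =
  rsum K (fun k => let X := seq_proj d P k S in hs d (msub X (mmul d (P k) X)) (msub X (mmul d (P k) X))).
Proof.
  cbv zeta. induction K as [|K IH]; intros H; simpl; [ring|].
  rewrite <- IH by (intros; apply H; lia). rewrite <- projector_hs by (apply H; lia). ring.
Qed.

(** Telescoping: each projector lowers the overlap of [S] with the current vector by the product of
    their rejected parts. *)
Lemma seq_proj_overlap d P K S : (forall k, (k < K)%nat -> projector d (P k)) ->
  hs d S S - hs d S (seq_proj d P K S) =
  rsum K (fun k => let X := seq_proj d P k S in hs d (msub S (mmul d (P k) S)) (msub X (mmul d (P k) X))).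
Proof.
  cbv zeta. induction K as [|K IH]; intros H; simpl; [ring|].
  rewrite <- IH by (intros; apply H; lia). rewrite projector_compl_hs by (apply H; lia).
  rewrite hs_sub_r. ring.
Qed.

(** The loss of overlap pairs the errors on [S] itself with those met along the sequence, and the
    squares of the latter add up to the total loss. Cauchy-Schwarz over [k] therefore bounds it by
    the root of [e] times the root of the loss. Comparing with [hs d S T <= sqrt a * sqrt b] gives
    [z <= 2 w], and 4 is the square of this 2. *)
Lemma union_bound d P K S : (forall k, (k < K)%nat -> projector d (P k)) ->
  0 <= hs d S S - hs d (seq_proj d P K S) (seq_proj d P K S) <=
  4 * rsum K (fun k => hs d (msub S (mmul d (P k) S)) (msub S (mmul d (P k) S))).
Proof.
  intros HP.
  set (T := seq_proj d P K S). set (e := rsum K _).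
  assert (0 <= hs d S S - hs d T T) as Hloss.
  { unfold T. rewrite seq_proj_loss by assumption. apply rsum_nonneg; intros; apply hs_pos. }
  assert (0 <= e) as He by (apply rsum_nonneg; intros; apply hs_pos).
  split; [exact Hloss|].
  assert (hs d S S - hs d S T <= sqrt e * sqrt (hs d S S - hs d T T)) as H1.
  { unfold T. rewrite seq_proj_overlap, seq_proj_loss by assumption. unfold e.
    eapply Rle_trans; [|apply rsum_CS; intros; apply hs_pos].
    apply rsum_le; intros k Hk. rewrite sqrt_mult by apply hs_pos. apply hs_CS_sqrt. }
  assert (H2 := hs_CS_sqrt d S T).
  assert (Hs := hs_pos d S). assert (Ht := hs_pos d T).
  set (a := hs d S S) in *. set (b := hs d T T) in *. set (c := hs d S T) in *.
  assert (Hx := sqrt_sqrt a Hs). assert (Hy := sqrt_sqrt b Ht).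
  assert (Hx0 := sqrt_pos a). assert (Hy0 := sqrt_pos b).
  assert (Hz := sqrt_sqrt (a - b) Hloss). assert (Hz0 := sqrt_pos (a - b)).
  assert (Hw := sqrt_sqrt e He). assert (Hw0 := sqrt_pos e).
  set (x := sqrt a) in *. set (y := sqrt b) in *. set (z := sqrt (a - b)) in *. set (w := sqrt e) in *.
  assert (y <= x) as Hyx by (apply sqrt_le_1_alt; lra).
  assert (x * (x - y) <= w * z) as H3 by nra.
  assert (z * z = (x - y) * (x + y)) as Hzz by nra.
  (* with [z^2 = (x-y)(x+y)] the bound [x(x-y) <= wz] becomes [x z <= w (x+y) <= 2 w x] *)
  destruct (Req_dec z 0) as [Hz00|Hzn]; [nra|].
  destruct (Req_dec x 0) as [Hx00|Hxn]; [nra|].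
  assert (x * z <= w * (x + y)) as H4.
  { apply Rmult_le_reg_r with z; [lra|].
    replace (x * z * z) with (x * (x - y) * (x + y)) by (rewrite (Rmult_assoc x z z), Hzz; ring).
    assert (x * (x - y) * (x + y) <= w * z * (x + y)) by (apply Rmult_le_compat_r; lra). nra. }
  assert (z <= 2 * w).
  { apply Rmult_le_reg_l with x; [lra|]. nra. }
  nra.
Qed.

(** * Measuring in an orthonormal basis *)

(** Weight of outcome [k] when [A] is measured in the basis of columns of [U]. *)
Definition diagq (d : nat) (U A : Mat) (k : nat) : R := Re (mmul d (adj U) (mmul d A U) k k).

Lemma diagq_meq d U A B k : (k < d)%nat -> meq d A B -> diagq d U A k = diagq d U B k.
Proof.
  intros Hk H. unfold diagq.
  assert (meq d (mmul d (adj U) (mmul d A U)) (mmul d (adj U) (mmul d B U))) as E by now rewrite H.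
  now rewrite E.
Qed.

Lemma diagq_pos d U A k : psd d A -> 0 <= diagq d U A k.
Proof. apply psd_conj_diag. Qed.

Lemma diagq_sum d U A : unitary d U -> rsum d (diagq d U A) = rtr d A.
Proof.
  intros HU. rewrite <- (rtr_conj_unitary d U A HU), rtr_sum. reflexivity.
Qed.

Lemma diagq_scale d U r A k : diagq d U (mscale r A) k = r * diagq d U A k.
Proof. unfold diagq. rewrite mmul_scale_l, mmul_scale_r. unfold mscale, Re; simpl; ring. Qed.
Lemma diagq_add d U A B k : diagq d U (madd A B) k = diagq d U A k + diagq d U B k.
Proof. unfold diagq. rewrite mmul_add_l, mmul_add_r. reflexivity. Qed.
Lemma diagq_sub d U A B k : diagq d U (msub A B) k = diagq d U A k - diagq d U B k.
Proof. unfold diagq. rewrite mmul_sub_l, mmul_sub_r. unfold msub, Re; simpl; ring. Qed.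

Lemma rtr_fcalc_mul d U l A : rtr d (mmul d (fcalc d U l) A) = rsum d (fun k => l k * diagq d U A k).
Proof.
  unfold fcalc. rewrite mmul_assoc, rtr_comm, <- mmul_assoc, rtr_comm, rtr_sum.
  apply rsum_ext; intros k Hk. rewrite mmul_diagm_l by assumption.
  unfold diagq. rewrite mmul_assoc. unfold Re; simpl; ring.
Qed.

Lemma diagq_spectral d U l A : spectral_decomp d A U l -> forall k, (k < d)%nat -> diagq d U A k = l k.
Proof.
  intros H k Hk. unfold diagq. rewrite (spectral_decomp_diag _ _ _ _ H) by assumption.
  unfold diagm. now rewrite Nat.eqb_refl.
Qed.

(* In an eigenbasis of [A - B], the difference of squares [A^2 - B^2 = ((A-B)(A+B) + (A+B)(A-B))/2]
   has diagonal [l_k (A+B)_kk], and [|l_k| <= (A+B)_kk]. *)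
Lemma diagq_sq_diff d A B U l :
  psd d A -> psd d B -> spectral_decomp d (msub A B) U l -> forall k, (k < d)%nat ->
  exists s, diagq d U (mmul d A A) k - diagq d U (mmul d B B) k = l k * s /\ Rabs (l k) <= s.
Proof.
  intros HA HB H k Hk.
  assert (HU := proj1 H). assert (HD := spectral_decomp_diag _ _ _ _ H).
  assert (Hlk := diagq_spectral _ _ _ _ H k Hk). rewrite diagq_sub in Hlk.
  assert (HA0 := diagq_pos d U A k HA). assert (HB0 := diagq_pos d U B k HB).
  exists (diagq d U A k + diagq d U B k). split.
  - rewrite <- diagq_sub.
    set (S := madd A B). set (D := msub A B) in *.
    assert (msub (mmul d A A) (mmul d B B)
            = mscale (1/2) (madd (mmul d D S) (mmul d S D))) as ->.
    { unfold S, D. rewrite !mmul_sub_l, !mmul_sub_r, !mmul_add_l, !mmul_add_r.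
      rewrite ?mmul_sub_l, ?mmul_sub_r.
      mext. unfold msub, madd, mscale. apply C_ext; simpl; field. }
    rewrite diagq_scale, diagq_add.
    assert (diagq d U (mmul d D S) k = l k * diagq d U S k) as ->.
    { unfold diagq.
      assert (meq d (mmul d (adj U) (mmul d (mmul d D S) U))
                    (mmul d (diagm l) (mmul d (adj U) (mmul d S U)))) as E.
      { rewrite <- HD, !mmul_assoc, mmul_unitary_r by assumption. reflexivity. }
      rewrite E, mmul_diagm_l by assumption. unfold Re; simpl; ring. }
    assert (diagq d U (mmul d S D) k = l k * diagq d U S k) as ->.
    { unfold diagq.
      assert (meq d (mmul d (adj U) (mmul d (mmul d S D) U))
                    (mmul d (mmul d (adj U) (mmul d S U)) (diagm l))) as E.
      { rewrite <- HD, !mmul_assoc, mmul_unitary_r by assumption. reflexivity. }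
      rewrite E, mmul_diagm_r by assumption. unfold Re; simpl; ring. }
    unfold S. rewrite diagq_add. field.
  - rewrite <- Hlk. apply Rabs_le. lra.
Qed.

(** * The overlap [T], the decision projector and measured pairs *)

Definition sfid (d : nat) (a b : Mat) : R := rtr d (mmul d (sqrtm d a) (sqrtm d b)).

(** Quantum Hellinger distance; for densities it equals [2 (1 - T)]. *)
Lemma sqrtm_dist d a b : psd d a -> psd d b ->
  hs d (msub (sqrtm d a) (sqrtm d b)) (msub (sqrtm d a) (sqrtm d b)) = rtr d a + rtr d b - 2 * sfid d a b.
Proof.
  intros Ha Hb. rewrite hs_sub_l, !hs_sub_r. unfold hs.
  rewrite !sqrtm_adj by (apply Ha || apply Hb). rewrite !sqrtm_sq by assumption.
  rewrite (rtr_comm d (sqrtm d b)). unfold sfid. ring.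
Qed.

Lemma sqrtm_diff_herm d a b : psd d a -> psd d b -> hermitian d (msub (sqrtm d a) (sqrtm d b)).
Proof.
  intros Ha Hb. unfold hermitian. rewrite adj_sub, !sqrtm_adj by (apply Ha || apply Hb). reflexivity.
Qed.

Lemma hs_herm_spectral d D U l : spectral_decomp d D U l -> hs d D D = rsum d (fun k => l k * l k).
Proof.
  intros H. unfold hs. rewrite (spectral_decomp_herm _ _ _ _ H).
  destruct H as [HU HD]. fold (fcalc d U l) in HD.
  rewrite HD, fcalc_mul, rtr_fcalc by assumption. reflexivity.
Qed.

Lemma nonneg_proj_decomp d D U l : spectral_decomp d D U l ->
  meq d (nonneg_proj d D) (fcalc d U (fun k => if Rle_dec 0 (l k) then 1 else 0)).
Proof. intros H. unfold nonneg_proj. now rewrite (matfun_eq _ _ _ _ _ H). Qed.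

Lemma nonneg_proj_projector d D : hermitian d D -> projector d (nonneg_proj d D).
Proof.
  intros HD. destruct (spectral_theorem d D HD) as (U & l & H).
  assert (E := nonneg_proj_decomp _ _ _ _ H).
  split; [unfold hermitian|]; rewrite E.
  - now rewrite fcalc_adj.
  - rewrite fcalc_mul by apply H. apply fcalc_ext; intros k _. destruct (Rle_dec 0 (l k)); ring.
Qed.

Lemma projector_compl d P : projector d P -> projector d (msub mid P).
Proof.
  intros [Hh Hi]; red in Hh. split; [unfold hermitian|].
  - rewrite adj_sub, adj_mid, Hh. reflexivity.
  - rewrite mmul_sub_l, !mmul_sub_r, Hi, !mmul_1_l, mmul_1_r.
    intros i j _ _. unfold msub. ring.
Qed.

Lemma projector_mid d : projector d mid.
Proof. split; [unfold hermitian; now rewrite adj_mid|apply mmul_1_l]. Qed.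

(** In the eigenbasis of [sqrt a - sqrt b], the difference [a_kk - b_kk] has the sign of [l k] and
    size at least [(l k)^2]. Summation compares [Tr a + Tr b - 2 T] with
    [2 Tr P (a - b) - Tr (a - b)]. *)
Lemma pgm_error_bound d a b : psd d a -> psd d b ->
  let P := nonneg_proj d (msub (sqrtm d a) (sqrtm d b)) in
  rtr d (mmul d (msub mid P) a) + rtr d (mmul d P b) <= sfid d a b.
Proof.
  intros Ha Hb P.
  destruct (spectral_theorem d _ (sqrtm_diff_herm d a b Ha Hb)) as (U & l & H).
  assert (E := nonneg_proj_decomp _ _ _ _ H). fold P in E.
  rewrite mmul_sub_l, rtr_sub, mmul_1_l, E, !rtr_fcalc_mul.
  assert (Hd := sqrtm_dist d a b Ha Hb). rewrite (hs_herm_spectral _ _ _ _ H) in Hd.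
  assert (rsum d (fun k => l k * l k) <=
          rsum d (fun k => (if Rle_dec 0 (l k) then 1 else 0) * (2 * diagq d U a k - 2 * diagq d U b k)
                           - (diagq d U a k - diagq d U b k))) as Hle.
  { apply rsum_le; intros k Hk.
    destruct (diagq_sq_diff d _ _ U l (sqrtm_psd d a (proj1 Ha)) (sqrtm_psd d b (proj1 Hb)) H k Hk) as (s & Hs & Hls).
    rewrite (diagq_meq d U _ a k Hk (sqrtm_sq d a Ha)), (diagq_meq d U _ b k Hk (sqrtm_sq d b Hb)) in Hs.
    revert Hls. unfold Rabs. destruct (Rle_dec 0 (l k)); destruct (Rcase_abs (l k)); nra. }
  rewrite rsum_sub, rsum_sub, !diagq_sum in Hle by apply H.
  rewrite (rsum_ext d (fun k => (if Rle_dec 0 (l k) then 1 else 0) * (2 * diagq d U a k - 2 * diagq d U b k))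
    (fun k => 2 * ((if Rle_dec 0 (l k) then 1 else 0) * diagq d U a k) -
              2 * ((if Rle_dec 0 (l k) then 1 else 0) * diagq d U b k))) in Hle by (intros; ring).
  rewrite rsum_sub, !rsum_scal in Hle. lra.
Qed.

Definition BC (d : nat) (U a b : Mat) : R := rsum d (fun k => sqrt (diagq d U a k * diagq d U b k)).

Lemma BC_pos d U a b : 0 <= BC d U a b.
Proof. apply rsum_nonneg; intros; apply sqrt_pos. Qed.

Lemma BC_le d U a b : unitary d U -> psd d a -> psd d b -> BC d U a b <= sqrt (rtr d a) * sqrt (rtr d b).
Proof.
  intros HU Ha Hb. rewrite <- (diagq_sum d U a HU), <- (diagq_sum d U b HU).
  apply rsum_CS; intros; now apply diagq_pos.
Qed.

Lemma density_rtr d a : density d a -> rtr d a = 1.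
Proof. intros [_ H]. unfold rtr. now rewrite H. Qed.

(* [|p - q| = |sqrt p - sqrt q| (sqrt p + sqrt q)], then Cauchy-Schwarz. *)
Lemma tv_le_BC n p q : (forall k, (k < n)%nat -> 0 <= p k) -> (forall k, (k < n)%nat -> 0 <= q k) ->
  rsum n p = 1 -> rsum n q = 1 ->
  let B := rsum n (fun k => sqrt (p k * q k)) in
  rsum n (fun k => Rabs (p k - q k)) * rsum n (fun k => Rabs (p k - q k)) <= 4 * (1 - B * B).
Proof.
  intros Hp Hq Sp Sq B.
  rewrite (rsum_ext n (fun k => Rabs (p k - q k))
    (fun k => Rabs (sqrt (p k) - sqrt (q k)) * (sqrt (p k) + sqrt (q k)))).
  2:{ intros k Hk. rewrite <- (Rabs_right (sqrt (p k) + sqrt (q k)))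
        by (generalize (sqrt_pos (p k)), (sqrt_pos (q k)); lra).
      rewrite <- Rabs_mult. f_equal.
      rewrite <- (sqrt_sqrt (p k)) at 1 by auto. rewrite <- (sqrt_sqrt (q k)) at 1 by auto. ring. }
  eapply Rle_trans; [apply (rsum_CS2 n (fun k => Rabs (sqrt (p k) - sqrt (q k))) (fun k => sqrt (p k) + sqrt (q k)))|]; cbv beta.
  assert (rsum n (fun k => Rabs (sqrt (p k) - sqrt (q k)) * Rabs (sqrt (p k) - sqrt (q k))) = 2 - 2 * B) as ->.
  { rewrite (rsum_ext n _ (fun k => p k + q k - 2 * sqrt (p k * q k))).
    - rewrite rsum_sub, rsum_add, rsum_scal. unfold B. lra.
    - intros k Hk. rewrite <- Rabs_mult, Rabs_right by (apply Rle_ge, Rle_0_sqr).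
      rewrite sqrt_mult by auto.
      generalize (sqrt_sqrt (p k) (Hp k Hk)), (sqrt_sqrt (q k) (Hq k Hk)). lra. }
  assert (rsum n (fun k => (sqrt (p k) + sqrt (q k)) * (sqrt (p k) + sqrt (q k))) = 2 + 2 * B) as ->.
  { rewrite (rsum_ext n _ (fun k => p k + q k + 2 * sqrt (p k * q k))).
    - rewrite !rsum_add, rsum_scal. unfold B. lra.
    - intros k Hk. rewrite sqrt_mult by auto.
      generalize (sqrt_sqrt (p k) (Hp k Hk)), (sqrt_sqrt (q k) (Hq k Hk)). lra. }
  lra.
Qed.

Lemma sfid_le_1 d a b : density d a -> density d b -> sfid d a b <= 1.
Proof.
  intros Ha Hb. assert (H := sqrtm_dist d a b (proj1 Ha) (proj1 Hb)).
  rewrite !density_rtr in H by assumption.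
  generalize (hs_pos d (msub (sqrtm d a) (sqrtm d b))). lra.
Qed.

(** In the eigenbasis of [sqrt a - sqrt b], the distance [2 (1 - T)] is at most the l1 distance of
    the outcome laws, which [tv_le_BC] bounds by [2 sqrt (1 - B^2)]. *)
Lemma BC_sfid d a b : density d a -> density d b ->
  exists U, unitary d U /\ (1 - sfid d a b) * (1 - sfid d a b) <= 1 - BC d U a b * BC d U a b.
Proof.
  intros Ha Hb. assert (Pa := proj1 Ha). assert (Pb := proj1 Hb).
  destruct (spectral_theorem d _ (sqrtm_diff_herm d a b Pa Pb)) as (U & l & H).
  exists U. split; [apply H|].
  assert (T := tv_le_BC d (diagq d U a) (diagq d U b) (fun k _ => diagq_pos d U a k Pa)
    (fun k _ => diagq_pos d U b k Pb)).
  rewrite !diagq_sum, !density_rtr in T by (assumption || apply H).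
  specialize (T eq_refl eq_refl). cbv zeta in T. fold (BC d U a b) in T.
  assert (Hd := sqrtm_dist d a b Pa Pb). rewrite (hs_herm_spectral _ _ _ _ H), !density_rtr in Hd by assumption.
  assert (rsum d (fun k => l k * l k) <= rsum d (fun k => Rabs (diagq d U a k - diagq d U b k))) as Hle.
  { apply rsum_le; intros k Hk.
    destruct (diagq_sq_diff d _ _ U l (sqrtm_psd d a (proj1 Pa)) (sqrtm_psd d b (proj1 Pb)) H k Hk) as (s & Hs & Hls).
    rewrite (diagq_meq d U _ a k Hk (sqrtm_sq d a Pa)), (diagq_meq d U _ b k Hk (sqrtm_sq d b Pb)) in Hs.
    rewrite Hs, Rabs_mult. assert (0 <= Rabs (l k)) by apply Rabs_pos. rewrite (Rabs_right s) by lra.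
    assert (l k * l k = Rabs (l k) * Rabs (l k)) as ->; [|nra].
    rewrite <- Rabs_mult. symmetry. apply Rabs_right. apply Rle_ge, Rle_0_sqr. }
  assert (S := sfid_le_1 d a b Ha Hb). nra.
Qed.

(** * Trace norm *)

Lemma col_CS d X Y k : Re (mmul d (adj X) Y k k) <= sqrt (cn d X k) * sqrt (cn d Y k).
Proof.
  apply sq_le_sqrt_mul; try apply cn_pos.
  assert (forall t, cn d (madd X (mscale t Y)) k = cn d X k + 2 * Re (mmul d (adj X) Y k k) * t + cn d Y k * t * t) as E.
  { intros t. unfold cn, mmul, Re. rewrite csum_fst.
    rewrite <- rsum_scal, <- !rsum_scal_r, <- !rsum_add. apply rsum_ext; intros i _.
    unfold Cnorm2, madd, mscale, adj; simpl. ring. }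
  apply quad_disc; try apply cn_pos. intros t. rewrite <- E. apply cn_pos.
Qed.

Lemma tnorm_eq d X U l : spectral_decomp d (mmul d (adj X) X) U l ->
  tnorm d X = rsum d (fun k => sqrt (l k)).
Proof.
  intros H. unfold tnorm. fold (rtr d (sqrtm d (mmul d (adj X) X))).
  destruct (sqrtm_decomp _ _ _ _ H) as [HU E]. fold (fcalc d U (fun k => sqrt (l k))) in E.
  now rewrite E, rtr_fcalc.
Qed.

(** In the right singular basis the columns of [X U] have the singular values as their lengths. *)
Lemma cn_gram_spectral d X U l : spectral_decomp d (mmul d (adj X) X) U l ->
  forall k, (k < d)%nat -> cn d (mmul d X U) k = l k.
Proof.
  intros H k Hk. rewrite cn_gram, adj_mul, mmul_assoc, <- (mmul_assoc d (adj X)).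
  rewrite (spectral_decomp_diag _ _ _ _ H) by assumption. unfold diagm. now rewrite Nat.eqb_refl.
Qed.

Lemma rtr_le_tnorm d X : rtr d X <= tnorm d X.
Proof.
  destruct (psd_spectral d _ (psd_gram d X)) as (U & l & H & Hl).
  rewrite (tnorm_eq _ _ _ _ H), <- (rtr_conj_unitary d U X) by apply H. rewrite rtr_sum.
  apply rsum_le; intros k Hk. eapply Rle_trans; [apply col_CS|].
  rewrite (cn_gram_spectral _ _ _ _ H) by assumption.
  rewrite cn_gram, (unitary_l d U (proj1 H)) by assumption.
  unfold mid. rewrite Nat.eqb_refl. unfold Re; simpl. rewrite sqrt_1. lra.
Qed.

Lemma tnorm_pos d X : 0 <= tnorm d X.
Proof.
  destruct (psd_spectral d _ (psd_gram d X)) as (U & l & H & Hl).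
  rewrite (tnorm_eq _ _ _ _ H). apply rsum_nonneg; intros; apply sqrt_pos.
Qed.

(** The two hypotheses say that [W] is a partial isometry. Subtracting from [Z] its projection
    [W (adj W Z)] leaves a column of nonnegative squared length, the difference of the two sides. *)
Lemma bessel d W E Z k : (k < d)%nat ->
  meq d (mmul d (adj W) W) E -> meq d (mmul d W E) W ->
  cn d (mmul d (adj W) Z) k <= cn d Z k.
Proof.
  intros Hk HE HWE.
  set (Y := mmul d (adj W) Z).
  assert (0 <= cn d (msub Z (mmul d W Y)) k) as H by apply cn_pos.
  rewrite cn_gram in H.
  assert (meq d (mmul d (adj (msub Z (mmul d W Y))) (msub Z (mmul d W Y)))
     (msub (mmul d (adj Z) Z) (mmul d (adj Y) Y))) as EE.
  { rewrite adj_sub, adj_mul, mmul_sub_l, !mmul_sub_r, !mmul_assoc.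
    assert (meq d (mmul d (adj W) (mmul d W Y)) Y) as EY.
    { unfold Y. rewrite <- !mmul_assoc.
      transitivity (mmul d (adj (mmul d W (mmul d (adj W) W))) Z).
      - rewrite adj_mul, adj_mul, adj_adj, mmul_assoc. rewrite !mmul_assoc. reflexivity.
      - rewrite HE, HWE. reflexivity. }
    assert (mmul d (adj Z) (mmul d W Y) = mmul d (adj Y) Y) as E2.
    { unfold Y at 2. rewrite adj_mul, adj_adj, mmul_assoc. reflexivity. }
    rewrite EY, E2. change (mmul d (adj W) Z) with Y.
    intros i j _ _. unfold msub. ring. }
  rewrite EE in H by assumption. rewrite (cn_gram d Y), (cn_gram d Z).
  unfold msub, Re in *; simpl in H. lra.
Qed.

(* [tnorm (A B) = Re tr (W^* A B V)] for the partial isometry [W = A B V s^-1] of the polar decomposition;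
   insert the basis [U] between [A] and [B]. *)
Lemma tnorm_le_BC d U a b : unitary d U -> psd d a -> psd d b ->
  tnorm d (mmul d (sqrtm d a) (sqrtm d b)) <= BC d U a b.
Proof.
  intros HU Ha Hb. set (A := sqrtm d a). set (B := sqrtm d b). set (X := mmul d A B).
  destruct (psd_spectral d _ (psd_gram d X)) as (V & l & H & Hl).
  rewrite (tnorm_eq _ _ _ _ H).
  (* Inverse singular values, with 0 on the kernel: the columns of [W] are the normalized nonzero
     columns of [X V]. *)
  set (n := fun k => if Rlt_dec 0 (l k) then / sqrt (l k) else 0).
  set (W := mmul d (mmul d X V) (diagm n)).
  assert (meq d (mmul d (adj X) (mmul d X V)) (mmul d V (diagm l))) as HXV.
  { rewrite <- mmul_assoc. destruct H as [HV HX]. rewrite HX at 1.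
    rewrite !mmul_assoc, (unitary_l _ _ HV), mmul_1_r. reflexivity. }
  assert (meq d (mmul d (adj V) (mmul d (adj X) (mmul d X V))) (diagm l)) as HVX
    by (rewrite HXV; apply mmul_unitary_l, H).
  assert (meq d (mmul d (adj W) W) (diagm (fun k => n k * l k * n k))) as HWW.
  { unfold W. rewrite !adj_mul, adj_diagm, !mmul_assoc.
    rewrite <- (mmul_assoc d X V), <- (mmul_assoc d (adj X)), <- (mmul_assoc d (adj V)).
    rewrite HVX, !mmul_diagm. apply diagm_ext; intros; ring. }
  assert (forall k, (k < d)%nat -> n k * l k * n k * n k = n k /\ n k * l k = sqrt (l k)) as Hn.
  { intros k Hk. unfold n. destruct (Rlt_dec 0 (l k)) as [Hp|Hp].
    - assert (0 < sqrt (l k)) by now apply sqrt_lt_R0.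
      assert (Es : sqrt (l k) * sqrt (l k) = l k) by (apply sqrt_sqrt; lra).
      set (s := sqrt (l k)) in *. rewrite <- Es. split; field; lra.
    - specialize (Hl k Hk). replace (l k) with 0 by lra. rewrite sqrt_0. lra. }
  assert (meq d (mmul d W (diagm (fun k => n k * l k * n k))) W) as HWE.
  { unfold W. rewrite mmul_assoc, mmul_diagm. apply mmul_meq; [reflexivity|].
    apply diagm_ext; intros k Hk. rewrite <- (proj1 (Hn k Hk)) at 4. ring. }
  assert (rsum d (fun k => sqrt (l k)) = rtr d (mmul d (adj W) (mmul d X V))) as ->.
  { unfold W. rewrite !adj_mul, adj_diagm, !mmul_assoc. rewrite HVX, mmul_diagm, rtr_diagm.
    apply rsum_ext; intros k Hk. symmetry. apply Hn, Hk. }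
  (* Cyclicity moves [B V] to the front, and [U (adj U)] is inserted before it. *)
  assert (rtr d (mmul d (adj W) (mmul d X V)) =
          rtr d (mmul d (adj (mmul d (adj (mmul d B V)) U)) (mmul d (adj W) (mmul d A U)))) as ->.
  { unfold X. rewrite adj_mul, adj_adj.
    rewrite (rtr_comm d _ (mmul d (adj W) (mmul d A U))), !mmul_assoc, mmul_unitary_r by assumption.
    reflexivity. }
  rewrite rtr_sum. unfold BC. apply rsum_le; intros k Hk.
  rewrite Rmult_comm, sqrt_mult by (now apply diagq_pos).
  eapply Rle_trans; [apply col_CS|].
  apply Rmult_le_compat; try apply sqrt_pos; apply sqrt_le_1_alt.
  (* The unitary [V] drops out, so this column has squared length exactly [diagq d U b k]. *)
  - rewrite cn_gram. unfold diagq. apply Req_le. f_equal.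
    assert (meq d (mmul d (adj (mmul d (adj (mmul d B V)) U)) (mmul d (adj (mmul d B V)) U))
                  (mmul d (adj U) (mmul d b U))) as E; [|now rewrite E].
    rewrite !adj_mul, !adj_adj, !mmul_assoc. rewrite mmul_unitary_r by apply H.
    unfold B. rewrite sqrtm_adj by apply Hb. rewrite <- (mmul_assoc d (sqrtm d b)), sqrtm_sq by assumption.
    reflexivity.
  (* [adj W] does not lengthen columns, and the column of [A U] has squared length
     [diagq d U a k]. *)
  - eapply Rle_trans; [apply (bessel d W _ _ k Hk HWW HWE)|].
    rewrite cn_gram. unfold diagq. apply Req_le. f_equal.
    assert (meq d (mmul d (adj (mmul d A U)) (mmul d A U))
                  (mmul d (adj U) (mmul d a U))) as E; [|now rewrite E].
    rewrite adj_mul, !mmul_assoc. unfold A. rewrite sqrtm_adj by apply Ha.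
    rewrite <- (mmul_assoc d (sqrtm d a)), sqrtm_sq by assumption. reflexivity.
Qed.

(** * Holevo information of a pair of states *)

Lemma psd_sub_le_diag d a r U k : psd d (msub r a) -> diagq d U a k <= diagq d U r k.
Proof. intros H. generalize (diagq_pos d U _ k H). rewrite diagq_sub. lra. Qed.

(** In the eigenbasis of [M - C], a negative eigenvalue [l k] would make the diagonal entry
    [l k * s] of [M^2 - C^2] negative, since [s >= |l k| > 0]. *)
Lemma sqrt_operator_monotone d C M :
  psd d C -> psd d M -> psd d (msub (mmul d M M) (mmul d C C)) -> psd d (msub M C).
Proof.
  intros HC HM H.
  assert (hermitian d (msub M C)) as Hh.
  { unfold hermitian. rewrite adj_sub, (psd_herm _ _ HC), (psd_herm _ _ HM). reflexivity. }
  destruct (spectral_theorem d _ Hh) as (U & l & HD).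
  rewrite (proj2 HD). apply (fcalc_psd d U l). intros k Hk.
  destruct (diagq_sq_diff d M C U l HM HC HD k Hk) as (s & Hs & Hls).
  assert (Hp := psd_sub_le_diag d _ _ U k H).
  destruct (Rle_dec 0 (l k)) as [|Hn]; [assumption|exfalso].
  rewrite Rabs_left in Hls by lra. nra.
Qed.

Definition pinv_sqrt (x : R) : R := if Rlt_dec 0 x then / sqrt x else 0.

(* With [A = sqrt a], [N = V n(m) V^*] the pseudo-inverse of [sqrt r] and [G = A N^2 A], the hypothesis
   [a <= 2 r] gives [tr A G^2 A <= 2 tr A G A], while [(tr A G A)^2 <= tr A^2 * tr A G^2 A]. *)
Lemma chi2_le_2 d a r V m : density d a -> psd d r -> psd d (msub (mscale 2 r) a) ->
  spectral_decomp d r V m ->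
  let N := fcalc d V (fun k => pinv_sqrt (m k)) in
  hs d (mmul d a N) (mmul d a N) <= 2.
Proof.
  intros Ha Hr Hle HV N.
  assert (Pa := proj1 Ha). assert (Ea := psd_herm _ _ Pa).
  assert (HUV := proj1 HV). assert (Hm := psd_eigen_pos _ _ _ _ Hr HV).
  set (A := sqrtm d a). assert (EA := sqrtm_adj d a (proj1 Pa)). fold A in EA.
  assert (AA := sqrtm_sq d a Pa). fold A in AA.
  set (N2 := mmul d N N).
  assert (EN : adj N = N) by apply fcalc_adj.
  assert (EN2 : adj N2 = N2) by (unfold N2; now rewrite adj_mul, EN).
  set (t := hs d (mmul d a N) (mmul d a N)).
  assert (Ht : t = rtr d (mmul d a (mmul d N2 a))).
  { unfold t, hs. rewrite adj_mul, EN, Ea, rtr_comm.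
    unfold N2. rewrite !mmul_assoc. reflexivity. }
  (* [N2] is the pseudo-inverse of [r]. *)
  assert (Hr2 : meq d (mmul d N2 (mmul d r N2)) N2).
  { unfold N2, N. rewrite (proj2 HV). fold (fcalc d V m). rewrite !fcalc_mul by assumption.
    apply fcalc_ext; intros k Hk. unfold pinv_sqrt. destruct (Rlt_dec 0 (m k)) as [Hp|]; [|ring].
    assert (Es : sqrt (m k) * sqrt (m k) = m k) by (apply sqrt_sqrt; lra).
    assert (0 < sqrt (m k)) by now apply sqrt_lt_R0.
    set (s := sqrt (m k)) in *. rewrite <- Es. field. lra. }
  set (G := mmul d A (mmul d N2 A)).
  assert (EG : meq d (adj G) G).
  { unfold G. rewrite !adj_mul, EA, EN2, mmul_assoc. reflexivity. }
  assert (H1 : t = hs d A (mmul d G A)).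
  { rewrite Ht. unfold hs, G. rewrite EA, <- AA, !mmul_assoc. reflexivity. }
  assert (H2 : hs d (mmul d G A) (mmul d G A) <= 2 * t).
  { unfold hs. rewrite adj_mul, EG, EA.
    assert (meq d (mmul d (mmul d A G) (mmul d G A)) (mmul d (adj (mmul d N2 a)) (mmul d a (mmul d N2 a)))) as ->.
    { rewrite adj_mul, Ea, EN2. unfold G. rewrite <- AA, !mmul_assoc. reflexivity. }
    assert (P := psd_conj_rtr d _ (mmul d N2 a) Hle).
    rewrite mmul_sub_l, mmul_sub_r, rtr_sub, mmul_scale_l, mmul_scale_r, rtr_scale in P.
    assert (rtr d (mmul d (adj (mmul d N2 a)) (mmul d r (mmul d N2 a))) = t) as E; [|lra].
    rewrite Ht, adj_mul, Ea, EN2, !mmul_assoc.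
    rewrite <- (mmul_assoc d r), <- (mmul_assoc d N2), Hr2. reflexivity. }
  assert (H3 : hs d A A = 1).
  { unfold hs. rewrite EA, AA. now apply density_rtr. }
  assert (H4 := hs_CS d A (mmul d G A)). rewrite <- H1, H3 in H4.
  assert (0 <= t) by apply hs_pos.
  (* The two estimates combine to [t^2 <= 2 t]. *)
  destruct (Req_dec t 0); nra.
Qed.

Lemma diagq_fcalc d U f V k :
  diagq d V (fcalc d U f) k = rsum d (fun j => Cnorm2 (mmul d (adj U) V j k) * f j).
Proof.
  unfold diagq, fcalc. set (c := mmul d (adj U) V).
  assert (mmul d (adj V) (mmul d (mmul d (mmul d U (diagm f)) (adj U)) V) =
          mmul d (adj c) (mmul d (diagm f) c)) as ->.
  { unfold c. rewrite adj_mul, adj_adj, !mmul_assoc. reflexivity. }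
  unfold mmul at 1, Re. rewrite csum_fst. apply rsum_ext; intros j Hj.
  rewrite mmul_diagm_l by assumption. unfold adj, Cnorm2; simpl. ring.
Qed.

Lemma unitary_cn d U k : (k < d)%nat -> unitary d U -> cn d U k = 1.
Proof.
  intros Hk HU. rewrite cn_gram, (unitary_l _ _ HU) by assumption.
  unfold mid. rewrite Nat.eqb_refl. reflexivity.
Qed.

Lemma unitary_mul d U V : unitary d U -> unitary d V -> unitary d (mmul d U V).
Proof.
  intros HU HV. unfold unitary. rewrite adj_mul, mmul_assoc, mmul_unitary_l by assumption.
  now apply unitary_l.
Qed.

Lemma unitary_adj_unitary d U : unitary d U -> unitary d (adj U).
Proof. intros HU. unfold unitary. rewrite adj_adj. now apply unitary_r. Qed.

(** * Logarithms and the relative entropy to a dominating state *)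

Definition Ln (x : R) : R := if Rlt_dec 0 x then ln x else 0.

Lemma xlog2x_Ln x : 0 <= x -> xlog2x x = x * Ln x / ln 2.
Proof.
  intros Hx. unfold xlog2x, Ln. destruct (Rlt_dec 0 x); unfold Rdiv; [ring|ring].
Qed.

Lemma ln2_pos : 0 < ln 2.
Proof. rewrite <- ln_1. apply ln_increasing; lra. Qed.

Lemma ln_le_sub1 x : 0 < x -> ln x <= x - 1.
Proof.
  intros Hx. destruct (Req_dec x 1) as [->|Hne]; [rewrite ln_1; lra|].
  assert (H := exp_ineq1_le (x - 1)).
  rewrite <- (ln_exp (x - 1)). left.
  apply ln_increasing; [assumption|].
  assert (1 + (x - 1) < exp (x - 1)) by (apply exp_ineq1; lra). lra.
Qed.

Lemma ln_sqrt x : 0 < x -> ln (sqrt x) = ln x / 2.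
Proof.
  intros Hx. assert (0 < sqrt x) by now apply sqrt_lt_R0.
  assert (ln x = ln (sqrt x) + ln (sqrt x)); [|lra].
  rewrite <- ln_mult by assumption. rewrite sqrt_sqrt by lra. reflexivity.
Qed.

(* Tangent of [ln] at [theta], applied to [ln x - ln y = 2 ln (sqrt x / sqrt y)]. *)
Lemma ln_diff_bound theta x y : 0 < theta -> 0 < x -> 0 < y ->
  ln x - ln y <= 2 * (sqrt x * pinv_sqrt y / theta - 1 + ln theta).
Proof.
  intros Ht Hx Hy. unfold pinv_sqrt. destruct (Rlt_dec 0 y) as [_|]; [|lra].
  assert (0 < sqrt x) by now apply sqrt_lt_R0. assert (0 < sqrt y) by now apply sqrt_lt_R0.
  assert (0 < / sqrt y) by now apply Rinv_0_lt_compat.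
  assert (0 < / theta) by now apply Rinv_0_lt_compat.
  assert (L := ln_le_sub1 (sqrt x * / sqrt y / theta)).
  unfold Rdiv in L. rewrite !ln_mult, !ln_Rinv, !ln_sqrt in L by (repeat apply Rmult_lt_0_compat; assumption).
  assert (0 < sqrt x * / sqrt y * / theta) by (repeat apply Rmult_lt_0_compat; assumption).
  specialize (L H3). unfold Rdiv. lra.
Qed.

Section RelativeEntropy.
Variables (d : nat) (a r : Mat) (V : Mat) (m : nat -> R).
Hypotheses (Ha : density d a) (Hr : psd d r) (Hle : psd d (msub (mscale 2 r) a))
  (HV : spectral_decomp d r V m).
Let N := fcalc d V (fun k => pinv_sqrt (m k)).
Let A := sqrtm d a.
(** [Tr a^(3/2) r^(-1/2)]. Under the weights [w j k * al j] of [relative_entropy_bound] it is the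
    mean of [sqrt (al j / m k)]. *)
Let Q := hs d A (mmul d a N).

Lemma pgm_overlap_le_sqrt2 : Q <= sqrt 2.
Proof.
  assert (Pa := proj1 Ha).
  eapply Rle_trans; [apply hs_CS_sqrt|].
  assert (hs d A A = 1) as ->.
  { unfold hs, A. rewrite sqrtm_adj, sqrtm_sq by (assumption || apply Pa). now apply density_rtr. }
  rewrite sqrt_1, Rmult_1_l. apply sqrt_le_1_alt. unfold N. now apply chi2_le_2 with (r := r).
Qed.

(** [Q] pairs [a N] with [A]; pairing [a N] with [sqrt r] instead gives the weight of [a] on the
    support of [r], at most 1. Cauchy-Schwarz bounds the difference, with [sqrt 2] from
    [chi2_le_2]. *)
Lemma pgm_overlap_le_dist :
  Q - 1 <= sqrt 2 * sqrt (rtr d a + rtr d r - 2 * sfid d a r).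
Proof.
  assert (Pa := proj1 Ha). assert (Hm := psd_eigen_pos _ _ _ _ Hr HV).
  rewrite <- sqrtm_dist by assumption. fold A.
  assert (Q - 1 <= hs d (mmul d a N) (msub A (sqrtm d r))) as H.
  { rewrite hs_sub_r, hs_sym. fold Q.
    assert (hs d (mmul d a N) (sqrtm d r) <= 1); [|lra].
    unfold hs. rewrite adj_mul. unfold N. rewrite fcalc_adj, (psd_herm _ _ Pa), mmul_assoc, rtr_comm, mmul_assoc, rtr_comm.
    assert (E : meq d (sqrtm d r) (fcalc d V (fun k => sqrt (m k)))) by apply (sqrtm_decomp d r V m HV).
    rewrite E, fcalc_mul, rtr_fcalc_mul by apply HV.
    rewrite <- (density_rtr d a Ha), <- (diagq_sum d V a (proj1 HV)).
    apply rsum_le; intros k Hk. assert (P := diagq_pos d V a k Pa).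
    assert (sqrt (m k) * pinv_sqrt (m k) <= 1); [|nra].
    unfold pinv_sqrt. destruct (Rlt_dec 0 (m k)) as [Hp|]; [|lra].
    rewrite Rinv_r; [lra|]. apply Rgt_not_eq. now apply sqrt_lt_R0. }
  eapply Rle_trans; [apply H|]. eapply Rle_trans; [apply hs_CS_sqrt|].
  apply Rmult_le_compat_r; [apply sqrt_pos|]. apply sqrt_le_1_alt. unfold N. now apply chi2_le_2 with (r := r).
Qed.

(** The left side is the relative entropy of [a] to [r], in nats. With [w j k] the squared overlaps
    of the two eigenbases it is the mean of [ln (al j) - ln (m k)] under the probability weights
    [w j k * al j], so the scalar tangent bound applies term by term. *)
Lemma relative_entropy_bound theta U al : 0 < theta -> spectral_decomp d a U al ->
  rsum d (fun j => al j * Ln (al j)) - rsum d (fun k => diagq d V a k * Ln (m k))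
  <= 2 * (Q / theta - 1 + ln theta).
Proof.
  intros Ht HU.
  assert (Pa := proj1 Ha). assert (Hal := psd_eigen_pos _ _ _ _ Pa HU).
  assert (UU := proj1 HU). assert (VV := proj1 HV).
  set (w := fun j k => Cnorm2 (mmul d (adj U) V j k)).
  assert (Ww : forall j k, 0 <= w j k) by (intros; apply Cnorm2_pos).
  assert (Uc : unitary d (mmul d (adj U) V)) by (apply unitary_mul; [now apply unitary_adj_unitary|assumption]).
  assert (Wr : forall j, (j < d)%nat -> rsum d (fun k => w j k) = 1).
  { intros j Hj. rewrite <- (unitary_cn d (adj (mmul d (adj U) V)) j Hj (unitary_adj_unitary _ _ Uc)).
    apply rsum_ext; intros k _. unfold w, adj, Cnorm2; simpl. ring. }
  assert (Wa : forall f k, (k < d)%nat -> forall X, meq d X (fcalc d U f) -> diagq d V X k = rsum d (fun j => w j k * f j)).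
  { intros f k Hk X HX. rewrite (diagq_meq _ _ _ _ _ Hk HX). apply diagq_fcalc. }
  assert (Wdiag : forall k, (k < d)%nat -> diagq d V a k = rsum d (fun j => w j k * al j)).
  { intros k Hk. apply Wa; [assumption|apply HU]. }
  (* [a <= 2 r] acts as the support condition: a positive weight forces [m k > 0]. *)
  assert (Wm : forall j k, (j < d)%nat -> (k < d)%nat -> w j k * al j <= 2 * m k).
  { intros j k Hj Hk.
    assert (P := psd_sub_le_diag d a _ V k Hle). rewrite diagq_scale, (diagq_spectral _ _ _ _ HV k Hk) in P.
    rewrite Wdiag in P by assumption.
    eapply Rle_trans; [|apply P].
    apply (rsum_term_le d (fun j => w j k * al j)); [|assumption].
    intros i Hi. apply Rmult_le_pos; auto. }
  assert (HQ : Q = rsum d (fun j => rsum d (fun k => w j k * (al j * (sqrt (al j) * pinv_sqrt (m k)))))).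
  { unfold Q, hs, A. rewrite sqrtm_adj by apply Pa. rewrite <- mmul_assoc, rtr_comm.
    unfold N. rewrite rtr_fcalc_mul.
    rewrite rsum_swap. apply rsum_ext; intros k Hk.
    rewrite (Wa (fun j => sqrt (al j) * al j) k Hk).
    - rewrite <- rsum_scal. apply rsum_ext; intros; ring.
    - rewrite <- fcalc_mul by assumption. apply mmul_meq; [|apply HU].
      apply (sqrtm_decomp d a U al HU). }
  assert (H1 : rsum d (fun j => rsum d (fun k => w j k * al j)) = 1).
  { rewrite rsum_swap. rewrite <- (density_rtr d a Ha), <- (diagq_sum d V a VV).
    apply rsum_ext; intros k Hk. symmetry. now apply Wdiag. }
  rewrite (rsum_ext d (fun j => al j * Ln (al j)) (fun j => rsum d (fun k => w j k * (al j * Ln (al j)))))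
    by (intros j Hj; rewrite rsum_scal_r, Wr by assumption; ring).
  rewrite (rsum_ext d (fun k => diagq d V a k * Ln (m k)) (fun k => rsum d (fun j => w j k * (al j * Ln (m k)))))
    by (intros k Hk; rewrite Wdiag, <- rsum_scal_r by assumption; apply rsum_ext; intros; ring).
  rewrite (rsum_swap d d (fun k j => w j k * (al j * Ln (m k)))), <- rsum_sub.
  replace (2 * (Q / theta - 1 + ln theta)) with (2 / theta * Q + 2 * (ln theta - 1) * 1) by (field; lra).
  rewrite <- H1 at 2. rewrite HQ, <- !rsum_scal, <- rsum_add.
  apply rsum_le; intros j Hj. rewrite <- !rsum_scal, <- rsum_sub, <- rsum_add.
  apply rsum_le; intros k Hk.
  specialize (Ww j k). specialize (Wm j k Hj Hk). specialize (Hal j Hj).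
  destruct (Req_dec (w j k * al j) 0) as [E|E].
  - replace (w j k * (al j * Ln (al j)) - w j k * (al j * Ln (m k))) with (w j k * al j * (Ln (al j) - Ln (m k))) by ring.
    replace (2 / theta * (w j k * (al j * (sqrt (al j) * pinv_sqrt (m k)))) + 2 * (ln theta - 1) * (w j k * al j))
      with (w j k * al j * (2 / theta * (sqrt (al j) * pinv_sqrt (m k)) + 2 * (ln theta - 1))) by ring.
    rewrite E; lra.
  - assert (0 < w j k * al j) by nra. assert (0 < al j) by nra. assert (0 < m k) by nra.
    assert (B := ln_diff_bound theta (al j) (m k) Ht ltac:(assumption) ltac:(assumption)).
    unfold Ln. destruct (Rlt_dec 0 (al j)); [|lra]. destruct (Rlt_dec 0 (m k)); [|lra].
    apply (Rmult_le_compat_l (w j k * al j)) in B; [|lra].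
    replace (2 / theta * (w j k * (al j * (sqrt (al j) * pinv_sqrt (m k)))) + 2 * (ln theta - 1) * (w j k * al j))
      with (w j k * al j * (2 * (sqrt (al j) * pinv_sqrt (m k) / theta - 1 + ln theta))) by (field; lra).
    lra.
Qed.
End RelativeEntropy.

Definition avg2 (a b : Mat) : Mat := mscale (1/2) (madd a b).

Lemma avg2_density d a b : density d a -> density d b -> density d (avg2 a b).
Proof.
  intros [Pa Ta] [Pb Tb]. split.
  - apply psd_scale; [lra|]. now apply psd_add.
  - apply C_ext; unfold trace in *; rewrite ?csum_fst, ?csum_snd.
    + apply (f_equal fst) in Ta, Tb. rewrite csum_fst in Ta, Tb.
      rewrite (rsum_ext d _ (fun i => 1/2 * (fst (a i i) + fst (b i i))))
        by (intros; unfold avg2, mscale, madd; simpl; ring).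
      rewrite rsum_scal, rsum_add, Ta, Tb. simpl. lra.
    + apply (f_equal snd) in Ta, Tb. rewrite csum_snd in Ta, Tb.
      rewrite (rsum_ext d _ (fun i => 1/2 * (snd (a i i) + snd (b i i))))
        by (intros; unfold avg2, mscale, madd; simpl; ring).
      rewrite rsum_scal, rsum_add, Ta, Tb. simpl. lra.
Qed.

Lemma avg2_dominates_l d a b : psd d b -> psd d (msub (mscale 2 (avg2 a b)) a).
Proof.
  intros Hb. assert (meq d (msub (mscale 2 (avg2 a b)) a) b) as ->; [|assumption].
  intros i j _ _. unfold msub, avg2, mscale, madd. apply C_ext; simpl; field.
Qed.
Lemma avg2_dominates_r d a b : psd d a -> psd d (msub (mscale 2 (avg2 a b)) b).
Proof.
  intros Hb. assert (meq d (msub (mscale 2 (avg2 a b)) b) a) as ->; [|assumption].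
  intros i j _ _. unfold msub, avg2, mscale, madd. apply C_ext; simpl; field.
Qed.

(* [((A+B)/2)^2 <= (A^2+B^2)/2 = r], so operator monotonicity gives [sqrt r >= (A+B)/2]. *)
Lemma sqrtm_avg2 d a b : psd d a -> psd d b ->
  psd d (msub (sqrtm d (avg2 a b)) (avg2 (sqrtm d a) (sqrtm d b))).
Proof.
  intros Ha Hb.
  assert (Hr : psd d (avg2 a b)) by (apply psd_scale; [lra|]; now apply psd_add).
  assert (HA := sqrtm_psd d a (proj1 Ha)). assert (HB := sqrtm_psd d b (proj1 Hb)).
  assert (HM := sqrtm_psd d _ (proj1 Hr)).
  apply sqrt_operator_monotone; [|assumption|].
  - apply psd_scale; [lra|]. now apply psd_add.
  - rewrite (sqrtm_sq d _ Hr). set (A := sqrtm d a) in *. set (B := sqrtm d b) in *.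
    assert (meq d (msub (avg2 a b) (mmul d (avg2 A B) (avg2 A B)))
      (mscale (1/4) (mmul d (adj (msub A B)) (msub A B)))) as ->.
    { rewrite adj_sub, (psd_herm _ _ HA), (psd_herm _ _ HB).
      unfold avg2. rewrite <- (sqrtm_sq d a Ha) at 1. rewrite <- (sqrtm_sq d b Hb) at 1.
      fold A B. rewrite !mmul_scale_l, !mmul_scale_r, !mmul_sub_l, !mmul_add_l, !mmul_sub_r, !mmul_add_r.
      intros i j _ _. unfold msub, mscale, madd. apply C_ext; simpl; field. }
    apply psd_scale; [lra|]. apply psd_gram.
Qed.

(** Pairing [sqrt a] with [sqrt r >= (sqrt a + sqrt b) / 2], where [r] is the average, gives
    [Tr sqrt a sqrt r >= (1 + T) / 2]; likewise for [b]. *)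
Lemma sfid_avg2 d a b : density d a -> density d b ->
  2 - 2 * sfid d a (avg2 a b) <= 1 - sfid d a b /\ 2 - 2 * sfid d b (avg2 a b) <= 1 - sfid d a b.
Proof.
  intros Ha Hb. assert (H := sqrtm_avg2 d a b (proj1 Ha) (proj1 Hb)).
  assert (HA := sqrtm_psd d a (proj1 (proj1 Ha))). assert (HB := sqrtm_psd d b (proj1 (proj1 Hb))).
  assert (P1 := psd_mul_rtr d _ _ HA H). assert (P2 := psd_mul_rtr d _ _ HB H).
  rewrite mmul_sub_r, rtr_sub in P1, P2. unfold avg2 at 2 in P1. unfold avg2 at 2 in P2.
  rewrite mmul_scale_r, mmul_add_r, rtr_scale, rtr_add in P1, P2.
  rewrite (sqrtm_sq d a (proj1 Ha)) in P1. rewrite (sqrtm_sq d b (proj1 Hb)) in P2.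
  rewrite (density_rtr d a Ha) in P1. rewrite (density_rtr d b Hb), (rtr_comm d (sqrtm d b) (sqrtm d a)) in P2.
  fold (sfid d a b) in P1, P2. fold (sfid d a (avg2 a b)) in P1. fold (sfid d b (avg2 a b)) in P2. lra.
Qed.

(** [I ln 2] is the mean of the relative entropies of [a] and [b] to their average. [theta] stays
    free because two values are used below; the overlaps are existential to hide the eigenbases. *)
Lemma mutinf_bound theta d a b : 0 < theta -> density d a -> density d b -> exists Qa Qb,
  (Qa <= sqrt 2 /\ Qb <= sqrt 2) /\
  (Qa - 1 <= sqrt 2 * sqrt (1 - sfid d a b) /\ Qb - 1 <= sqrt 2 * sqrt (1 - sfid d a b)) /\
  mutinf d a b * ln 2 <= (Qa / theta - 1 + ln theta) + (Qb / theta - 1 + ln theta).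
Proof.
  intros Ht Ha Hb.
  assert (Dr := avg2_density d a b Ha Hb). assert (Pr := proj1 Dr).
  destruct (psd_spectral d _ (proj1 Ha)) as (U & al & HU & Hal).
  destruct (psd_spectral d _ (proj1 Hb)) as (W & be & HW & Hbe).
  destruct (psd_spectral d _ Pr) as (V & m & HV & Hm).
  assert (La := avg2_dominates_l d a b (proj1 Hb)). assert (Lb := avg2_dominates_r d a b (proj1 Ha)).
  set (r := avg2 a b) in *.
  destruct (sfid_avg2 d a b Ha Hb) as [Fa Fb]. fold r in Fa, Fb.
  do 2 eexists. split; [split|split; [split|]].
  - exact (pgm_overlap_le_sqrt2 d a r V m Ha Pr La HV).
  - exact (pgm_overlap_le_sqrt2 d b r V m Hb Pr Lb HV).
  - eapply Rle_trans; [exact (pgm_overlap_le_dist d a r V m Ha Pr La HV)|].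
    apply Rmult_le_compat_l; [apply sqrt_pos|]. apply sqrt_le_1_alt.
    rewrite !density_rtr by assumption. lra.
  - eapply Rle_trans; [exact (pgm_overlap_le_dist d b r V m Hb Pr Lb HV)|].
    apply Rmult_le_compat_l; [apply sqrt_pos|]. apply sqrt_le_1_alt.
    rewrite !density_rtr by assumption. lra.
  - assert (Ra := relative_entropy_bound d a r V m Ha La HV theta U al Ht HU).
    assert (Rb := relative_entropy_bound d b r V m Hb Lb HV theta W be Ht HW).
    unfold mutinf. fold (avg2 a b). fold r.
    rewrite (entropy_eq _ _ _ _ HU), (entropy_eq _ _ _ _ HW), (entropy_eq _ _ _ _ HV).
    assert (L2 := ln2_pos).
    rewrite (rsum_ext d (fun k => xlog2x (al k)) (fun k => al k * Ln (al k) * / ln 2)) by (intros; apply xlog2x_Ln; auto).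
    rewrite (rsum_ext d (fun k => xlog2x (be k)) (fun k => be k * Ln (be k) * / ln 2)) by (intros; apply xlog2x_Ln; auto).
    rewrite (rsum_ext d (fun k => xlog2x (m k)) (fun k => m k * Ln (m k) * / ln 2)) by (intros; apply xlog2x_Ln; auto).
    rewrite !rsum_scal_r.
    assert (rsum d (fun k => m k * Ln (m k)) =
      1/2 * (rsum d (fun k => diagq d V a k * Ln (m k)) + rsum d (fun k => diagq d V b k * Ln (m k)))) as ->.
    { rewrite <- rsum_add, <- rsum_scal. apply rsum_ext; intros k Hk.
      rewrite <- (diagq_spectral _ _ _ _ HV k Hk) at 1. unfold r, avg2. rewrite diagq_scale, diagq_add. ring. }
    set (x := rsum d (fun k => diagq d V a k * Ln (m k))) in *.
    set (y := rsum d (fun k => diagq d V b k * Ln (m k))) in *.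
    set (z := rsum d (fun k => al k * Ln (al k))) in *.
    set (z' := rsum d (fun k => be k * Ln (be k))) in *.
    replace ((- (1 / 2 * (x + y) * / ln 2) - - (z * / ln 2) / 2 - - (z' * / ln 2) / 2) * ln 2)
      with (1/2 * (z - x) + 1/2 * (z' - y)) by (field; lra).
    lra.
Qed.

(** At [theta = sqrt 2] each [Q / theta] is at most 1, and [2 ln (sqrt 2) = ln 2] remains. *)
Lemma mutinf_le_1 d a b : density d a -> density d b -> mutinf d a b <= 1.
Proof.
  intros Ha Hb. assert (S2 : 0 < sqrt 2) by (apply sqrt_lt_R0; lra).
  destruct (mutinf_bound (sqrt 2) d a b S2 Ha Hb) as (Qa & Qb & [H1 H2] & _ & H).
  rewrite ln_sqrt in H by lra.
  assert (forall q, q <= sqrt 2 -> q / sqrt 2 <= 1) as Hq.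
  { intros q Hq. apply (Rmult_le_reg_r (sqrt 2)); [assumption|]. unfold Rdiv.
    rewrite Rmult_assoc, Rinv_l by lra. lra. }
  apply Hq in H1, H2. assert (L2 := ln2_pos). nra.
Qed.

(** At [theta = 1] only the two excesses [Q - 1] remain. *)
Lemma mutinf_le_sfid d a b : density d a -> density d b ->
  mutinf d a b * ln 2 <= 2 * sqrt 2 * sqrt (1 - sfid d a b).
Proof.
  intros Ha Hb. destruct (mutinf_bound 1 d a b Rlt_0_1 Ha Hb) as (Qa & Qb & _ & [H1 H2] & H).
  rewrite ln_1 in H. lra.
Qed.

(** * Kronecker products *)

Lemma div_add_small i j m : (j < m)%nat -> ((i * m + j) / m)%nat = i.
Proof. intros H. rewrite Nat.div_add_l, Nat.div_small by lia. lia. Qed.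
Lemma mod_add_small i j m : (j < m)%nat -> ((i * m + j) mod m)%nat = j.
Proof.
  intros H. rewrite Nat.add_comm, Nat.Div0.mod_add, Nat.mod_small by lia. reflexivity.
Qed.
Lemma div_lt_prod i n m : (i < n * m)%nat -> (i / m < n)%nat.
Proof. intros H. apply Nat.Div0.div_lt_upper_bound. lia. Qed.
Lemma mod_lt_prod i n m : (i < n * m)%nat -> (i mod m < m)%nat.
Proof. intros H. apply Nat.mod_upper_bound. nia. Qed.
Lemma eqb_div_mod i j m :
  Nat.eqb i j = andb (Nat.eqb (i / m) (j / m)) (Nat.eqb (i mod m) (j mod m)).
Proof.
  destruct (Nat.eqb_spec i j) as [->|H]; [now rewrite !Nat.eqb_refl|].
  destruct (Nat.eqb_spec (i / m) (j / m)) as [E|]; [|reflexivity].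
  destruct (Nat.eqb_spec (i mod m) (j mod m)) as [E'|]; [|reflexivity].
  exfalso. apply H. rewrite (Nat.div_mod_eq i m), (Nat.div_mod_eq j m), E, E'. reflexivity.
Qed.

Lemma csum_div_mod n m f :
  csum (n * m) (fun k => f (k / m)%nat (k mod m)%nat) = csum n (fun i => csum m (fun j => f i j)).
Proof.
  rewrite csum_prod. apply csum_ext; intros i Hi. apply csum_ext; intros j Hj.
  now rewrite div_add_small, mod_add_small.
Qed.
Lemma rsum_div_mod n m f :
  rsum (n * m) (fun k => f (k / m)%nat (k mod m)%nat) = rsum n (fun i => rsum m (fun j => f i j)).
Proof.
  rewrite rsum_prod. apply rsum_ext; intros i Hi. apply rsum_ext; intros j Hj.
  now rewrite div_add_small, mod_add_small.
Qed.

Lemma csum_mul n m f g : csum n (fun i => csum m (fun j => Cmul (f i) (g j))) = Cmul (csum n f) (csum m g).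
Proof.
  rewrite <- csum_scal_r. apply csum_ext; intros. apply csum_scal_l.
Qed.
Lemma rsum_mul n m f g : rsum n (fun i => rsum m (fun j => f i * g j)) = rsum n f * rsum m g.
Proof. rewrite <- rsum_scal_r. apply rsum_ext; intros. apply rsum_scal. Qed.

Lemma kron_mul da db A B A' B' :
  mmul (da * db) (kron db A B) (kron db A' B') = kron db (mmul da A A') (mmul db B B').
Proof.
  mext. unfold mmul, kron.
  rewrite (csum_div_mod da db (fun k l => Cmul (Cmul (A (i / db)%nat k) (B (i mod db)%nat l))
     (Cmul (A' k (j / db)%nat) (B' l (j mod db)%nat)))).
  rewrite <- csum_mul. apply csum_ext; intros; apply csum_ext; intros; ring.
Qed.

Lemma kron_adj db A B : adj (kron db A B) = kron db (adj A) (adj B).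
Proof. mext. unfold adj, kron. apply Cconj_mul. Qed.

Lemma kron_diagm db l m :
  kron db (diagm l) (diagm m) = diagm (fun k => l (k / db)%nat * m (k mod db)%nat).
Proof.
  mext. unfold kron, diagm. rewrite (eqb_div_mod i j db).
  destruct (Nat.eqb (i / db) (j / db)); destruct (Nat.eqb (i mod db) (j mod db)); simpl;
    apply C_ext; simpl; ring.
Qed.

Lemma kron_mid db : kron db mid mid = mid.
Proof.
  change mid with (diagm (fun _ => 1)). rewrite kron_diagm.
  f_equal. apply functional_extensionality; intros; ring.
Qed.

#[export] Instance kron_meq da db : Proper (meq da ==> meq db ==> meq (da * db)) (kron db).
Proof.
  intros A A' HA B B' HB i j Hi Hj. unfold kron.
  rewrite HA, HB; eauto using div_lt_prod, mod_lt_prod.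
Qed.

Lemma kron_add_l db A A' B : kron db (madd A A') B = madd (kron db A B) (kron db A' B).
Proof. mext. unfold kron, madd. ring. Qed.
Lemma kron_add_r db A B B' : kron db A (madd B B') = madd (kron db A B) (kron db A B').
Proof. mext. unfold kron, madd. ring. Qed.
Lemma kron_scale_l db r A B : kron db (mscale r A) B = mscale r (kron db A B).
Proof. mext. unfold kron, mscale. ring. Qed.
Lemma kron_scale_r db r A B : kron db A (mscale r B) = mscale r (kron db A B).
Proof. mext. unfold kron, mscale. ring. Qed.

Lemma unitary_kron da db U V : unitary da U -> unitary db V -> unitary (da * db) (kron db U V).
Proof.
  intros HU HV. unfold unitary. rewrite kron_adj, kron_mul, (unitary_l _ _ HU), (unitary_l _ _ HV), kron_mid.
  reflexivity.
Qed.

Lemma spectral_decomp_kron da db A U l B V m :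
  spectral_decomp da A U l -> spectral_decomp db B V m ->
  spectral_decomp (da * db) (kron db A B) (kron db U V) (fun k => l (k / db)%nat * m (k mod db)%nat).
Proof.
  intros [HU HA] [HV HB]. split; [now apply unitary_kron|].
  rewrite HA, HB, <- kron_diagm, kron_adj, !kron_mul. reflexivity.
Qed.

Lemma psd_kron da db A B : psd da A -> psd db B -> psd (da * db) (kron db A B).
Proof.
  intros HA HB. rewrite <- (sqrtm_sq da A HA), <- (sqrtm_sq db B HB).
  rewrite <- (sqrtm_adj da A (proj1 HA)) at 1. rewrite <- (sqrtm_adj db B (proj1 HB)) at 1.
  rewrite <- kron_mul, <- kron_adj. apply psd_gram.
Qed.

Lemma trace_kron da db A B : trace (da * db) (kron db A B) = Cmul (trace da A) (trace db B).
Proof.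
  unfold trace, kron. rewrite (csum_div_mod da db (fun k l => Cmul (A k k) (B l l))). apply csum_mul.
Qed.

Lemma density_kron da db A B : density da A -> density db B -> density (da * db) (kron db A B).
Proof.
  intros [HA TA] [HB TB]. split; [now apply psd_kron|].
  rewrite trace_kron, TA, TB. ring.
Qed.

Lemma trace_meq d A B : meq d A B -> trace d A = trace d B.
Proof. intros H. apply csum_ext; intros. now apply H. Qed.

#[export] Instance density_meq d : Proper (meq d ==> iff) (density d).
Proof.
  intros A B H. unfold density. rewrite (trace_meq _ _ _ H). now rewrite H.
Qed.

Lemma xlog2x_mul a b : 0 <= a -> 0 <= b -> xlog2x (a * b) = a * xlog2x b + b * xlog2x a.
Proof.
  intros Ha Hb. unfold xlog2x.
  destruct (Rlt_dec 0 a) as [Pa|Pa].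
  - destruct (Rlt_dec 0 b) as [Pb|Pb].
    + destruct (Rlt_dec 0 (a * b)) as [|Pab]; [|exfalso; apply Pab; now apply Rmult_lt_0_compat].
      rewrite ln_mult by assumption. unfold Rdiv. ring.
    + replace b with 0 by lra. destruct (Rlt_dec 0 (a * 0)); lra.
  - replace a with 0 by lra. destruct (Rlt_dec 0 (0 * b)); lra.
Qed.

Lemma entropy_kron da db A B : density da A -> density db B ->
  entropy (da * db) (kron db A B) = entropy da A + entropy db B.
Proof.
  intros HA HB.
  destruct (psd_spectral _ _ (proj1 HA)) as (U & l & HU & Hl).
  destruct (psd_spectral _ _ (proj1 HB)) as (V & m & HV & Hm).
  rewrite (entropy_eq _ _ _ _ HU), (entropy_eq _ _ _ _ HV), (entropy_eq _ _ _ _ (spectral_decomp_kron _ _ _ _ _ _ _ _ HU HV)).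
  assert (rsum da l = 1) as Sl.
  { rewrite <- (density_rtr _ _ HA), (proj2 HU). symmetry. apply rtr_fcalc, HU. }
  assert (rsum db m = 1) as Sm.
  { rewrite <- (density_rtr _ _ HB), (proj2 HV). symmetry. apply rtr_fcalc, HV. }
  rewrite (rsum_div_mod da db (fun i j => xlog2x (l i * m j))).
  rewrite (rsum_ext da _ (fun i => rsum db (fun j => l i * xlog2x (m j)) + rsum db (fun j => xlog2x (l i) * m j))).
  - rewrite rsum_add, !rsum_mul, Sl, Sm. ring.
  - intros i Hi. rewrite <- rsum_add. apply rsum_ext; intros j Hj. rewrite xlog2x_mul by auto. ring.
Qed.

Lemma herm_diag_real d A U k : (k < d)%nat -> psd d A -> snd (mmul d (adj U) (mmul d A U) k k) = 0.
Proof.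
  intros Hk HA. assert (H := psd_herm _ _ (psd_conj d A U HA) k k Hk Hk).
  apply (f_equal snd) in H. unfold adj at 1 in H. simpl in H. lra.
Qed.

(** The real part is multiplicative here because the diagonal entry of the first factor is real. *)
Lemma diagq_kron da db U V A B k : (k < da * db)%nat -> psd da A -> psd db B ->
  diagq (da * db) (kron db U V) (kron db A B) k = diagq da U A (k / db)%nat * diagq db V B (k mod db)%nat.
Proof.
  intros Hk HA HB. unfold diagq. rewrite kron_adj, !kron_mul. unfold kron, Re. simpl.
  rewrite (herm_diag_real da A U) by eauto using div_lt_prod. ring.
Qed.

(** * Optimal Bhattacharyya coefficient over orthonormal measurements *)

(** The values carry a minus sign because [completeness] yields suprema. *)
Definition BC_values (d : nat) (a b : Mat) (x : R) : Prop := exists U, unitary d U /\ x = - BC d U a b.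

Lemma unitary_mid d : unitary d mid.
Proof. unfold unitary. rewrite adj_mid. apply mmul_1_l. Qed.

Lemma BC_values_bound d a b : bound (BC_values d a b).
Proof. exists 0. intros x (U & _ & ->). generalize (BC_pos d U a b). lra. Qed.
Lemma BC_values_ex d a b : exists x, BC_values d a b x.
Proof. exists (- BC d mid a b), mid. split; [apply unitary_mid|reflexivity]. Qed.

Definition BCinf (d : nat) (a b : Mat) : R :=
  - proj1_sig (completeness (BC_values d a b) (BC_values_bound d a b) (BC_values_ex d a b)).

Lemma BCinf_le d a b U : unitary d U -> BCinf d a b <= BC d U a b.
Proof.
  intros HU. unfold BCinf. destruct (completeness _ _ _) as [m [H1 H2]]; simpl.
  assert (- BC d U a b <= m) by (apply H1; now exists U). lra.
Qed.

Lemma BCinf_glb d a b x : (forall U, unitary d U -> x <= BC d U a b) -> x <= BCinf d a b.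
Proof.
  intros H. unfold BCinf. destruct (completeness _ _ _) as [m [H1 H2]]; simpl.
  assert (m <= - x); [|lra]. apply H2. intros y (U & HU & ->). specialize (H U HU). lra.
Qed.

Lemma BCinf_approx d a b e : 0 < e -> exists U, unitary d U /\ BC d U a b <= BCinf d a b + e.
Proof.
  intros He. destruct (classic (exists U, unitary d U /\ BC d U a b <= BCinf d a b + e)) as [H|H]; [assumption|exfalso].
  assert (BCinf d a b + e <= BCinf d a b); [|lra].
  apply BCinf_glb; intros U HU. destruct (Rle_dec (BC d U a b) (BCinf d a b + e)); [|lra].
  exfalso; apply H; now exists U.
Qed.

Lemma BCinf_pos d a b : 0 <= BCinf d a b.
Proof. apply BCinf_glb; intros; apply BC_pos. Qed.

Lemma BC_le_1 d U a b : unitary d U -> density d a -> density d b -> BC d U a b <= 1.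
Proof.
  intros HU Ha Hb. eapply Rle_trans; [apply BC_le; [assumption|apply Ha|apply Hb]|].
  rewrite !density_rtr by assumption. rewrite sqrt_1. lra.
Qed.

Lemma BCinf_le_1 d a b : density d a -> density d b -> BCinf d a b <= 1.
Proof.
  intros Ha Hb. eapply Rle_trans; [apply BCinf_le, unitary_mid|]. apply BC_le_1; auto using unitary_mid.
Qed.

Lemma BCinf_sfid d a b : density d a -> density d b ->
  (1 - sfid d a b) * (1 - sfid d a b) <= 2 * (1 - BCinf d a b).
Proof.
  intros Ha Hb. destruct (BC_sfid d a b Ha Hb) as (U & HU & H).
  assert (H1 := BCinf_le d a b U HU). assert (H2 := BCinf_pos d a b).
  assert (H3 := BC_le_1 d U a b HU Ha Hb). nra.
Qed.

Definition mutinf_const (e : R) : R := 128 / (ln 2 * ln 2 * (ln 2 * ln 2)) / (e * e * (e * e)).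

(* [(I ln 2)^4 <= 64 (1 - sfid)^2 <= 128 (1 - BCinf)], and [I <= (I/e)^4] once [e < I <= 1]. *)
Lemma mutinf_le_BCinf d a b e : 0 < e -> density d a -> density d b ->
  mutinf d a b <= e + mutinf_const e * (1 - BCinf d a b).
Proof.
  intros He Ha Hb.
  assert (HY := BCinf_le_1 d a b Ha Hb). assert (HI := mutinf_le_1 d a b Ha Hb).
  assert (HS := mutinf_le_sfid d a b Ha Hb). assert (HF := BCinf_sfid d a b Ha Hb).
  assert (HT := sfid_le_1 d a b Ha Hb).
  set (I := mutinf d a b) in *. set (Y := BCinf d a b) in *. set (u := 1 - sfid d a b) in *.
  assert (L2 := ln2_pos). set (L := ln 2) in *.
  assert (0 < L * L * (L * L)) by (repeat apply Rmult_lt_0_compat; assumption).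
  assert (0 < e * e * (e * e)) by (repeat apply Rmult_lt_0_compat; assumption).
  assert (0 <= mutinf_const e * (1 - Y)).
  { apply Rmult_le_pos; [|lra]. unfold mutinf_const. fold L.
    unfold Rdiv. repeat apply Rmult_le_pos; try lra; left; apply Rinv_0_lt_compat; assumption. }
  destruct (Rle_dec I e) as [|Hn]; [lra|].
  assert (Hu : 0 <= u) by (unfold u; lra).
  assert (E1 := sqrt_sqrt 2 ltac:(lra)). assert (E2 := sqrt_sqrt u Hu).
  assert (0 <= I * L) by nra.
  assert (I * L * (I * L) <= 8 * u) as E3.
  { eapply Rle_trans; [apply Rmult_le_compat; try eassumption|].
    replace (2 * sqrt 2 * sqrt u * (2 * sqrt 2 * sqrt u)) with (4 * (sqrt 2 * sqrt 2) * (sqrt u * sqrt u)) by ring.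
    rewrite E1, E2. lra. }
  assert (I * L * (I * L) * (I * L * (I * L)) <= 128 * (1 - Y)) as E4.
  { assert (0 <= I * L * (I * L)) by nra.
    eapply Rle_trans; [apply Rmult_le_compat; try eassumption|]. nra. }
  assert (I <= mutinf_const e * (1 - Y)); [|lra].
  apply (Rmult_le_reg_r (L * L * (L * L) * (e * e * (e * e)))); [nra|].
  unfold mutinf_const. fold L.
  replace (128 / (L * L * (L * L)) / (e * e * (e * e)) * (1 - Y) * (L * L * (L * L) * (e * e * (e * e))))
    with (128 * (1 - Y)) by (field; split; lra).
  eapply Rle_trans; [|apply E4].
  replace (I * L * (I * L) * (I * L * (I * L))) with ((I * I * (I * I)) * (L * L * (L * L))) by ring.
  rewrite (Rmult_comm (L * L * (L * L)) (e * e * (e * e))), <- Rmult_assoc.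
  apply Rmult_le_compat_r; [lra|].
  assert (e * e <= I * I) by nra. assert (0 <= e * e) by nra.
  assert (e * e * (e * e) <= I * I * (I * I)) by (apply Rmult_le_compat; assumption).
  nra.
Qed.

(** The two combined halves know different prefixes, one from [u_o (+) u_e] and one from [u_e];
    hence two pairs [P] and [Q] rather than one. *)
Definition minus_state (D : nat) (P Q : bool -> Mat) (v : bool) : Mat :=
  avg2 (kron D (P v) (Q false)) (kron D (P (negb v)) (Q true)).
Definition plus_state (D : nat) (P Q : bool -> Mat) (v w : bool) : Mat :=
  kron D (P (xorb v w)) (Q w).

Definition pair_density (D : nat) (P : bool -> Mat) : Prop := forall b, density D (P b).

(* With [s = sqrt (p0 p1)], [t = sqrt (q0 q1)], the square of the right side exceeds that of the left side by
   [2 s t (q0 + q1 - 2 t) (p0 + p1 - 2 s)]. *)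
Lemma sqrt_minus_ineq p0 p1 q0 q1 : 0 <= p0 -> 0 <= p1 -> 0 <= q0 -> 0 <= q1 ->
  sqrt ((p0 * q0 + p1 * q1) * (p1 * q0 + p0 * q1)) <=
  sqrt (p0 * p1) * (q0 + q1) + (p0 + p1) * sqrt (q0 * q1) - 2 * (sqrt (p0 * p1) * sqrt (q0 * q1)).
Proof.
  intros H1 H2 H3 H4. rewrite !sqrt_mult by nra.
  rewrite <- sqrt_mult by nra.
  set (a := sqrt p0). set (b := sqrt p1). set (c := sqrt q0). set (e := sqrt q1).
  assert (Ea : p0 = a * a) by (unfold a; now rewrite sqrt_sqrt).
  assert (Eb : p1 = b * b) by (unfold b; now rewrite sqrt_sqrt).
  assert (Ec : q0 = c * c) by (unfold c; now rewrite sqrt_sqrt).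
  assert (Ee : q1 = e * e) by (unfold e; now rewrite sqrt_sqrt).
  assert (0 <= a) by apply sqrt_pos. assert (0 <= b) by apply sqrt_pos.
  assert (0 <= c) by apply sqrt_pos. assert (0 <= e) by apply sqrt_pos.
  rewrite Ea, Eb, Ec, Ee. clearbody a b c e.
  assert (0 <= a * b) by nra. assert (0 <= c * e) by nra.
  assert (Hs : 0 <= (a - b) * (a - b)) by apply Rle_0_sqr.
  assert (Ht : 0 <= (c - e) * (c - e)) by apply Rle_0_sqr.
  set (rhs := a * b * (c * c + e * e) + (a * a + b * b) * (c * e) - 2 * (a * b * (c * e))).
  assert (Hr : 0 <= rhs).
  { replace rhs with (a * b * (c * c + e * e) + (a - b) * (a - b) * (c * e)) by (unfold rhs; ring). nra. }
  rewrite <- (sqrt_square rhs) by assumption. apply sqrt_le_1_alt.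
  assert (0 <= 2 * (a * b) * (c * e) * ((a - b) * (a - b)) * ((c - e) * (c - e))).
  { apply Rmult_le_pos; [apply Rmult_le_pos; [|exact Hs]|exact Ht]. apply Rmult_le_pos; lra. }
  assert (rhs * rhs - (a * a * (c * c) + b * b * (e * e)) * (b * b * (c * c) + a * a * (e * e))
    = 2 * (a * b) * (c * e) * ((a - b) * (a - b)) * ((c - e) * (c - e))) by (unfold rhs; ring).
  lra.
Qed.

(** Measured in a product basis, the minus pair is the classical minus transform of the two outcome
    laws. [sqrt_minus_ineq] bounds each outcome, and the sum over the product factors because all
    four laws are normalized. *)
Lemma BC_minus D U V P Q : pair_density D P -> pair_density D Q -> unitary D U -> unitary D V ->
  let x := BC D U (P false) (P true) in let y := BC D V (Q false) (Q true) in
  BC (D * D) (kron D U V) (minus_state D P Q false) (minus_state D P Q true) <= x + y - x * y.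
Proof.
  intros HP HQ HU HV x y.
  set (p := fun b k => diagq D U (P b) k). set (q := fun b k => diagq D V (Q b) k).
  assert (Pp : forall b k, 0 <= p b k) by (intros; apply diagq_pos, HP).
  assert (Pq : forall b k, 0 <= q b k) by (intros; apply diagq_pos, HQ).
  assert (Sp : forall b, rsum D (p b) = 1) by (intros; unfold p; rewrite diagq_sum by assumption; now apply density_rtr).
  assert (Sq : forall b, rsum D (q b) = 1) by (intros; unfold q; rewrite diagq_sum by assumption; now apply density_rtr).
  assert (E : forall v k, (k < D * D)%nat -> diagq (D * D) (kron D U V) (minus_state D P Q v) k =
     1/2 * (p v (k / D)%nat * q false (k mod D)%nat + p (negb v) (k / D)%nat * q true (k mod D)%nat)).
  { intros v k Hk. unfold minus_state, avg2. rewrite diagq_scale, diagq_add, !diagq_kron; auto; try apply HP; apply HQ. }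
  unfold BC at 1.
  rewrite (rsum_ext (D * D) _ (fun k => (fun i j => 1/2 * sqrt ((p false i * q false j + p true i * q true j) *
     (p true i * q false j + p false i * q true j))) (k / D)%nat (k mod D)%nat)).
  2:{ intros k Hk. rewrite !E by assumption. cbv beta. simpl negb.
      match goal with |- sqrt (1/2 * ?X * (1/2 * ?Y)) = _ =>
        replace (1/2 * X * (1/2 * Y)) with ((1/2 * (1/2)) * (X * Y)) by ring end.
      rewrite sqrt_mult_alt by lra. rewrite sqrt_square by lra. reflexivity. }
  rewrite (rsum_div_mod D D (fun i j => 1/2 * sqrt ((p false i * q false j + p true i * q true j) *
     (p true i * q false j + p false i * q true j)))).
  set (s := fun i => sqrt (p false i * p true i)). set (t := fun j => sqrt (q false j * q true j)).
  apply Rle_trans with (rsum D (fun i => rsum D (fun j =>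
     1/2 * (s i * q false j + s i * q true j + p false i * t j + p true i * t j - 2 * (s i * t j))))).
  - apply rsum_le; intros i Hi; apply rsum_le; intros j Hj.
    assert (B := sqrt_minus_ineq (p false i) (p true i) (q false j) (q true j) (Pp _ _) (Pp _ _) (Pq _ _) (Pq _ _)).
    fold (s i) in B. fold (t j) in B. lra.
  - apply Req_le.
    rewrite (rsum_ext D _ (fun i => 1/2 * (s i * rsum D (q false) + s i * rsum D (q true) +
       p false i * rsum D t + p true i * rsum D t - 2 * (s i * rsum D t)))).
    + rewrite rsum_scal, rsum_sub, !rsum_add, rsum_scal, !rsum_scal_r, !Sp, !Sq.
      change (rsum D s) with x. change (rsum D t) with y. lra.
    + intros i Hi. rewrite rsum_scal, rsum_sub, !rsum_add, rsum_scal, !rsum_scal. reflexivity.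
Qed.

(** For either [v], the two values of [w] together use both inputs of [P] and both inputs of [Q], so
    the root splits. *)
Lemma BC_plus D U V P Q v : pair_density D P -> pair_density D Q -> unitary D U -> unitary D V ->
  BC (D * D) (kron D U V) (plus_state D P Q v false) (plus_state D P Q v true)
  = BC D U (P false) (P true) * BC D V (Q false) (Q true).
Proof.
  intros HP HQ HU HV.
  set (p := fun b k => diagq D U (P b) k). set (q := fun b k => diagq D V (Q b) k).
  assert (Pp : forall b k, 0 <= p b k) by (intros; apply diagq_pos, HP).
  assert (Pq : forall b k, 0 <= q b k) by (intros; apply diagq_pos, HQ).
  unfold BC.
  rewrite (rsum_ext (D * D) _ (fun k => (fun i j => sqrt (p false i * p true i) * sqrt (q false j * q true j)) (k / D)%nat (k mod D)%nat)).
  - rewrite (rsum_div_mod D D (fun i j => sqrt (p false i * p true i) * sqrt (q false j * q true j))).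
    apply rsum_mul.
  - intros k Hk. unfold plus_state. rewrite !diagq_kron by (assumption || apply HP || apply HQ).
    fold (p (xorb v false) (k / D)%nat). fold (p (xorb v true) (k / D)%nat).
    fold (q false (k mod D)%nat). fold (q true (k mod D)%nat).
    rewrite <- sqrt_mult by (apply Rmult_le_pos; auto). f_equal. destruct v; simpl; ring.
Qed.

Lemma BCinf_minus D P Q : pair_density D P -> pair_density D Q ->
  let x := BCinf D (P false) (P true) in let y := BCinf D (Q false) (Q true) in
  BCinf (D * D) (minus_state D P Q false) (minus_state D P Q true) <= x + y - x * y.
Proof.
  intros HP HQ x y. apply le_epsilon. intros e He.
  destruct (BCinf_approx D (P false) (P true) (e / 2)) as (U & HU & HUx); [lra|].
  destruct (BCinf_approx D (Q false) (Q true) (e / 2)) as (V & HV & HVy); [lra|].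
  eapply Rle_trans; [apply BCinf_le, (unitary_kron D D U V HU HV)|].
  eapply Rle_trans; [apply BC_minus; assumption|].
  assert (B1 := BC_pos D V (Q false) (Q true)).
  assert (B2 := BC_le_1 D V (Q false) (Q true) HV (HQ _) (HQ _)).
  assert (B3 := BCinf_pos D (P false) (P true)). assert (B4 := BCinf_le_1 D (P false) (P true) (HP _) (HP _)).
  assert (B5 := BCinf_le D (P false) (P true) U HU). assert (B6 := BCinf_le D (Q false) (Q true) V HV).
  fold x in HUx, B3, B4, B5. fold y in HVy, B6.
  set (x' := BC D U (P false) (P true)) in *. set (y' := BC D V (Q false) (Q true)) in *.
  (* [x + y - x y] changes by [(x' - x) (1 - y') + (y' - y) (1 - x)]. *)
  assert ((x' - x) * (1 - y') <= e / 2) by nra.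
  assert ((y' - y) * (1 - x) <= e / 2) by nra. lra.
Qed.

Lemma BCinf_plus D P Q v : pair_density D P -> pair_density D Q ->
  BCinf (D * D) (plus_state D P Q v false) (plus_state D P Q v true)
  <= BCinf D (P false) (P true) * BCinf D (Q false) (Q true).
Proof.
  intros HP HQ. apply le_epsilon. intros e He.
  destruct (BCinf_approx D (P false) (P true) (e / 2)) as (U & HU & HUx); [lra|].
  destruct (BCinf_approx D (Q false) (Q true) (e / 2)) as (V & HV & HVy); [lra|].
  eapply Rle_trans; [apply BCinf_le, (unitary_kron D D U V HU HV)|].
  rewrite BC_plus by assumption.
  assert (B1 := BC_pos D V (Q false) (Q true)).
  assert (B2 := BC_le_1 D V (Q false) (Q true) HV (HQ _) (HQ _)).
  assert (B3 := BCinf_pos D (P false) (P true)). assert (B4 := BCinf_le_1 D (P false) (P true) (HP _) (HP _)).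
  assert (B5 := BCinf_le D (P false) (P true) U HU). assert (B6 := BCinf_le D (Q false) (Q true) V HV).
  set (x := BCinf D (P false) (P true)) in *. set (y := BCinf D (Q false) (Q true)) in *.
  set (x' := BC D U (P false) (P true)) in *. set (y' := BC D V (Q false) (Q true)) in *.
  assert ((x' - x) * y' <= e / 2) by nra.
  assert ((y' - y) * x <= e / 2) by nra. lra.
Qed.

Lemma avg2_minus D P Q :
  avg2 (minus_state D P Q false) (minus_state D P Q true)
  = kron D (avg2 (P false) (P true)) (avg2 (Q false) (Q true)).
Proof.
  unfold minus_state, avg2.
  rewrite !kron_scale_l, !kron_scale_r, !kron_add_l, !kron_add_r. simpl negb.
  mext. unfold mscale, madd. apply C_ext; simpl; ring.
Qed.

Lemma avg2_plus D P Q v : avg2 (plus_state D P Q v false) (plus_state D P Q v true) = minus_state D P Q v.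
Proof. unfold plus_state, minus_state. destruct v; reflexivity. Qed.

(** Averaging a plus pair over its input returns a minus state, whose entropy cancels between the
    two channels. What remains are entropies of product states. *)
Lemma mutinf_chain D P Q : pair_density D P -> pair_density D Q ->
  mutinf (D * D) (minus_state D P Q false) (minus_state D P Q true)
  + 1/2 * (mutinf (D * D) (plus_state D P Q false false) (plus_state D P Q false true)
         + mutinf (D * D) (plus_state D P Q true false) (plus_state D P Q true true))
  = mutinf D (P false) (P true) + mutinf D (Q false) (Q true).
Proof.
  intros HP HQ. unfold mutinf.
  fold (avg2 (minus_state D P Q false) (minus_state D P Q true)). rewrite avg2_minus.
  fold (avg2 (plus_state D P Q false false) (plus_state D P Q false true)).
  fold (avg2 (plus_state D P Q true false) (plus_state D P Q true true)). rewrite !avg2_plus.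
  fold (avg2 (P false) (P true)) (avg2 (Q false) (Q true)).
  unfold plus_state. simpl xorb.
  rewrite !entropy_kron by (auto using avg2_density). lra.
Qed.

(** * Averages over bit strings *)

Lemma ext_fold_app {T} (add : T -> T -> T) m k s u F :
  ext_fold add (m + k) s u F = ext_fold add m s u (fun u' => ext_fold add k (s + m) u' F).
Proof.
  revert s u. induction m as [|m IH]; intros s u; simpl.
  - now rewrite Nat.add_0_r.
  - rewrite !IH. now rewrite !Nat.add_succ_r.
Qed.

Lemma ext_fold_last {T} (add : T -> T -> T) m s u F :
  ext_fold add (S m) s u F =
  ext_fold add m s u (fun u' => add (F (upd u' (s + m) false)) (F (upd u' (s + m) true))).
Proof. replace (S m) with (m + 1)%nat by lia. rewrite ext_fold_app. reflexivity. Qed.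

Lemma ext_fold_ext {T} (add : T -> T -> T) m s u F G :
  (forall v, F v = G v) -> ext_fold add m s u F = ext_fold add m s u G.
Proof. intros H. replace G with F by (now apply functional_extensionality). reflexivity. Qed.

Lemma ef_add m s u F G :
  ext_fold Rplus m s u (fun v => F v + G v) = ext_fold Rplus m s u F + ext_fold Rplus m s u G.
Proof. revert s u. induction m as [|m IH]; intros; simpl; [ring|]. rewrite !IH. ring. Qed.
Lemma ef_scal m s u c F :
  ext_fold Rplus m s u (fun v => c * F v) = c * ext_fold Rplus m s u F.
Proof. revert s u. induction m as [|m IH]; intros; simpl; [ring|]. rewrite !IH. ring. Qed.
Lemma ef_const m s u c : ext_fold Rplus m s u (fun _ => c) = 2 ^ m * c.
Proof. revert s u. induction m as [|m IH]; intros; simpl; [ring|]. rewrite !IH. ring. Qed.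
Lemma ef_le m s u F G :
  (forall v, F v <= G v) -> ext_fold Rplus m s u F <= ext_fold Rplus m s u G.
Proof.
  intros H. revert s u. induction m as [|m IH]; intros; simpl; [apply H|].
  apply Rplus_le_compat; apply IH.
Qed.
Lemma ef_rsum m s u N F :
  ext_fold Rplus m s u (fun v => rsum N (fun k => F k v)) = rsum N (fun k => ext_fold Rplus m s u (F k)).
Proof.
  induction N as [|N IH]; simpl.
  - rewrite ef_const; ring.
  - rewrite ef_add, IH. reflexivity.
Qed.

(* [comb_odd u = u_o (+) u_e] and [comb_even u = u_e] in the channel combining recursion. *)
Definition comb_odd (u : nat -> bool) : nat -> bool := fun k => xorb (u (2 * k)%nat) (u (2 * k + 1)%nat).
Definition comb_even (u : nat -> bool) : nat -> bool := fun k => u (2 * k + 1)%nat.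

Lemma comb_odd_upd u q v w :
  comb_odd (upd (upd u (2 * q) v) (S (2 * q)) w) = upd (comb_odd u) q (xorb v w).
Proof.
  apply functional_extensionality; intros k. unfold comb_odd, upd.
  destruct (Nat.eqb_spec k q) as [->|H].
  - rewrite (Nat.add_1_r (2 * q)), !Nat.eqb_refl.
    destruct (Nat.eqb_spec (2 * q) (S (2 * q))); [lia|reflexivity].
  - destruct (Nat.eqb_spec (2 * k) (S (2 * q))); [lia|].
    destruct (Nat.eqb_spec (2 * k) (2 * q)); [lia|].
    destruct (Nat.eqb_spec (2 * k + 1) (S (2 * q))); [lia|].
    destruct (Nat.eqb_spec (2 * k + 1) (2 * q)); [lia|reflexivity].
Qed.

Lemma comb_even_upd u q v w :
  comb_even (upd (upd u (2 * q) v) (S (2 * q)) w) = upd (comb_even u) q w.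
Proof.
  apply functional_extensionality; intros k. unfold comb_even, upd.
  destruct (Nat.eqb_spec k q) as [->|H].
  - now rewrite (Nat.add_1_r (2 * q)), Nat.eqb_refl.
  - destruct (Nat.eqb_spec (2 * k + 1) (S (2 * q))); [lia|].
    destruct (Nat.eqb_spec (2 * k + 1) (2 * q)); [lia|reflexivity].
Qed.

(** [(v, w) -> (xorb v w, w)] permutes the four values of two consecutive bits, so a string of
    length [2 m] amounts to an independent pair of strings of length [m]. *)
Lemma ef_split m s u (G : (nat -> bool) -> (nat -> bool) -> R) :
  ext_fold Rplus (2 * m) (2 * s) u (fun v => G (comb_odd v) (comb_even v)) =
  ext_fold Rplus m s (comb_odd u) (fun a => ext_fold Rplus m s (comb_even u) (fun b => G a b)).
Proof.
  revert s u. induction m as [|m IH]; intros s u; [reflexivity|].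
  replace (2 * S m)%nat with (S (S (2 * m))) by lia. cbn [ext_fold].
  replace (S (S (2 * s))) with (2 * S s)%nat by lia.
  rewrite !IH, !comb_odd_upd, !comb_even_upd. simpl xorb.
  rewrite !ef_add. ring.
Qed.

Definition zeros : nat -> bool := fun _ => false.
Definition bavg (p : nat) (F : (nat -> bool) -> R) : R := / 2 ^ p * ext_fold Rplus p 0 zeros F.

Lemma pow2_pos p : 0 < 2 ^ p.
Proof. apply pow_lt; lra. Qed.

Lemma bavg_ext p F G : (forall u, F u = G u) -> bavg p F = bavg p G.
Proof. intros H. unfold bavg. now rewrite (ext_fold_ext _ _ _ _ _ _ H). Qed.
Lemma bavg_add p F G : bavg p (fun u => F u + G u) = bavg p F + bavg p G.
Proof. unfold bavg. rewrite ef_add. ring. Qed.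
Lemma bavg_scal p c F : bavg p (fun u => c * F u) = c * bavg p F.
Proof. unfold bavg. rewrite ef_scal. ring. Qed.
Lemma bavg_const p c : bavg p (fun _ => c) = c.
Proof. unfold bavg. rewrite ef_const. generalize (pow2_pos p). intros. field. lra. Qed.
Lemma bavg_le p F G : (forall u, F u <= G u) -> bavg p F <= bavg p G.
Proof.
  intros H. apply Rmult_le_compat_l; [|now apply ef_le].
  left. apply Rinv_0_lt_compat, pow2_pos.
Qed.
Lemma bavg_last p F : bavg (S p) F = bavg p (fun u => 1/2 * (F (upd u p false) + F (upd u p true))).
Proof.
  unfold bavg. rewrite ext_fold_last, ef_scal. simpl. field. generalize (pow2_pos p); lra.
Qed.
Lemma bavg_split p (G : (nat -> bool) -> (nat -> bool) -> R) :
  bavg (2 * p) (fun u => G (comb_odd u) (comb_even u)) = bavg p (fun a => bavg p (fun b => G a b)).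
Proof.
  unfold bavg. assert (E := ef_split p 0 zeros G). change (2 * 0)%nat with 0%nat in E. rewrite E.
  change (comb_odd zeros) with zeros. change (comb_even zeros) with zeros.
  rewrite ef_scal. replace (2 * p)%nat with (p + p)%nat by lia. rewrite pow_add, Rinv_mult. ring.
Qed.

(** * The recursive structure of the split channels *)

Lemma dimN_S d n : dimN d (S n) = (dimN d n * dimN d n)%nat.
Proof. unfold dimN. rewrite <- Nat.pow_add_r. f_equal. simpl. lia. Qed.

Section Tree.
Variables (rho : bool -> Mat) (d : nat).
Hypothesis Hrho : forall b, density d (rho b).

Lemma rhobar_step n q u : (q < 2 ^ n)%nat ->
  rhobar rho d n q u = avg2 (rhobar rho d n (S q) (upd u q false)) (rhobar rho d n (S q) (upd u q true)).
Proof.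
  intros Hq. unfold rhobar. replace (2 ^ n - q)%nat with (S (2 ^ n - S q)) by lia.
  cbn [ext_fold]. rewrite <- tech_pow_Rmult.
  mext. unfold avg2, mscale, madd. rewrite Rinv_mult. apply C_ext; simpl; field;
    generalize (pow2_pos (2 ^ n - S q)); lra.
Qed.

Lemma rhobar_full n u : rhobar rho d n (2 ^ n) u = rho_comb rho d n u.
Proof.
  unfold rhobar. rewrite Nat.sub_diag. mext. unfold mscale. apply C_ext; simpl; field.
Qed.

(** Downward induction on the prefix length, starting from the definition of channel combining at
    full length. A step averages over two bits on the left and over one bit of each factor on the
    right; the same permutation of bit pairs matches them. *)
Lemma rhobar_split n q u : (q <= 2 ^ n)%nat ->
  rhobar rho d (S n) (2 * q) u =
  kron (dimN d n) (rhobar rho d n q (comb_odd u)) (rhobar rho d n q (comb_even u)).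
Proof.
  intros Hq. remember (2 ^ n - q)%nat as k eqn:Ek. revert q u Hq Ek.
  induction k as [|k IH]; intros q u Hq Ek.
  - replace q with (2 ^ n)%nat by lia. change (2 * 2 ^ n)%nat with (2 ^ S n)%nat.
    rewrite !rhobar_full. reflexivity.
  - assert (2 ^ S n = 2 * 2 ^ n)%nat by reflexivity.
    rewrite (rhobar_step (S n) (2 * q)) by lia.
    rewrite !(rhobar_step (S n) (S (2 * q))) by lia.
    replace (S (S (2 * q))) with (2 * S q)%nat by lia.
    rewrite !IH by lia. rewrite !comb_odd_upd, !comb_even_upd. simpl xorb.
    rewrite (rhobar_step n q (comb_odd u)), (rhobar_step n q (comb_even u)) by lia.
    unfold avg2. rewrite !kron_scale_l, !kron_scale_r, !kron_add_l, !kron_add_r.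
    mext. unfold mscale, madd. apply C_ext; simpl; ring.
Qed.

Lemma rho_comb_density n u : density (dimN d n) (rho_comb rho d n u).
Proof.
  revert u. induction n as [|n IH]; intros u.
  - unfold dimN. simpl. rewrite Nat.mul_1_r. apply Hrho.
  - rewrite dimN_S. cbn [rho_comb]. apply density_kron; apply IH.
Qed.

Lemma rhobar_density n i u : (i <= 2 ^ n)%nat -> density (dimN d n) (rhobar rho d n i u).
Proof.
  intros Hi. remember (2 ^ n - i)%nat as k eqn:Ek. revert i u Hi Ek.
  induction k as [|k IH]; intros i u Hi Ek.
  - replace i with (2 ^ n)%nat by lia. rewrite rhobar_full. apply rho_comb_density.
  - rewrite rhobar_step by lia. apply avg2_density; apply IH; lia.
Qed.

Definition node_pair (n q : nat) (u : nat -> bool) (b : bool) : Mat := rhobar rho d n (S q) (upd u q b).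

Lemma node_pair_density n q u : (q < 2 ^ n)%nat -> pair_density (dimN d n) (node_pair n q u).
Proof. intros Hq b. apply rhobar_density. lia. Qed.

(** Indices are 0-based: node [q] has the minus child [2 q] and the plus child [2 q + 1]. *)
Lemma node_pair_minus n q u v : (q < 2 ^ n)%nat ->
  node_pair (S n) (2 * q) u v =
  minus_state (dimN d n) (node_pair n q (comb_odd u)) (node_pair n q (comb_even u)) v.
Proof.
  intros Hq. assert (2 ^ S n = 2 * 2 ^ n)%nat by reflexivity.
  unfold node_pair at 1. rewrite rhobar_step by lia.
  replace (S (S (2 * q))) with (2 * S q)%nat by lia. rewrite !rhobar_split by lia.
  rewrite !comb_odd_upd, !comb_even_upd. now destruct v.
Qed.

Lemma node_pair_plus n q u v w : (q < 2 ^ n)%nat ->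
  node_pair (S n) (S (2 * q)) (upd u (2 * q) v) w =
  plus_state (dimN d n) (node_pair n q (comb_odd u)) (node_pair n q (comb_even u)) v w.
Proof.
  intros Hq. assert (2 ^ S n = 2 * 2 ^ n)%nat by reflexivity.
  unfold node_pair at 1.
  replace (S (S (2 * q))) with (2 * S q)%nat by lia. rewrite !rhobar_split by lia.
  rewrite !comb_odd_upd, !comb_even_upd. reflexivity.
Qed.

Definition node_avg (Phi : nat -> Mat -> Mat -> R) (n q : nat) : R :=
  bavg q (fun u => Phi (dimN d n) (node_pair n q u false) (node_pair n q u true)).

Lemma node_avg_minus Phi n q : (q < 2 ^ n)%nat ->
  node_avg Phi (S n) (2 * q) = bavg q (fun a => bavg q (fun b =>
    let D := dimN d n in let P := node_pair n q a in let Q := node_pair n q b in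
    Phi (D * D)%nat (minus_state D P Q false) (minus_state D P Q true))).
Proof.
  intros Hq. unfold node_avg. rewrite dimN_S.
  rewrite <- bavg_split. apply bavg_ext; intros u. now rewrite !node_pair_minus.
Qed.

Lemma node_avg_plus Phi n q : (q < 2 ^ n)%nat ->
  node_avg Phi (S n) (S (2 * q)) = bavg q (fun a => bavg q (fun b =>
    let D := dimN d n in let P := node_pair n q a in let Q := node_pair n q b in
    1/2 * (Phi (D * D)%nat (plus_state D P Q false false) (plus_state D P Q false true)
         + Phi (D * D)%nat (plus_state D P Q true false) (plus_state D P Q true true)))).
Proof.
  intros Hq. unfold node_avg. rewrite dimN_S, bavg_last.
  rewrite <- bavg_split. apply bavg_ext; intros u. now rewrite !node_pair_plus.
Qed.

Lemma node_mutinf_chain n q : (q < 2 ^ n)%nat ->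
  node_avg mutinf (S n) (2 * q) + node_avg mutinf (S n) (S (2 * q)) = 2 * node_avg mutinf n q.
Proof.
  intros Hq. rewrite node_avg_minus, node_avg_plus by assumption. cbv zeta.
  rewrite <- bavg_add.
  rewrite (bavg_ext q _ (fun a => mutinf (dimN d n) (node_pair n q a false) (node_pair n q a true) + node_avg mutinf n q)).
  - rewrite bavg_add, bavg_const. unfold node_avg. ring.
  - intros a. rewrite <- bavg_add.
    rewrite (bavg_ext q _ (fun b => mutinf (dimN d n) (node_pair n q a false) (node_pair n q a true)
       + mutinf (dimN d n) (node_pair n q b false) (node_pair n q b true))).
    + rewrite bavg_add, bavg_const. reflexivity.
    + intros b. apply mutinf_chain; now apply node_pair_density.
Qed.

(** The prefixes of the two halves are independent under the average, so averaging [x + y - x y]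
    gives the same polynomial in the means. *)
Lemma node_BCinf_minus n q : (q < 2 ^ n)%nat ->
  node_avg BCinf (S n) (2 * q) <= 2 * node_avg BCinf n q - node_avg BCinf n q * node_avg BCinf n q.
Proof.
  intros Hq. rewrite node_avg_minus by assumption. cbv zeta.
  set (f := fun u => BCinf (dimN d n) (node_pair n q u false) (node_pair n q u true)).
  change (node_avg BCinf n q) with (bavg q f).
  apply Rle_trans with (bavg q (fun a => bavg q (fun b => f a + (1 + - f a) * f b))).
  - apply bavg_le; intros a; apply bavg_le; intros b.
    eapply Rle_trans; [apply BCinf_minus; now apply node_pair_density|]. unfold f. apply Req_le. ring.
  - rewrite (bavg_ext q _ (fun a => (1 - bavg q f) * f a + bavg q f)).
    + rewrite bavg_add, bavg_scal, bavg_const. apply Req_le. ring.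
    + intros a. rewrite bavg_add, bavg_scal, bavg_const. ring.
Qed.

Lemma node_BCinf_plus n q : (q < 2 ^ n)%nat ->
  node_avg BCinf (S n) (S (2 * q)) <= node_avg BCinf n q * node_avg BCinf n q.
Proof.
  intros Hq. rewrite node_avg_plus by assumption. cbv zeta.
  set (f := fun u => BCinf (dimN d n) (node_pair n q u false) (node_pair n q u true)).
  change (node_avg BCinf n q) with (bavg q f).
  apply Rle_trans with (bavg q (fun a => bavg q (fun b => f a * f b))).
  - apply bavg_le; intros a; apply bavg_le; intros b.
    assert (Ha := node_pair_density n q a Hq). assert (Hb := node_pair_density n q b Hq).
    assert (H1 := BCinf_plus _ _ _ false Ha Hb). assert (H2 := BCinf_plus _ _ _ true Ha Hb).
    fold (f a) (f b) in H1, H2. lra.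
  - rewrite (bavg_ext q _ (fun a => bavg q f * f a)).
    + rewrite bavg_scal. apply Req_le. ring.
    + intros a. rewrite bavg_scal. ring.
Qed.

Lemma node_BCinf_bounds n q : (q < 2 ^ n)%nat -> 0 <= node_avg BCinf n q <= 1.
Proof.
  intros Hq. unfold node_avg. split.
  - rewrite <- (bavg_const q 0). apply bavg_le; intros; apply BCinf_pos.
  - rewrite <- (bavg_const q 1). apply bavg_le; intros; apply BCinf_le_1; now apply node_pair_density.
Qed.

Lemma node_mutinf_le_1 n q : (q < 2 ^ n)%nat -> node_avg mutinf n q <= 1.
Proof.
  intros Hq. rewrite <- (bavg_const q 1). apply bavg_le; intros; apply mutinf_le_1; now apply node_pair_density.
Qed.

Lemma node_mutinf_le_BCinf n q e : (q < 2 ^ n)%nat -> 0 < e ->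
  node_avg mutinf n q <= e + mutinf_const e * (1 - node_avg BCinf n q).
Proof.
  intros Hq He.
  apply Rle_trans with (bavg q (fun u => (e + mutinf_const e) +
     - mutinf_const e * BCinf (dimN d n) (node_pair n q u false) (node_pair n q u true))).
  - apply bavg_le; intros u.
    eapply Rle_trans; [apply (mutinf_le_BCinf _ _ _ e He); now apply node_pair_density|].
    apply Req_le; ring.
  - rewrite bavg_add, bavg_const, bavg_scal. apply Req_le. unfold node_avg. ring.
Qed.

Lemma node_mutinf_root : node_avg mutinf 0 0 = mutinf d (rho false) (rho true).
Proof.
  unfold node_avg, bavg, node_pair. simpl ext_fold. simpl pow. rewrite Rinv_1, Rmult_1_l.
  change 1%nat with (2 ^ 0)%nat. rewrite !rhobar_full. simpl.
  unfold dimN. simpl. now rewrite Nat.mul_1_r.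
Qed.
End Tree.

(** * The classical register: block-diagonal states *)

(** Direct sum of blocks of size [D]; the block number is the content of the classical register. *)
Definition blockdiag (D : nat) (X : nat -> Mat) : Mat :=
  fun i j => if Nat.eqb (i / D) (j / D) then X (i / D)%nat (i mod D)%nat (j mod D)%nat else C0.

Lemma blockdiag_mul m D X Y :
  meq (m * D) (mmul (m * D) (blockdiag D X) (blockdiag D Y)) (blockdiag D (fun c => mmul D (X c) (Y c))).
Proof.
  intros i j Hi Hj. unfold mmul, blockdiag.
  rewrite (csum_div_mod m D (fun k l => Cmul (if Nat.eqb (i / D) k then X (i / D)%nat (i mod D)%nat l else C0)
    (if Nat.eqb k (j / D) then Y k l (j mod D)%nat else C0))).
  rewrite (csum_ext m _ (fun k => if Nat.eqb (i / D) k then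
     (if Nat.eqb k (j / D) then csum D (fun l => Cmul (X (i / D)%nat (i mod D)%nat l) (Y k l (j mod D)%nat)) else C0) else C0)).
  - rewrite (csum_delta_l m (i / D) (fun k => if Nat.eqb k (j / D) then csum D (fun l => Cmul (X (i / D)%nat (i mod D)%nat l) (Y k l (j mod D)%nat)) else C0))
      by eauto using div_lt_prod. reflexivity.
  - intros k Hk. destruct (Nat.eqb (i / D) k); destruct (Nat.eqb k (j / D)); try reflexivity;
      (transitivity (csum D (fun _ => C0)); [apply csum_ext; intros; ring|apply csum_zero]).
Qed.

Lemma blockdiag_adj D X : adj (blockdiag D X) = blockdiag D (fun c => adj (X c)).
Proof.
  mext. unfold adj, blockdiag. rewrite (Nat.eqb_sym (j / D)).
  destruct (Nat.eqb_spec (i / D) (j / D)) as [->|]; [reflexivity|apply C_ext; simpl; ring].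
Qed.

Lemma blockdiag_diagm D l :
  blockdiag D (fun c => diagm (l c)) = diagm (fun k => l (k / D)%nat (k mod D)%nat).
Proof.
  mext. unfold blockdiag, diagm. rewrite (eqb_div_mod i j D).
  destruct (Nat.eqb (i / D) (j / D)); reflexivity.
Qed.

Lemma blockdiag_mid D : blockdiag D (fun _ => mid) = mid.
Proof. apply (blockdiag_diagm D (fun _ _ => 1)). Qed.

Lemma blockdiag_meq m D X Y :
  (forall c, (c < m)%nat -> meq D (X c) (Y c)) -> meq (m * D) (blockdiag D X) (blockdiag D Y).
Proof.
  intros H i j Hi Hj. unfold blockdiag. rewrite (H (i / D)%nat); eauto using div_lt_prod, mod_lt_prod.
Qed.

Lemma blockdiag_unitary m D U :
  (forall c, (c < m)%nat -> unitary D (U c)) -> unitary (m * D) (blockdiag D U).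
Proof.
  intros H. unfold unitary. rewrite blockdiag_adj, blockdiag_mul, <- (blockdiag_mid D).
  apply blockdiag_meq. exact H.
Qed.

Lemma blockdiag_spectral m D X U l :
  (forall c, (c < m)%nat -> spectral_decomp D (X c) (U c) (l c)) ->
  spectral_decomp (m * D) (blockdiag D X) (blockdiag D U) (fun k => l (k / D)%nat (k mod D)%nat).
Proof.
  intros H. split; [apply blockdiag_unitary; intros; now apply H|].
  rewrite <- blockdiag_diagm, blockdiag_adj, !blockdiag_mul.
  apply blockdiag_meq. intros c Hc. apply H, Hc.
Qed.

(** Eigenbases of the blocks assemble to an eigenbasis of the direct sum; choice collects them for
    all [c] at once. *)
Lemma blockdiag_sqrtm m D X : (forall c, hermitian D (X c)) ->
  meq (m * D) (sqrtm (m * D) (blockdiag D X)) (blockdiag D (fun c => sqrtm D (X c))).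
Proof.
  intros H.
  destruct (IndefiniteDescription.functional_choice (fun c (Ul : Mat * (nat -> R)) => spectral_decomp D (X c) (fst Ul) (snd Ul))) as [Ul HUl].
  { intros c. destruct (spectral_theorem D (X c) (H c)) as (U & l & HU). now exists (U, l). }
  assert (HB := blockdiag_spectral m D X (fun c => fst (Ul c)) (fun c => snd (Ul c)) (fun c _ => HUl c)).
  rewrite (proj2 (sqrtm_decomp _ _ _ _ HB)).
  symmetry.
  apply (blockdiag_spectral m D (fun c => sqrtm D (X c)) (fun c => fst (Ul c)) (fun c k => sqrt (snd (Ul c) k))).
  intros c _. now apply sqrtm_decomp.
Qed.

Lemma blockdiag_psd m D X : (forall c, psd D (X c)) -> psd (m * D) (blockdiag D X).
Proof.
  intros H.
  rewrite (blockdiag_meq m D X (fun c => mmul D (adj (sqrtm D (X c))) (sqrtm D (X c)))).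
  - rewrite <- blockdiag_mul, <- blockdiag_adj. apply psd_gram.
  - intros c _. rewrite sqrtm_adj, sqrtm_sq by apply H. reflexivity.
Qed.

Lemma blockdiag_rtr m D X : rtr (m * D) (blockdiag D X) = rsum m (fun c => rtr D (X c)).
Proof.
  rewrite rtr_sum. rewrite (rsum_ext m _ (fun c => rsum D (fun j => Re (X c j j)))) by (intros; apply rtr_sum).
  rewrite <- (rsum_div_mod m D (fun c j => Re (X c j j))).
  apply rsum_ext; intros. unfold blockdiag. now rewrite Nat.eqb_refl.
Qed.

Lemma blockdiag_diagq m D U A k : (k < m * D)%nat ->
  diagq (m * D) (blockdiag D U) (blockdiag D A) k = diagq D (U (k / D)%nat) (A (k / D)%nat) (k mod D)%nat.
Proof.
  intros Hk. unfold diagq.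
  assert (meq (m * D) (mmul (m * D) (adj (blockdiag D U)) (mmul (m * D) (blockdiag D A) (blockdiag D U)))
     (blockdiag D (fun c => mmul D (adj (U c)) (mmul D (A c) (U c))))) as E.
  { rewrite blockdiag_adj, !blockdiag_mul. reflexivity. }
  rewrite E by assumption. unfold blockdiag. now rewrite Nat.eqb_refl.
Qed.

Lemma blockdiag_BC m D U A B :
  BC (m * D) (blockdiag D U) (blockdiag D A) (blockdiag D B) = rsum m (fun c => BC D (U c) (A c) (B c)).
Proof.
  unfold BC. rewrite <- (rsum_div_mod m D (fun c j => sqrt (diagq D (U c) (A c) j * diagq D (U c) (B c) j))).
  apply rsum_ext; intros k Hk. now rewrite !blockdiag_diagq.
Qed.

Lemma BC_meq d U a a' b b' : meq d a a' -> meq d b b' -> BC d U a b = BC d U a' b'.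
Proof.
  intros Ha Hb. unfold BC. apply rsum_ext; intros k Hk.
  now rewrite (diagq_meq d U a a' k Hk Ha), (diagq_meq d U b b' k Hk Hb).
Qed.

Lemma BC_scale d U r a b : 0 <= r -> BC d U (mscale r a) (mscale r b) = r * BC d U a b.
Proof.
  intros Hr. unfold BC. rewrite <- rsum_scal. apply rsum_ext; intros k _.
  rewrite !diagq_scale.
  replace (r * diagq d U a k * (r * diagq d U b k)) with (r * r * (diagq d U a k * diagq d U b k)) by ring.
  rewrite sqrt_mult_alt by nra. now rewrite sqrt_square.
Qed.

Lemma sqrtm_scale d r a : 0 <= r -> hermitian d a ->
  meq d (sqrtm d (mscale r a)) (mscale (sqrt r) (sqrtm d a)).
Proof.
  intros Hr Ha. destruct (spectral_theorem d a Ha) as (U & l & H).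
  assert (forall s m, mscale s (fcalc d U m) = fcalc d U (fun k => s * m k)) as Es.
  { intros s m. unfold fcalc.
    replace (diagm (fun k => s * m k)) with (mscale s (diagm m)).
    - now rewrite mmul_scale_r, mmul_scale_l.
    - mext. unfold mscale, diagm. destruct (Nat.eqb i j); apply C_ext; simpl; ring. }
  assert (Hs : spectral_decomp d (mscale r a) U (fun k => r * l k)).
  { split; [apply H|]. rewrite (proj2 H) at 1. fold (fcalc d U l). rewrite Es. reflexivity. }
  rewrite (proj2 (sqrtm_decomp _ _ _ _ Hs)), (proj2 (sqrtm_decomp _ _ _ _ H)).
  fold (fcalc d U (fun k => sqrt (l k))). rewrite Es.
  apply (fcalc_ext d U). intros k _. now apply sqrt_mult_alt.
Qed.

Lemma sfid_scale d r a b : 0 <= r -> hermitian d a -> hermitian d b ->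
  sfid d (mscale r a) (mscale r b) = r * sfid d a b.
Proof.
  intros Hr Ha Hb. unfold sfid. rewrite !sqrtm_scale by assumption.
  rewrite mmul_scale_l, mmul_scale_r, !rtr_scale, <- Rmult_assoc, sqrt_sqrt by assumption. reflexivity.
Qed.

Lemma sfid_meq d a a' b b' : hermitian d a -> hermitian d b -> meq d a a' -> meq d b b' ->
  sfid d a b = sfid d a' b'.
Proof.
  intros Ha Hb Ea Eb. unfold sfid. now rewrite (sqrtm_meq d a a' Ha Ea), (sqrtm_meq d b b' Hb Eb).
Qed.

Lemma blockdiag_sfid m D A B : (forall c, hermitian D (A c)) -> (forall c, hermitian D (B c)) ->
  sfid (m * D) (blockdiag D A) (blockdiag D B) = rsum m (fun c => sfid D (A c) (B c)).
Proof.
  intros HA HB. unfold sfid. rewrite !blockdiag_sqrtm, blockdiag_mul by assumption. apply blockdiag_rtr.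
Qed.

(* Inverse of [code]: the bit string of length [p] with binary code [c]. *)
Fixpoint bits (p c : nat) : nat -> bool :=
  match p with
  | O => zeros
  | S k => if Nat.ltb c (2 ^ k) then bits k c else upd (bits k (c - 2 ^ k)) k true
  end.

Lemma bits_high p c k : (p <= k)%nat -> bits p c k = false.
Proof.
  revert c. induction p as [|p IH]; intros c Hk; simpl; [reflexivity|].
  destruct (Nat.ltb c (2 ^ p)); [apply IH; lia|].
  unfold upd. destruct (Nat.eqb_spec k p); [lia|apply IH; lia].
Qed.

Lemma upd_same u k b : u k = b -> upd u k b = u.
Proof.
  intros H. apply functional_extensionality; intros i. unfold upd.
  destruct (Nat.eqb_spec i k); congruence.
Qed.

Lemma code_agree u v p : (forall i, (i < p)%nat -> u i = v i) -> code u p = code v p.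
Proof.
  induction p as [|p IH]; intros H; simpl; [reflexivity|].
  rewrite IH by (intros; apply H; lia). now rewrite H by lia.
Qed.

Lemma code_bits p c : (c < 2 ^ p)%nat -> code (bits p c) p = c.
Proof.
  revert c. induction p as [|p IH]; intros c Hc.
  - simpl in *. lia.
  - simpl in Hc. cbn [bits code]. destruct (Nat.ltb_spec c (2 ^ p)).
    + rewrite IH, bits_high by lia. lia.
    + rewrite (code_agree _ (bits p (c - 2 ^ p))).
      * rewrite IH by lia. unfold upd. rewrite Nat.eqb_refl. lia.
      * intros i Hi. unfold upd. destruct (Nat.eqb_spec i p); [lia|reflexivity].
Qed.

Lemma ef_bits p F : ext_fold Rplus p 0 zeros F = rsum (2 ^ p) (fun c => F (bits p c)).
Proof.
  revert F. induction p as [|p IH]; intros F; [simpl; ring|].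
  rewrite ext_fold_last, IH, rsum_add.
  replace (2 ^ S p)%nat with (2 ^ p + 2 ^ p)%nat by (simpl; lia). rewrite rsum_app.
  f_equal; apply rsum_ext; intros c Hc; cbn [bits].
  - destruct (Nat.ltb_spec c (2 ^ p)); [|lia]. now rewrite upd_same by now apply bits_high.
  - destruct (Nat.ltb_spec (2 ^ p + c) (2 ^ p)); [lia|].
    now replace (2 ^ p + c - 2 ^ p)%nat with c by lia.
Qed.

Lemma ef_madd_fst m s u F i j :
  fst (ext_fold madd m s u F i j) = ext_fold Rplus m s u (fun v => fst (F v i j)).
Proof. revert s u. induction m as [|m IH]; intros; simpl; [reflexivity|]. now rewrite !IH. Qed.
Lemma ef_madd_snd m s u F i j :
  snd (ext_fold madd m s u F i j) = ext_fold Rplus m s u (fun v => snd (F v i j)).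
Proof. revert s u. induction m as [|m IH]; intros; simpl; [reflexivity|]. now rewrite !IH. Qed.

Section Fidelity.
Variables (rho : bool -> Mat) (d : nat).
Hypothesis Hrho : forall b, density d (rho b).

Lemma split_state_blockdiag n p b :
  meq (2 ^ p * dimN d n) (split_state rho d n p b)
    (blockdiag (dimN d n) (fun c => mscale (/ 2 ^ p) (node_pair rho d n p (bits p c) b))).
Proof.
  intros i j Hi Hj. unfold split_state. fold zeros.
  set (D := dimN d n) in *. set (X := fun u => mscale (/ 2 ^ p) (rhobar rho d n (S p) (upd u p b))).
  (* Only the string whose code is the common block number of [i] and [j] contributes. *)
  transitivity (csum (2 ^ p) (fun c => if Nat.eqb (i / D) c then
    (if Nat.eqb c (j / D) then X (bits p c) (i mod D)%nat (j mod D)%nat else C0) else C0)).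
  - assert (forall c, (c < 2 ^ p)%nat ->
       kron D (ketbra (code (bits p c) p)) (X (bits p c)) i j =
       if Nat.eqb (i / D) c then
         (if Nat.eqb c (j / D) then X (bits p c) (i mod D)%nat (j mod D)%nat else C0) else C0) as E.
    { intros c Hc. unfold kron, ketbra. rewrite code_bits by assumption.
      rewrite (Nat.eqb_sym (j / D)).
      destruct (Nat.eqb (i / D) c); destruct (Nat.eqb c (j / D)); simpl; ring. }
    apply C_ext.
    + rewrite ef_madd_fst, ef_bits, csum_fst. apply rsum_ext; intros c Hc. now rewrite <- E.
    + rewrite ef_madd_snd, ef_bits, csum_snd. apply rsum_ext; intros c Hc. now rewrite <- E.
  - rewrite (csum_delta_l (2 ^ p) (i / D)
      (fun c => if Nat.eqb c (j / D) then X (bits p c) (i mod D)%nat (j mod D)%nat else C0))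
      by eauto using div_lt_prod. reflexivity.
Qed.

Lemma bavg_bits p F : bavg p F = rsum (2 ^ p) (fun c => / 2 ^ p * F (bits p c)).
Proof. unfold bavg. now rewrite ef_bits, rsum_scal. Qed.

(** [t] is the root of the fidelity, the [Z] of the whole split channel. The lower bound compares
    trace and trace norm; the upper one is [tnorm_le_BC] in a block-diagonal basis, a measurement
    that may depend on the register. *)
Lemma Fsplit_bounds n p : (p < 2 ^ n)%nat -> exists t, 0 <= t /\ Fsplit rho d n p = t * t /\
  node_avg rho d sfid n p <= t <= node_avg rho d BCinf n p.
Proof.
  intros Hp. unfold Fsplit, fid.
  set (D := dimN d n). set (N := (2 ^ p * D)%nat).
  set (s0 := split_state rho d n p false). set (s1 := split_state rho d n p true).
  set (X := fun b c => mscale (/ 2 ^ p) (node_pair rho d n p (bits p c) b)).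
  assert (Hi : 0 <= / 2 ^ p) by (left; apply Rinv_0_lt_compat, pow2_pos).
  assert (HX : forall b c, psd D (X b c)).
  { intros b c. apply psd_scale; [assumption|]. now apply node_pair_density. }
  assert (E0 : meq N s0 (blockdiag D (X false))) by apply split_state_blockdiag.
  assert (E1 : meq N s1 (blockdiag D (X true))) by apply split_state_blockdiag.
  assert (P0 : psd N s0) by (rewrite E0; now apply blockdiag_psd).
  assert (P1 : psd N s1) by (rewrite E1; now apply blockdiag_psd).
  exists (tnorm N (mmul N (sqrtm N s0) (sqrtm N s1))).
  split; [apply tnorm_pos|]. split; [ring|]. split.
  - eapply Rle_trans; [|apply rtr_le_tnorm].
    fold (sfid N s0 s1). rewrite (sfid_meq N s0 _ s1 _ (proj1 P0) (proj1 P1) E0 E1).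
    unfold N. rewrite blockdiag_sfid by (intros; apply HX).
    unfold node_avg. rewrite bavg_bits. apply rsum_le; intros c Hc.
    unfold X. rewrite sfid_scale; [apply Rle_refl|assumption|..]; now apply node_pair_density.
  - apply le_epsilon. intros e He.
    (* One basis per block, each optimal up to the same [e]; the errors average to [e]. *)
    destruct (IndefiniteDescription.functional_choice (fun c U => unitary D U /\
      BC D U (node_pair rho d n p (bits p c) false) (node_pair rho d n p (bits p c) true)
      <= BCinf D (node_pair rho d n p (bits p c) false) (node_pair rho d n p (bits p c) true) + e)) as [U HU].
    { intros c. apply BCinf_approx. assumption. }
    eapply Rle_trans; [apply (tnorm_le_BC N (blockdiag D U) s0 s1); try assumption|].
    + apply blockdiag_unitary. intros; apply HU.
    + rewrite (BC_meq _ _ _ _ _ _ E0 E1). unfold N. rewrite blockdiag_BC.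
      rewrite <- (bavg_const p e). unfold node_avg. rewrite <- bavg_add, bavg_bits.
      apply rsum_le; intros c Hc. unfold X. rewrite BC_scale by assumption.
      apply Rmult_le_compat_l; [assumption|]. apply HU.
Qed.
End Fidelity.

(** * Block error probability of the successive cancellation decoder *)

Lemma ext_fold_agree {T} (add : T -> T -> T) m s u F G :
  (forall v, (forall i, (i < s)%nat -> v i = u i) -> F v = G v) ->
  ext_fold add m s u F = ext_fold add m s u G.
Proof.
  revert s u. induction m as [|m IH]; intros s u H; simpl; [now apply H|].
  f_equal; apply IH; intros v Hv; apply H; intros i Hi; rewrite Hv by lia; unfold upd;
    destruct (Nat.eqb_spec i s); (lia || reflexivity).
Qed.

Lemma ext_fold_agree_base {T} (add : T -> T -> T) m s u v F :
  (forall x y, (forall i, (i < s + m)%nat -> x i = y i) -> F x = F y) ->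
  (forall i, (i < s)%nat -> u i = v i) ->
  ext_fold add m s u F = ext_fold add m s v F.
Proof.
  revert s u v. induction m as [|m IH]; intros s u v HF H; simpl.
  - apply HF. intros; apply H; lia.
  - f_equal; (apply IH; [intros; apply HF; intros; match goal with h : _ |- _ => apply h; lia end|]);
      intros i Hi; unfold upd; destruct (Nat.eqb_spec i s); try reflexivity; apply H; lia.
Qed.

Lemma upd_upd u k a b : upd (upd u k a) k b = upd u k b.
Proof.
  apply functional_extensionality; intros i. unfold upd. now destruct (Nat.eqb i k).
Qed.

Lemma ef_rtr_mul d M m s u F :
  ext_fold Rplus m s u (fun v => rtr d (mmul d M (F v))) = rtr d (mmul d M (ext_fold madd m s u F)).
Proof.
  revert s u. induction m as [|m IH]; intros; simpl; [reflexivity|].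
  now rewrite !IH, mmul_add_r, rtr_add.
Qed.

Section Decoder.
Variables (rho : bool -> Mat) (d : nat).
Hypothesis Hrho : forall b, density d (rho b).

Lemma rho_comb_agree n u v :
  (forall i, (i < 2 ^ n)%nat -> u i = v i) -> rho_comb rho d n u = rho_comb rho d n v.
Proof.
  revert u v. induction n as [|n IH]; intros u v H; cbn [rho_comb].
  - rewrite H by (simpl; lia). reflexivity.
  - assert (2 ^ S n = 2 * 2 ^ n)%nat by reflexivity.
    f_equal; apply IH; intros i Hi; rewrite !H by lia; reflexivity.
Qed.

Lemma rhobar_agree n q u v : (q <= 2 ^ n)%nat ->
  (forall i, (i < q)%nat -> u i = v i) -> rhobar rho d n q u = rhobar rho d n q v.
Proof.
  intros Hq H. unfold rhobar. f_equal. apply ext_fold_agree_base; [|assumption].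
  intros x y Hxy. apply rho_comb_agree. intros; apply Hxy. lia.
Qed.

Definition node_proj (n k : nat) (u : nat -> bool) : Mat :=
  nonneg_proj (dimN d n) (msub (sqrtm (dimN d n) (node_pair rho d n k u false))
                               (sqrtm (dimN d n) (node_pair rho d n k u true))).

Lemma Pi_projector n A k u : (k < 2 ^ n)%nat -> projector (dimN d n) (Defs.Pi rho d n A k u).
Proof.
  intros Hk. unfold Defs.Pi. fold (node_pair rho d n k u). destruct (A k); [|apply projector_mid].
  cbv zeta.
  assert (projector (dimN d n) (node_proj n k u)) as H.
  { apply nonneg_proj_projector. apply sqrtm_diff_herm; now apply node_pair_density. }
  destruct (u k); [now apply projector_compl|exact H].
Qed.

(** Causality of the decoder: no later bit is read, so the projector can leave the sum over the
    later bits. *)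
Lemma Pi_agree n A k u v : (k < 2 ^ n)%nat ->
  (forall i, (i < S k)%nat -> u i = v i) -> Defs.Pi rho d n A k u = Defs.Pi rho d n A k v.
Proof.
  intros Hk H. unfold Defs.Pi. rewrite (H k) by lia.
  assert (forall b, rhobar rho d n (S k) (upd u k b) = rhobar rho d n (S k) (upd v k b)) as E;
    [|now rewrite !E].
  intros b. apply rhobar_agree; [lia|]. intros i Hi. unfold upd. destruct (Nat.eqb i k); [reflexivity|now apply H].
Qed.

(** Writing the state as [X (adj X)] turns its trace into a squared Hilbert-Schmidt norm, the form
    of [union_bound]. *)
Lemma decode_state_seq n A u K : (K <= 2 ^ n)%nat ->
  let D := dimN d n in let X := seq_proj D (fun k => Defs.Pi rho d n A k u) K (sqrtm D (rho_comb rho d n u)) in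
  meq D (decode_state rho d n A K u) (mmul D X (adj X)).
Proof.
  intros HK D. assert (HD := rho_comb_density rho d Hrho n u). fold D in HD.
  induction K as [|K IH]; cbv zeta; simpl.
  - rewrite sqrtm_adj, sqrtm_sq by apply HD. reflexivity.
  - fold D. rewrite IH by lia. rewrite adj_mul, !mmul_assoc.
    assert (HP := Pi_projector n A K u ltac:(lia)). fold D in HP. destruct HP as [HP _]; red in HP.
    rewrite HP. reflexivity.
Qed.

Lemma decoding_loss n A u : let D := dimN d n in
  0 <= 1 - rtr D (decode_state rho d n A (2 ^ n) u) <=
  4 * rsum (2 ^ n) (fun k => rtr D (mmul D (msub mid (Defs.Pi rho d n A k u)) (rho_comb rho d n u))).
Proof.
  intros D. assert (HD := rho_comb_density rho d Hrho n u). fold D in HD.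
  set (S0 := sqrtm D (rho_comb rho d n u)).
  assert (HP : forall k, (k < 2 ^ n)%nat -> projector D (Defs.Pi rho d n A k u)) by (intros; now apply Pi_projector).
  assert (E := decode_state_seq n A u (2 ^ n) (le_n _)). cbv zeta in E. fold D S0 in E.
  rewrite E, rtr_comm. fold (hs D (seq_proj D (fun k => Defs.Pi rho d n A k u) (2 ^ n) S0) (seq_proj D (fun k => Defs.Pi rho d n A k u) (2 ^ n) S0)).
  assert (hs D S0 S0 = 1) as <-.
  { unfold hs, S0. rewrite sqrtm_adj, sqrtm_sq by apply HD. now apply density_rtr. }
  rewrite (rsum_ext (2 ^ n) _ (fun k => hs D (msub S0 (mmul D (Defs.Pi rho d n A k u) S0)) (msub S0 (mmul D (Defs.Pi rho d n A k u) S0)))).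
  - now apply union_bound.
  - intros k Hk. rewrite projector_compl_hs by now apply HP.
    assert (ES : meq D (adj S0) S0) by apply sqrtm_adj, HD.
    assert (EQ : meq D (rho_comb rho d n u) (mmul D S0 S0)) by (symmetry; apply sqrtm_sq, HD).
    unfold hs. rewrite ES, EQ, <- mmul_assoc, rtr_comm, mmul_sub_l, mmul_1_l. reflexivity.
Qed.

(** Averaging over the bits after position [k] replaces the state by [rhobar]. Averaging over bit
    [k] itself then gives half the sum of the two errors of the decision projector, or 0 if the bit
    is frozen. *)
Lemma decoding_error_step n A k : (k < 2 ^ n)%nat -> let D := dimN d n in
  bavg (2 ^ n) (fun u => rtr D (mmul D (msub mid (Defs.Pi rho d n A k u)) (rho_comb rho d n u)))
  <= 1/2 * (if A k then node_avg rho d sfid n k else 0).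
Proof.
  intros Hk D.
  set (r := (2 ^ n - S k)%nat).
  assert (bavg (2 ^ n) (fun u => rtr D (mmul D (msub mid (Defs.Pi rho d n A k u)) (rho_comb rho d n u))) =
    bavg (S k) (fun u => rtr D (mmul D (msub mid (Defs.Pi rho d n A k u)) (rhobar rho d n (S k) u)))) as ->.
  { unfold bavg. replace (2 ^ n)%nat with (S k + r)%nat by (unfold r; lia).
    rewrite ext_fold_app, pow_add, Rinv_mult, Rmult_assoc. f_equal. rewrite <- ef_scal.
    apply ext_fold_ext; intros u. simpl (0 + S k)%nat.
    rewrite (ext_fold_agree Rplus r (S k) u _ (fun v => rtr D (mmul D (msub mid (Defs.Pi rho d n A k u)) (rho_comb rho d n v)))).
    - rewrite ef_rtr_mul. unfold rhobar. fold r. now rewrite mmul_scale_r, rtr_scale.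
    - intros v Hv. now rewrite (Pi_agree n A k v u Hk Hv). }
  rewrite bavg_last. unfold node_avg. fold D.
  destruct (A k) eqn:EA.
  - rewrite <- bavg_scal. apply bavg_le; intros u.
    apply Rmult_le_compat_l; [lra|].
    unfold Defs.Pi. rewrite EA. cbv zeta. rewrite !upd_upd.
    assert (forall b, upd u k b k = b) as Eu by (intros; unfold upd; now rewrite Nat.eqb_refl).
    rewrite !Eu. fold (node_pair rho d n k u false) (node_pair rho d n k u true).
    fold (node_proj n k u). fold D.
    replace (msub mid (msub mid (node_proj n k u))) with (node_proj n k u)
      by (mext; unfold msub; ring).
    apply pgm_error_bound; now apply node_pair_density.
  - rewrite Rmult_0_r, <- (bavg_const k 0). apply bavg_le; intros u.
    unfold Defs.Pi. rewrite EA, !mmul_sub_l, !rtr_sub. lra.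
Qed.

(** 2 is the 4 of the union bound times the 1/2 of a uniform input bit. *)
Lemma Pe_bounds n A :
  0 <= Pe rho d n A <= 2 * rsum (2 ^ n) (fun k => if A k then node_avg rho d sfid n k else 0).
Proof.
  assert (Pe rho d n A = bavg (2 ^ n) (fun u => 1 - rtr (dimN d n) (decode_state rho d n A (2 ^ n) u))) as ->.
  { unfold Pe. fold zeros.
    change (1 - bavg (2 ^ n) (fun u => rtr (dimN d n) (decode_state rho d n A (2 ^ n) u)) =
            bavg (2 ^ n) (fun u => 1 - rtr (dimN d n) (decode_state rho d n A (2 ^ n) u))).
    rewrite (bavg_ext (2 ^ n) (fun u => 1 - rtr (dimN d n) (decode_state rho d n A (2 ^ n) u))
      (fun u => 1 + (-1) * rtr (dimN d n) (decode_state rho d n A (2 ^ n) u))) by (intros; ring).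
    rewrite bavg_add, bavg_const, bavg_scal. ring. }
  split.
  - rewrite <- (bavg_const (2 ^ n) 0). apply bavg_le; intros. apply decoding_loss.
  - eapply Rle_trans; [apply bavg_le; intros; apply decoding_loss|]. cbv beta zeta.
    rewrite bavg_scal. unfold bavg at 1. rewrite ef_rsum, <- rsum_scal.
    replace (2 * rsum (2 ^ n) (fun k => if A k then node_avg rho d sfid n k else 0))
      with (4 * rsum (2 ^ n) (fun k => 1/2 * (if A k then node_avg rho d sfid n k else 0)))
      by (rewrite rsum_scal; field).
    apply Rmult_le_compat_l; [lra|]. apply rsum_le; intros k Hk. now apply decoding_error_step.
Qed.
End Decoder.

(** * Polarization of a scalar process on the binary tree *)

Lemma INR_pow2 p : INR (2 ^ p) = 2 ^ p.
Proof. now rewrite pow_INR. Qed.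

Lemma rsum_pow2_S n f :
  rsum (2 ^ S n) f = rsum (2 ^ n) (fun q => f (2 * q)%nat + f (S (2 * q))).
Proof.
  replace (2 ^ S n)%nat with (2 ^ n * 2)%nat by (simpl; lia). rewrite rsum_prod.
  apply rsum_ext; intros q _. simpl rsum.
  replace (q * 2 + 0)%nat with (2 * q)%nat by lia. replace (q * 2 + 1)%nat with (S (2 * q)) by lia. ring.
Qed.

(* Number of sign strings of length [L] with fewer than [j] plus signs. *)
Fixpoint few_plus (L j : nat) : R :=
  match L with
  | O => if Nat.eqb j 0 then 0 else 1
  | S L' => few_plus L' j + few_plus L' (j - 1)
  end.

Lemma few_plus_0 L : few_plus L 0 = 0.
Proof. induction L as [|L IH]; simpl; [reflexivity|]. rewrite IH. ring. Qed.

(* Chebyshev: the second moment of a simple random walk started at [s] is [s^2 + L]. *)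
Lemma few_plus_chebyshev L j s a : 0 <= a -> a <= s + INR L - 2 * INR j + 2 ->
  few_plus L j * (a * a) <= 2 ^ L * (s * s + INR L).
Proof.
  revert j s. induction L as [|L IH]; intros j s Ha Hs.
  - simpl. destruct (Nat.eqb_spec j 0) as [->|Hj]; [simpl; nra|].
    assert (1 <= INR j) by (apply (le_INR 1); lia). simpl in Hs. nra.
  - cbn [few_plus]. rewrite S_INR in Hs.
    (* A minus sign moves the walk up, a plus sign down. With at most [j - 1] plus signs it ends at
       or above [s + L - 2 (j - 1)], the bound imposed on [a]. *)
    assert (H1 := IH j (s + 1) Ha ltac:(lra)).
    assert (few_plus L (j - 1) * (a * a) <= 2 ^ L * ((s - 1) * (s - 1) + INR L)) as H2.
    { destruct j as [|j].
      - replace (few_plus L (0 - 1)) with 0.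
        + rewrite Rmult_0_l. assert (0 <= INR L) by apply pos_INR.
          apply Rmult_le_pos; [apply pow_le; lra|].
          assert (0 <= (s - 1) * (s - 1)) by apply Rle_0_sqr. lra.
        + symmetry. apply few_plus_0.
      - replace (S j - 1)%nat with j by lia. rewrite S_INR in Hs. apply IH; lra. }
    rewrite S_INR, <- tech_pow_Rmult.
    assert (2 ^ L * ((s + 1) * (s + 1) + INR L) + 2 ^ L * ((s - 1) * (s - 1) + INR L)
      = 2 * 2 ^ L * (s * s + (INR L + 1))) by ring.
    nra.
Qed.

(** All that is used of the channels is condensed into inequalities for two scalars on the nodes of
    a binary tree. [I_le_Y] expresses that [I] is small near [Y = 1], with a slope depending on the
    tolerated error. *)
Section Polarization.
Variables (Y I : nat -> nat -> R).
Hypothesis Y_bounds : forall n q, (q < 2 ^ n)%nat -> 0 <= Y n q <= 1.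
Hypothesis Y_minus : forall n q, (q < 2 ^ n)%nat -> Y (S n) (2 * q) <= 2 * Y n q - Y n q * Y n q.
Hypothesis Y_plus : forall n q, (q < 2 ^ n)%nat -> Y (S n) (S (2 * q)) <= Y n q * Y n q.
Hypothesis I_chain : forall n q, (q < 2 ^ n)%nat -> I (S n) (2 * q)%nat + I (S n) (S (2 * q)) = 2 * I n q.
Hypothesis I_le_1 : forall n q, (q < 2 ^ n)%nat -> I n q <= 1.
Hypothesis I_le_Y : forall e, 0 < e -> exists K, 0 <= K /\
  forall n q, (q < 2 ^ n)%nat -> I n q <= e + K * (1 - Y n q).

Definition level_avg (n : nat) (f : nat -> R) : R := / 2 ^ n * rsum (2 ^ n) f.

Lemma inv_pow2_pos n : 0 < / 2 ^ n.
Proof. apply Rinv_0_lt_compat, pow_lt; lra. Qed.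

Lemma level_avg_le n f g : (forall q, (q < 2 ^ n)%nat -> f q <= g q) -> level_avg n f <= level_avg n g.
Proof.
  intros H. apply Rmult_le_compat_l; [left; apply inv_pow2_pos|]. now apply rsum_le.
Qed.
Lemma level_avg_add n f g : level_avg n (fun q => f q + g q) = level_avg n f + level_avg n g.
Proof. unfold level_avg. rewrite rsum_add. ring. Qed.
Lemma level_avg_scal n c f : level_avg n (fun q => c * f q) = c * level_avg n f.
Proof. unfold level_avg. rewrite rsum_scal. ring. Qed.
Lemma level_avg_const n c : level_avg n (fun _ => c) = c.
Proof.
  unfold level_avg. rewrite rsum_const, INR_pow2. field. apply pow_nonzero; lra.
Qed.
Lemma level_avg_S n f : level_avg (S n) f = level_avg n (fun q => 1/2 * (f (2 * q)%nat + f (S (2 * q)))).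
Proof.
  unfold level_avg. rewrite rsum_pow2_S, rsum_scal. rewrite <- tech_pow_Rmult, Rinv_mult. field.
  apply pow_nonzero; lra.
Qed.

Lemma I_avg n : level_avg n (I n) = I 0 0%nat.
Proof.
  induction n as [|n IH].
  - unfold level_avg. simpl. field.
  - rewrite level_avg_S, <- IH. unfold level_avg. f_equal. apply rsum_ext; intros q Hq.
    rewrite I_chain by assumption. field.
Qed.

Definition ind_le (t x : R) : R := if Rle_dec x t then 1 else 0.

Lemma ind_le_bounds t x : 0 <= ind_le t x <= 1.
Proof. unfold ind_le. destruct (Rle_dec x t); lra. Qed.

Definition good_frac (n : nat) (t : R) : R := level_avg n (fun q => ind_le t (Y n q)).

Definition unpolarized (n : nat) : R := level_avg n (fun q => Y n q * Y n q * ((1 - Y n q) * (1 - Y n q))).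

(* The potential [2 y - y^2] decreases by [y^2 (1-y)^2] on average in each step. *)
Lemma unpolarized_sum K : rsum K unpolarized <= 1 - level_avg K (fun q => 2 * Y K q - Y K q * Y K q).
Proof.
  induction K as [|K IH].
  - simpl. unfold level_avg. simpl. assert (B := Y_bounds 0 0 ltac:(simpl; lia)). rewrite Rinv_1. nra.
  - cbn [rsum].
    assert (level_avg (S K) (fun q => 2 * Y (S K) q - Y (S K) q * Y (S K) q) + unpolarized K
      <= level_avg K (fun q => 2 * Y K q - Y K q * Y K q)); [|lra].
    rewrite level_avg_S. unfold unpolarized. rewrite <- level_avg_add. apply level_avg_le; intros q Hq.
    assert (B := Y_bounds K q Hq). assert (Hm := Y_minus K q Hq). assert (Hp := Y_plus K q Hq).
    assert (Bm := Y_bounds (S K) (2 * q) ltac:(simpl; lia)).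
    assert (Bp := Y_bounds (S K) (S (2 * q)) ltac:(simpl; lia)).
    set (y := Y K q) in *. set (m := Y (S K) (2 * q)) in *. set (p := Y (S K) (S (2 * q))) in *.
    assert (By : 0 <= y * y <= 1) by nra.
    (* With [f t = 2 t - t^2], increasing on [0, 1], the two products say [f m <= f (2 y - y^2)] and
       [f p <= f (y^2)]; the mean of these bounds is [f y - y^2 (1 - y)^2]. *)
    assert (0 <= (2 * y - y * y - m) * (2 - m - (2 * y - y * y))) by (apply Rmult_le_pos; nra).
    assert (0 <= (y * y - p) * (2 - p - y * y)) by (apply Rmult_le_pos; lra).
    nra.
Qed.

(** Pigeonhole: were all [K] terms above [1/K], their sum would exceed 1. *)
Lemma exists_polarized_level K : (0 < K)%nat -> exists n, (n < K)%nat /\ unpolarized n <= / INR K.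
Proof.
  intros HK. apply Classical_Prop.NNPP. intros Hn.
  assert (0 < INR K) by now apply lt_0_INR.
  assert (H2 := unpolarized_sum K).
  assert (Hall : forall n, (n < K)%nat -> / INR K < unpolarized n).
  { intros n Hlt. destruct (Rle_dec (unpolarized n) (/ INR K)); [|lra]. exfalso; apply Hn; now exists n. }
  assert (1 < rsum K unpolarized).
  { destruct K as [|K]; [lia|].
    assert (rsum K (fun _ => / INR (S K)) <= rsum K unpolarized).
    { apply rsum_le; intros n Hlt. left. apply Hall. lia. }
    assert (L := Hall K ltac:(lia)). cbn [rsum]. rewrite rsum_const in *.
    assert (INR K * / INR (S K) + / INR (S K) = 1) by (rewrite S_INR in *; field; lra). lra. }
  assert (0 <= level_avg K (fun q => 2 * Y K q - Y K q * Y K q)); [|lra].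
  rewrite <- (level_avg_const K 0). apply level_avg_le; intros q Hq.
  assert (B := Y_bounds K q Hq). nra.
Qed.

(** Three classes of nodes: [Y <= eta], where [I <= 1]; [Y] near 1, where [I <= delta]; and the
    rest, where [Y^2 (1 - Y)^2 >= g^2 eta^2] and Markov's inequality applies. The conserved mean of
    [I] must be carried by the three together. *)
Lemma good_frac_initial delta : 0 < delta -> exists C, 0 < C /\
  forall n eta, 0 < eta -> I 0 0%nat - delta - C * unpolarized n / (eta * eta) <= good_frac n eta.
Proof.
  intros Hd. destruct (I_le_Y (delta / 2) ltac:(lra)) as (K & HK & HI).
  (* Keeps [K (1 - Y)] below [delta / 2] on the second class; [K + 1] covers [K = 0]. *)
  set (g := delta / (2 * (K + 1))).
  assert (Hg : 0 < g) by (unfold g; apply Rdiv_lt_0_compat; lra).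
  assert (HKg : K * g <= delta / 2).
  { unfold g. replace (delta / 2) with ((K + 1) * (delta / (2 * (K + 1)))) by (field; lra).
    apply Rmult_le_compat_r; [left; exact Hg|lra]. } clearbody g.
  exists (/ (g * g)). split; [apply Rinv_0_lt_compat; nra|].
  intros n eta He.
  assert (level_avg n (I n) <= level_avg n (fun q => ind_le eta (Y n q) + (delta +
    / (g * g) / (eta * eta) * (Y n q * Y n q * ((1 - Y n q) * (1 - Y n q)))))) as H.
  { apply level_avg_le; intros q Hq.
    assert (B := Y_bounds n q Hq). assert (I1 := I_le_1 n q Hq). assert (I2 := HI n q Hq).
    assert (0 < / (g * g)) by (apply Rinv_0_lt_compat; nra).
    assert (0 < / (eta * eta)) by (apply Rinv_0_lt_compat; nra).
    set (y := Y n q) in *.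
    assert (0 <= y * y * ((1 - y) * (1 - y))) by (apply Rmult_le_pos; [nra|apply Rle_0_sqr]).
    assert (0 <= / (g * g) / (eta * eta) * (y * y * ((1 - y) * (1 - y)))).
    { apply Rmult_le_pos; [|assumption]. unfold Rdiv. apply Rmult_le_pos; lra. }
    unfold ind_le. destruct (Rle_dec y eta) as [|Hn]; [lra|].
    destruct (Rle_dec (1 - y) g) as [Hs|Hs].
    - assert (K * (1 - y) <= K * g) by (apply Rmult_le_compat_l; lra). lra.
    - assert (1 <= / (g * g) / (eta * eta) * (y * y * ((1 - y) * (1 - y)))); [|lra].
      apply (Rmult_le_reg_r (g * g * (eta * eta))); [repeat apply Rmult_lt_0_compat; lra|].
      replace (/ (g * g) / (eta * eta) * (y * y * ((1 - y) * (1 - y))) * (g * g * (eta * eta)))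
        with (y * y * ((1 - y) * (1 - y))) by (field; lra).
      rewrite Rmult_1_l, (Rmult_comm (g * g)). apply Rmult_le_compat; [nra|nra|apply Rmult_le_compat; lra|apply Rmult_le_compat; lra]. }
  rewrite I_avg, !level_avg_add, level_avg_const, level_avg_scal in H.
  fold (good_frac n eta) in H. fold (unpolarized n) in H.
  replace (/ (g * g) * unpolarized n / (eta * eta)) with (/ (g * g) / (eta * eta) * unpolarized n) by (field; lra).
  lra.
Qed.

(* Invariant: [Y <= z^(2^i)] with [z <= 2^-(remaining steps + 1)]; a minus step doubles [z], a plus step
   increments [i]. *)
Lemma descendants_good L n q z i J : (q < 2 ^ n)%nat ->
  0 <= z <= (1/2) ^ S L -> Y n q <= z ^ (2 ^ i) ->
  rsum (2 ^ L) (fun r => 1 - ind_le ((1/2) ^ (2 ^ J)) (Y (n + L) (q * 2 ^ L + r))) <= few_plus L (J - i).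
Proof.
  revert n q z i. induction L as [|L IH]; intros n q z i Hq Hz HY.
  - simpl rsum. cbn [few_plus]. replace (n + 0)%nat with n by lia. replace (q * 1 + 0)%nat with q by lia.
    (* If [J - i = 0], enough plus signs have occurred: [i >= J], and [z <= 1/2] gives the
       target. *)
    destruct (Nat.eqb_spec (J - i) 0) as [E|E].
    + assert (Y n q <= (1/2) ^ (2 ^ J)) as Hle.
      { eapply Rle_trans; [apply HY|]. eapply Rle_trans; [apply pow_incr; split; [apply Hz|apply Hz]|].
        simpl pow at 1. rewrite Rmult_1_r.
        assert (H : (2 ^ J <= 2 ^ i)%nat) by (apply Nat.pow_le_mono_r; lia).
        replace (2 ^ i)%nat with (2 ^ J + (2 ^ i - 2 ^ J))%nat by lia.
        rewrite pow_add. rewrite <- (Rmult_1_r ((1/2) ^ (2 ^ J))) at 2.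
        apply Rmult_le_compat_l; [apply pow_le; lra|]. eapply Rle_trans; [apply (pow_incr _ 1); lra|]. rewrite pow1. lra. }
      unfold ind_le. destruct (Rle_dec _ _); [lra|contradiction].
    + assert (B := ind_le_bounds ((1/2) ^ (2 ^ J)) (Y n q)). lra.
  - replace (2 ^ S L)%nat with (2 ^ L + 2 ^ L)%nat by (simpl; lia). rewrite rsum_app. cbn [few_plus].
    assert (Hpos : (0 < 2 ^ i)%nat) by (apply Nat.neq_0_lt_0, Nat.pow_nonzero; lia).
    assert (Hy := Y_bounds n q Hq). assert (Hm := Y_minus n q Hq). assert (Hp := Y_plus n q Hq).
    assert (E : (1/2) ^ S (S L) = 1/2 * (1/2) ^ S L) by reflexivity.
    assert (0 < (1/2) ^ S L) by (apply pow_lt; lra).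
    apply Rplus_le_compat.
    + rewrite (rsum_ext _ _ (fun r => 1 - ind_le ((1/2) ^ (2 ^ J)) (Y (S n + L) (2 * q * 2 ^ L + r)))).
      2:{ intros r _. do 2 f_equal. f_equal; lia. }
      apply (IH (S n) (2 * q)%nat (2 * z) i); [simpl; lia|lra|].
      (* A factor 2 on [Y] is absorbed by the factor 2 on [z]. *)
      assert (2 <= 2 ^ (2 ^ i)) by (rewrite <- (pow_1 2) at 1; apply Rle_pow; [lra|lia]).
      assert (0 <= z ^ (2 ^ i)) by (apply pow_le; lra).
      rewrite Rpow_mult_distr. nra.
    + rewrite (rsum_ext _ _ (fun r => 1 - ind_le ((1/2) ^ (2 ^ J)) (Y (S n + L) (S (2 * q) * 2 ^ L + r)))).
      2:{ intros r _. do 2 f_equal. f_equal; lia. }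
      replace (J - i - 1)%nat with (J - S i)%nat by lia.
      apply (IH (S n) (S (2 * q)) z (S i)); [simpl; lia|lra|].
      replace (2 ^ S i)%nat with (2 ^ i + 2 ^ i)%nat by (simpl; lia). rewrite pow_add.
      assert (0 <= z ^ (2 ^ i)) by (apply pow_le; lra). nra.
Qed.

(** A node with [Y <= t] fails on at most [few_plus L J] of its [2^L] descendants, a fraction that
    Chebyshev bounds by [L / a^2]. The bound on [t] keeps [z] at most 1/2 through [L] doublings. *)
Lemma good_frac_boost n L J t a : t <= (1/2) ^ S L -> 0 < a -> a <= INR L - 2 * INR J + 2 ->
  good_frac n t - INR L / (a * a) <= good_frac (n + L) ((1/2) ^ (2 ^ J)).
Proof.
  intros Ht Ha HaL.
  assert (HC := few_plus_chebyshev L J 0 a ltac:(lra) ltac:(lra)).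
  set (b := few_plus L J) in *.
  assert (P2 : 0 < 2 ^ L) by (apply pow_lt; lra).
  assert (Hb : b * / 2 ^ L <= INR L / (a * a)).
  { apply (Rmult_le_reg_r (2 ^ L * (a * a))); [repeat apply Rmult_lt_0_compat; lra|].
    replace (b * / 2 ^ L * (2 ^ L * (a * a))) with (b * (a * a)) by (field; lra).
    replace (INR L / (a * a) * (2 ^ L * (a * a))) with (2 ^ L * (0 * 0 + INR L)) by (field; lra). exact HC. }
  assert (Hmain : level_avg n (fun q => ind_le t (Y n q) - b * / 2 ^ L) <=
                  good_frac (n + L) ((1/2) ^ (2 ^ J))).
  { unfold good_frac, level_avg at 2.
    replace (2 ^ (n + L))%nat with (2 ^ n * 2 ^ L)%nat by (now rewrite Nat.pow_add_r).
    rewrite rsum_prod, pow_add, Rinv_mult, Rmult_assoc, <- rsum_scal.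
    unfold level_avg. apply Rmult_le_compat_l; [left; apply inv_pow2_pos|].
    apply rsum_le; intros q Hq.
    set (f := fun r => ind_le ((1/2) ^ (2 ^ J)) (Y (n + L) (q * 2 ^ L + r))).
    assert (0 <= rsum (2 ^ L) f) by (apply rsum_nonneg; intros; apply ind_le_bounds).
    assert (0 < / 2 ^ L) by apply inv_pow2_pos.
    unfold ind_le at 1. destruct (Rle_dec (Y n q) t) as [Hle|].
    - assert (D := descendants_good L n q (Y n q) 0 J Hq).
      assert (By := Y_bounds n q Hq).
      specialize (D ltac:(lra)). simpl pow in D at 1. rewrite Nat.sub_0_r in D. fold b in D.
      assert (D' : rsum (2 ^ L) (fun r => 1 - f r) <= b) by (apply D; simpl; lra).
      rewrite rsum_sub, rsum_const, INR_pow2 in D'.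
      assert (/ 2 ^ L * (2 ^ L * 1 - rsum (2 ^ L) f) <= / 2 ^ L * b) by (apply Rmult_le_compat_l; lra).
      rewrite Rmult_minus_distr_l, <- Rmult_assoc, Rinv_l in H1 by lra. lra.
    - assert (0 <= b).
      { assert (B0 : forall L j, 0 <= few_plus L j).
        { induction L0 as [|L0 IHL]; intros j; simpl; [destruct (Nat.eqb j 0); lra|].
          generalize (IHL j), (IHL (j - 1)%nat). lra. }
        apply B0. }
      nra. }
  assert (level_avg n (fun q => ind_le t (Y n q) - b * / 2 ^ L) = good_frac n t - b * / 2 ^ L) as Hm.
  { unfold good_frac, Rminus. now rewrite level_avg_add, level_avg_const. }
  lra.
Qed.

Lemma INR_le_pow2 k : INR k <= 2 ^ k.
Proof. rewrite <- INR_pow2. apply le_INR. apply Nat.lt_le_incl, Nat.pow_gt_lin_r. lia. Qed.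

(** Serves the lengths [4 k] and [40 (k + 1)] of the first two boosts in [polarization_rate]. *)
Lemma pow2_ge_linear k : (10 <= k)%nat -> (44 * k + 44 <= 2 ^ k)%nat.
Proof.
  intros Hk. induction Hk as [|k Hk IH]; [simpl; lia|]. rewrite Nat.pow_succ_r'. lia.
Qed.

Lemma exists_nat_ge x : exists k, x <= INR k.
Proof.
  destruct (Rle_dec x 0) as [Hx|Hx]; [exists 0%nat; simpl; lra|].
  destruct (archimed x) as [H1 _]. exists (Z.to_nat (up x)).
  rewrite INR_IZR_INZ, Z2Nat.id; [lra|]. apply le_IZR. lra.
Qed.

(* Three boosts, of lengths [4 k], [40 (k + 1)] and [~ n] with [k = log2 n / 10], starting from a level
   [n1 < K = 2^(9 k + 2)] with [unpolarized n1 <= 1 / K]. *)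
Lemma polarization_rate gamma delta : 0 <= gamma < 1/2 -> 0 < delta ->
  exists n0, forall n, (n0 <= n)%nat -> exists J,
    gamma * INR n <= INR J /\ I 0 0%nat - delta <= good_frac n ((1/2) ^ (2 ^ J)).
Proof.
  intros Hg Hd.
  destruct (good_frac_initial (delta / 2) ltac:(lra)) as (C & HC & Hinit).
  (* The gap [1 - 2 gamma] is split in two: one half pays for the levels before the last stretch,
     the other for the Chebyshev deviation on it. *)
  set (kappa := (1 - 2 * gamma) / 2). assert (Hk0 : 0 < kappa) by (unfold kappa; lra).
  assert (Hkk : 0 < / (kappa * kappa)) by (apply Rinv_0_lt_compat, Rmult_lt_0_compat; assumption).
  (* 10 is for [pow2_ge_linear], [6 / kappa] for [n2 <= kappa n], the last entry for the total
     loss. *)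
  destruct (exists_nat_ge (Rmax 10 (Rmax (6 / kappa) (2 * (C + 2 + / (kappa * kappa)) / delta)))) as (k0 & Hk1).
  exists (2 ^ (10 * k0))%nat. intros n Hn.
  set (k := (Nat.log2 n / 10)%nat).
  assert (Hn0 : (0 < n)%nat) by (assert (0 < 2 ^ (10 * k0))%nat by (apply Nat.neq_0_lt_0, Nat.pow_nonzero; lia); lia).
  assert (Hk0k : (k0 <= k)%nat).
  { apply Nat.div_le_lower_bound; [lia|]. rewrite <- (Nat.log2_pow2 (10 * k0)) by lia. now apply Nat.log2_le_mono. }
  destruct (Nat.log2_spec n Hn0) as [Hlo Hhi].
  assert (Hlo' : (2 ^ (10 * k) <= n)%nat).
  { eapply Nat.le_trans; [|apply Hlo]. apply Nat.pow_le_mono_r; [lia|]. apply Nat.Div0.mul_div_le. }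
  assert (Hhi' : (n < 2 ^ (10 * (k + 1)))%nat).
  { eapply Nat.lt_le_trans; [apply Hhi|]. apply Nat.pow_le_mono_r; [lia|].
    assert (Nat.log2 n < 10 * S (Nat.log2 n / 10))%nat by (apply Nat.mul_succ_div_gt; lia). unfold k. lia. }
  assert (HkR : INR k0 <= INR k) by now apply le_INR.
  assert (M1 := Rmax_l 10 (Rmax (6 / kappa) (2 * (C + 2 + / (kappa * kappa)) / delta))).
  assert (M2 := Rmax_r 10 (Rmax (6 / kappa) (2 * (C + 2 + / (kappa * kappa)) / delta))).
  assert (M3 := Rmax_l (6 / kappa) (2 * (C + 2 + / (kappa * kappa)) / delta)).
  assert (M4 := Rmax_r (6 / kappa) (2 * (C + 2 + / (kappa * kappa)) / delta)).
  assert (Hk10 : (10 <= k)%nat) by (apply INR_le; simpl INR; lra).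
  assert (HkC : 2 * (C + 2 + / (kappa * kappa)) <= delta * INR k).
  { apply Rle_trans with (2 * (C + 2 + / (kappa * kappa)) / delta * delta); [apply Req_le; field; lra|].
    rewrite (Rmult_comm delta). apply Rmult_le_compat_r; lra. }
  assert (Hk6 : 6 <= kappa * INR k).
  { apply Rle_trans with (6 / kappa * kappa); [apply Req_le; field; lra|].
    rewrite (Rmult_comm kappa). apply Rmult_le_compat_r; lra. }
  clear M1 M2 M3 M4 Hk1 HkR.
  assert (Hlin := pow2_ge_linear k Hk10).
  assert (Hkpos : 10 <= INR k) by (apply (le_INR 10) in Hk10; simpl in Hk10; lra).
  (* As [1 / eta^2 = 2^(8 k + 2)], this [K] reduces the initial loss to [C / 2^k], yet stays small
     against [n >= 2^(10 k)]. *)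
  set (K := (2 ^ (9 * k + 2))%nat).
  assert (HK : (0 < K)%nat) by (apply Nat.neq_0_lt_0, Nat.pow_nonzero; lia).
  destruct (exists_polarized_level K HK) as (n1 & Hn1 & HE).
  set (eta := (1/2) ^ S (4 * k)).
  assert (Heta : 0 < eta) by (apply pow_lt; lra).
  assert (H0 := Hinit n1 eta Heta).
  assert (Hloss0 : C * unpolarized n1 / (eta * eta) <= C * / INR k).
  { unfold Rdiv. rewrite Rmult_assoc. apply Rmult_le_compat_l; [lra|].
    assert (Ee : / (eta * eta) = 2 ^ (8 * k + 2)).
    { unfold eta. rewrite <- pow_add. replace (S (4 * k) + S (4 * k))%nat with (8 * k + 2)%nat by lia.
      unfold Rdiv. rewrite Rmult_1_l, <- Rinv_pow, Rinv_inv by lra. reflexivity. }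
    rewrite Ee. apply Rle_trans with (/ INR K * 2 ^ (8 * k + 2)).
    - apply Rmult_le_compat_r; [apply pow_le; lra|exact HE].
    - unfold K. rewrite INR_pow2. replace (9 * k + 2)%nat with ((8 * k + 2) + k)%nat by lia.
      rewrite pow_add, Rinv_mult.
      assert (0 < 2 ^ (8 * k + 2)) by (apply pow_lt; lra).
      replace (/ 2 ^ (8 * k + 2) * / 2 ^ k * 2 ^ (8 * k + 2)) with (/ 2 ^ k)
        by (field; split; apply pow_nonzero; lra).
      apply Rinv_le_contravar; [lra|apply INR_le_pow2]. }
  (* [k] plus signs in [4 k] steps with deviation [2 k]: the loss is [1 / k], and the threshold
     drops from [2^-(4 k + 1)] to [2^-(2^k)]. *)
  assert (B1 := good_frac_boost n1 (4 * k) k eta (2 * INR k) (Rle_refl _) ltac:(lra)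
     ltac:(rewrite mult_INR; simpl INR; lra)).
  assert (E1 : INR (4 * k) / (2 * INR k * (2 * INR k)) = / INR k) by (rewrite mult_INR; simpl INR; field; lra).
  rewrite E1 in B1.
  (* The exponent [2^k] suffices for [4 J2] further steps. They raise it to [2^J2 > n], which
     suffices for all remaining levels. *)
  set (J2 := (10 * (k + 1))%nat) in *.
  assert (T2 : (1/2) ^ (2 ^ k) <= (1/2) ^ S (4 * J2)).
  { unfold Rdiv. rewrite Rmult_1_l, <- !Rinv_pow by lra.
    apply Rinv_le_contravar; [apply pow_lt; lra|]. apply Rle_pow; [lra|]. unfold J2. lia. }
  assert (HJ2 : INR k <= INR J2) by (apply le_INR; unfold J2; lia).
  assert (B2 := good_frac_boost (n1 + 4 * k) (4 * J2) J2 _ (2 * INR J2) T2 ltac:(lra)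
     ltac:(rewrite mult_INR; simpl INR; lra)).
  assert (E2 : INR (4 * J2) / (2 * INR J2 * (2 * INR J2)) = / INR J2) by (rewrite mult_INR; simpl INR; field; lra).
  rewrite E2 in B2.
  assert (HiJ2 : / INR J2 <= / INR k) by (apply Rinv_le_contravar; lra).
  set (n2 := (n1 + 4 * k + 4 * J2)%nat) in *.
  assert (Hn2 : INR n2 <= kappa * INR n).
  { assert (Hp : (2 ^ k <= 2 ^ (9 * k))%nat) by (apply Nat.pow_le_mono_r; lia).
    assert (HKe : K = (4 * 2 ^ (9 * k))%nat) by (unfold K; rewrite Nat.pow_add_r; simpl; lia).
    assert (Hle : (n2 <= 6 * 2 ^ (9 * k))%nat) by (unfold n2, J2; lia).
    apply le_INR in Hle. rewrite mult_INR, INR_pow2 in Hle. simpl INR in Hle.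
    assert (Hn' : 2 ^ k * 2 ^ (9 * k) <= INR n).
    { rewrite <- pow_add. replace (k + 9 * k)%nat with (10 * k)%nat by lia. rewrite <- INR_pow2. now apply le_INR. }
    assert (Hpk := INR_le_pow2 k).
    assert (0 < 2 ^ (9 * k)) by (apply pow_lt; lra).
    assert (kappa * (INR k * 2 ^ (9 * k)) <= kappa * INR n).
    { apply Rmult_le_compat_l; [lra|]. eapply Rle_trans; [|apply Hn']. apply Rmult_le_compat_r; lra. }
    assert (6 * 2 ^ (9 * k) <= kappa * INR k * 2 ^ (9 * k)) by (apply Rmult_le_compat_r; lra).
    lra. }
  assert (Hnk : INR k <= INR n).
  { apply le_INR. eapply Nat.le_trans; [|apply Hlo'].
    eapply Nat.le_trans; [apply Nat.lt_le_incl, (Nat.pow_gt_lin_r 2); lia|]. apply Nat.pow_le_mono_r; lia. }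
  assert (Hkap : kappa <= 1/2) by (unfold kappa; lra).
  assert (Hn2n : (n2 <= n)%nat) by (apply INR_le; nra).
  assert (exists J, gamma * INR n <= INR J <= gamma * INR n + 1) as (J & HJ).
  { destruct (archimed (gamma * INR n)) as [U1 U2]. exists (Z.to_nat (up (gamma * INR n))).
    rewrite (INR_IZR_INZ (Z.to_nat _)), Z2Nat.id; [lra|]. apply le_IZR. assert (0 <= gamma * INR n) by nra. lra. }
  exists J. split; [apply HJ|].
  set (L3 := (n - n2)%nat).
  assert (EL3 : INR L3 = INR n - INR n2) by (unfold L3; now apply minus_INR).
  assert (T3 : (1/2) ^ (2 ^ J2) <= (1/2) ^ S L3).
  { unfold Rdiv. rewrite Rmult_1_l, <- !Rinv_pow by lra.
    apply Rinv_le_contravar; [apply pow_lt; lra|]. apply Rle_pow; [lra|]. unfold L3. fold J2 in Hhi'. lia. }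
  assert (Hka : 0 < kappa * INR n) by (apply Rmult_lt_0_compat; lra).
  (* The length is at least [(1 - kappa) n] and [2 J - 2 <= 2 gamma n], which leaves [kappa n] for
     the deviation. *)
  assert (B3 := good_frac_boost n2 L3 J _ (kappa * INR n) T3 Hka ltac:(rewrite EL3; unfold kappa in *; lra)).
  replace (n2 + L3)%nat with n in B3 by (unfold L3; lia).
  assert (E3 : INR L3 / (kappa * INR n * (kappa * INR n)) <= / (kappa * kappa) * / INR k).
  { assert (HL : INR L3 <= INR n) by (rewrite EL3; generalize (pos_INR n2); lra).
    apply Rle_trans with (INR n / (kappa * INR n * (kappa * INR n))).
    - apply Rmult_le_compat_r; [|assumption]. left. apply Rinv_0_lt_compat, Rmult_lt_0_compat; assumption.
    - replace (INR n / (kappa * INR n * (kappa * INR n))) with (/ (kappa * kappa) * / INR n) by (field; split; lra).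
      apply Rmult_le_compat_l; [lra|]. apply Rinv_le_contravar; lra. }
  (* The losses are [C / k] initially, [1 / k] in each of the first two boosts and [1 / (kappa^2 k)]
     in the last; the other [delta / 2] was spent in [good_frac_initial]. *)
  assert (Htot : (C + 2 + / (kappa * kappa)) * / INR k <= delta / 2).
  { apply (Rmult_le_reg_r (INR k)); [lra|]. rewrite Rmult_assoc, Rinv_l by lra. lra. }
  lra.
Qed.
End Polarization.

(** * Rate of decay of the block error probability *)

Lemma card_below_rsum A N : INR (card_below A N) = rsum N (fun k => if A k then 1 else 0).
Proof.
  induction N as [|N IH]; simpl; [reflexivity|].
  rewrite plus_INR, IH. destruct (A N); simpl; ring.
Qed.

Lemma mutinf_const_pos e : 0 < e -> 0 <= mutinf_const e.
Proof.
  intros He. assert (L2 := ln2_pos). unfold mutinf_const, Rdiv.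
  repeat apply Rmult_le_pos; try lra; left; apply Rinv_0_lt_compat; repeat apply Rmult_lt_0_compat; assumption.
Qed.

Lemma exp_ge_sq y : 0 <= y -> y * y / 4 <= exp y.
Proof.
  intros Hy. replace y with (y / 2 + y / 2) at 3 by field. rewrite exp_plus.
  assert (H := exp_ineq1_le (y / 2)). nra.
Qed.

(** [X] stands for [N^g] with [g >= 1/4]. The factor [2 * 2^n] from summing over the indices is paid
    with half of the exponent. *)
Lemma double_exp_decay eps : 0 < eps -> exists n0 : nat, forall n : nat, (n0 <= n)%nat ->
  forall X, exp (INR n * ln 2 / 4) <= X ->
  2 * 2 ^ n * exp (- X * ln 2) <= eps * exp (- (X * ln 2) / 2).
Proof.
  intros He. assert (L2 := ln2_pos). set (l := ln 2) in *.
  (* [exp_ge_sq] gives [X >= (n ln 2)^2 / 64], which is at least [4 n] once [n >= 256 / (ln 2)^2];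
     the second entry absorbs [2 / eps]. *)
  destruct (exists_nat_ge (Rmax (256 / (l * l)) (ln (2 / eps) / l))) as (n0 & Hn0).
  exists n0. intros n Hn X HX.
  assert (M1 := Rmax_l (256 / (l * l)) (ln (2 / eps) / l)).
  assert (M2 := Rmax_r (256 / (l * l)) (ln (2 / eps) / l)).
  apply le_INR in Hn. set (x := INR n) in *.
  assert (H1 : 256 <= l * l * x).
  { replace 256 with (256 / (l * l) * (l * l)) by (field; lra).
    rewrite (Rmult_comm (l * l)). apply Rmult_le_compat_r; nra. }
  assert (H2 : ln (2 / eps) <= l * x).
  { replace (ln (2 / eps)) with (ln (2 / eps) / l * l) by (field; lra).
    rewrite (Rmult_comm l). apply Rmult_le_compat_r; lra. }
  assert (Hx : 0 <= x) by apply pos_INR.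
  assert (H3 : x * l / 4 * (x * l / 4) / 4 <= X).
  { eapply Rle_trans; [apply exp_ge_sq|exact HX]. unfold Rdiv. apply Rmult_le_pos; [nra|lra]. }
  assert (H4 : 4 * x <= X).
  { eapply Rle_trans; [|apply H3]. assert (256 * x <= l * l * x * x) by (apply Rmult_le_compat_r; lra). nra. }
  assert (E1 : 2 ^ n = exp (x * l)).
  { unfold x, l. rewrite <- (exp_ln (2 ^ n)) by (apply pow_lt; lra). f_equal. apply ln_pow. lra. }
  assert (E2 : 2 / eps = exp (ln (2 / eps))) by (rewrite exp_ln; [reflexivity|apply Rdiv_lt_0_compat; lra]).
  rewrite E1.
  replace (- X * l) with (- (X * l) / 2 + - (X * l) / 2) by field. rewrite exp_plus, <- Rmult_assoc.
  apply Rmult_le_compat_r; [left; apply exp_pos|].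
  rewrite Rmult_assoc, <- exp_plus.
  apply Rle_trans with (2 * exp (- ln (2 / eps))).
  - apply Rmult_le_compat_l; [lra|].
    assert (x * l + - (X * l) / 2 <= - ln (2 / eps)) as Hle.
    { assert (4 * x * l <= X * l) by (apply Rmult_le_compat_r; lra). lra. }
    destruct Hle as [Hlt|Heq]; [left; now apply exp_increasing|rewrite Heq; apply Rle_refl].
  - rewrite exp_Ropp, <- E2. apply Req_le. field. lra.
Qed.

Theorem theorem3 (d : nat) (rho : bool -> Mat)
  (Hd0 : density d (rho false)) (Hd1 : density d (rho true))
  (Rt beta : R) (HR : Rt < mutinf d (rho false) (rho true)) (Hb : beta < 1 / 2)
  (A : nat -> nat -> bool)
  (Hcard : forall n : nat,
      INR (card_below (A n) (2 ^ n)) <= INR (2 ^ n) * Rt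
      < INR (card_below (A n) (2 ^ n)) + 1)
  (Hrule : forall n i j : nat, (i < 2 ^ n)%nat -> (j < 2 ^ n)%nat ->
      A n i = true -> A n j = false -> Fsplit rho d n i <= Fsplit rho d n j) :
  forall eps : R, 0 < eps -> exists n0 : nat, forall n : nat, (n0 <= n)%nat ->
    Rabs (Pe rho d n (A n)) <= eps * Rpower 2 (- (1 / 2) * Rpower (INR (2 ^ n)) beta).
Proof.
  intros eps Heps.
  assert (Hrho : forall b, density d (rho b)) by (intros [|]; assumption).
  set (Y := node_avg rho d BCinf). set (I := node_avg rho d mutinf).
  (* [beta] may be negative or tiny, while [polarization_rate] needs [0 <= gamma] and
     [double_exp_decay] needs [X >= N^(1/4)]. *)
  set (g := Rmax beta (1/4)).
  assert (Hg : 1/4 <= g < 1/2) by (unfold g; split; [apply Rmax_r|apply Rmax_lub_lt; lra]).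
  set (delta := mutinf d (rho false) (rho true) - Rt).
  destruct (polarization_rate Y I (node_BCinf_bounds rho d Hrho) (node_BCinf_minus rho d Hrho)
    (node_BCinf_plus rho d Hrho) (node_mutinf_chain rho d Hrho) (node_mutinf_le_1 rho d Hrho)
    (fun e He => ex_intro _ (mutinf_const e) (conj (mutinf_const_pos e He)
       (fun n q Hq => node_mutinf_le_BCinf rho d Hrho n q e Hq He)))
    g (delta / 2) ltac:(lra) ltac:(unfold delta; lra)) as (n1 & Hn1).
  destruct (double_exp_decay eps Heps) as (n2 & Hn2).
  exists (Nat.max n1 n2). intros n Hn.
  destruct (Hn1 n ltac:(lia)) as (J & HJ & Hgood).
  set (thr := (1/2) ^ (2 ^ J)) in *.
  assert (Hthr : 0 < thr) by (apply pow_lt; lra).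
  assert (HI : I 0%nat 0%nat = mutinf d (rho false) (rho true)) by apply node_mutinf_root.
  assert (HN : 0 < 2 ^ n) by (apply pow_lt; lra).
  (* By contradiction: a chosen index with [T > thr] has fidelity above [thr^2], hence by the rule
     so has every index outside the set, and there [Y > thr]. *)
  assert (Hsel : forall k, (k < 2 ^ n)%nat -> A n k = true -> node_avg rho d sfid n k <= thr).
  { intros i Hi HAi. destruct (Rle_dec (node_avg rho d sfid n i) thr) as [|Hbad]; [assumption|exfalso].
    destruct (Fsplit_bounds rho d Hrho n i Hi) as (ti & Ti0 & TiF & TiT & TiY).
    assert (Hall : forall q, (q < 2 ^ n)%nat -> ind_le thr (Y n q) <= if A n q then 1 else 0).
    { intros q Hq. unfold ind_le. destruct (Rle_dec (Y n q) thr) as [HYq|]; [|destruct (A n q); lra].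
      destruct (A n q) eqn:HAq; [lra|exfalso].
      destruct (Fsplit_bounds rho d Hrho n q Hq) as (tq & Tq0 & TqF & TqT & TqY). fold (Y n q) in TqY.
      assert (HF := Hrule n i q Hi Hq HAi HAq). rewrite TiF, TqF in HF. nra. }
    (* So the set contains every index with [Y <= thr], a share of at least [I - delta / 2 > R],
       against its cardinality. *)
    assert (Hcnt : 2 ^ n * good_frac Y n thr <= INR (card_below (A n) (2 ^ n))).
    { unfold good_frac, level_avg. rewrite <- Rmult_assoc, Rinv_r, Rmult_1_l, card_below_rsum by lra.
      now apply rsum_le. }
    destruct (Hcard n) as [Hc _]. rewrite INR_pow2 in Hc.
    assert (2 ^ n * (I 0%nat 0%nat - delta / 2) <= 2 ^ n * good_frac Y n thr) by (apply Rmult_le_compat_l; lra).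
    assert (2 ^ n * Rt < 2 ^ n * (I 0%nat 0%nat - delta / 2)); [|lra].
    apply Rmult_lt_compat_l; [assumption|]. rewrite HI. unfold delta. lra. }
  destruct (Pe_bounds rho d Hrho n (A n)) as [HP0 HP1].
  rewrite Rabs_right by lra.
  eapply Rle_trans; [apply HP1|].
  apply Rle_trans with (2 * 2 ^ n * thr).
  { rewrite Rmult_assoc. apply Rmult_le_compat_l; [lra|].
    rewrite <- INR_pow2, <- rsum_const. apply rsum_le; intros k Hk.
    destruct (A n k) eqn:HAk; [now apply Hsel|lra]. }
  assert (L2 := ln2_pos).
  (* [X = N^g]; since [J >= g n], the threshold is at most [2^-X]. *)
  set (X := exp (g * (INR n * ln 2))).
  assert (HX : exp (INR n * ln 2 / 4) <= X).
  { unfold X. assert (Hle : INR n * ln 2 / 4 <= g * (INR n * ln 2)).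
    { assert (0 <= INR n * ln 2) by (apply Rmult_le_pos; [apply pos_INR|lra]). nra. }
    destruct Hle as [Hlt|Heq]; [left; now apply exp_increasing|rewrite Heq; apply Rle_refl]. }
  assert (HthrX : thr <= exp (- X * ln 2)).
  { assert (Et : thr = exp (- (2 ^ J * ln 2))).
    { unfold thr, Rdiv. rewrite Rmult_1_l, <- Rinv_pow, exp_Ropp by lra. f_equal.
      rewrite <- (INR_pow2 J), <- ln_pow, exp_ln by (try apply pow_lt; lra). reflexivity. }
    assert (EJ : 2 ^ J = exp (INR J * ln 2)).
    { rewrite <- ln_pow, exp_ln by (try apply pow_lt; lra). reflexivity. }
    assert (HXJ : X <= 2 ^ J).
    { rewrite EJ. unfold X. assert (Hle : g * (INR n * ln 2) <= INR J * ln 2) by nra.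
      destruct Hle as [Hlt|Heq]; [left; now apply exp_increasing|rewrite Heq; apply Rle_refl]. }
    rewrite Et. assert (Hle : - (2 ^ J * ln 2) <= - X * ln 2) by nra.
    destruct Hle as [Hlt|Heq]; [left; now apply exp_increasing|rewrite Heq; apply Rle_refl]. }
  apply Rle_trans with (2 * 2 ^ n * exp (- X * ln 2)).
  { apply Rmult_le_compat_l; lra. }
  eapply Rle_trans; [apply (Hn2 n ltac:(lia) X HX)|].
  apply Rmult_le_compat_l; [lra|]. unfold Rpower at 1.
  assert (HXb : Rpower (INR (2 ^ n)) beta <= X).
  { unfold Rpower, X. rewrite INR_pow2, ln_pow by lra.
    assert (Hle : beta * (INR n * ln 2) <= g * (INR n * ln 2)).
    { apply Rmult_le_compat_r; [apply Rmult_le_pos; [apply pos_INR|lra]|apply Rmax_l]. }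
    destruct Hle as [Hlt|Heq]; [left; now apply exp_increasing|rewrite Heq; apply Rle_refl]. }
  assert (Hle : - (X * ln 2) / 2 <= - (1 / 2) * Rpower (INR (2 ^ n)) beta * ln 2) by nra.
  destruct Hle as [Hlt|Heq]; [left; now apply exp_increasing|rewrite Heq; apply Rle_refl].
Qed.
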